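(* Let $L$ be a (Hausdorff) locally compact group, let $G$ be a discrete group in the class $\mathcal G$, and let $\varphi:L\to G$ be an abstract (not necessarily continuous) homomorphism. Then either $\varphi$ is continuous, or there is a finite nontrivial subgroup $F\subseteq G$ such that $\varphi(L)$ is contained in the normalizer of $F$ in $G$.
   Context: $\mathcal G$ is the class of all groups $G$ such that (1) every torsion subgroup of $G$ is finite, and (2) every abelian subgroup of $G$ is a (possibly infinite) direct sum of cyclic groups. *)

(* Defs.v *)
From HB Require Import structures.
From mathcomp Require Import all_boot all_order all_algebra.
From mathcomp Require Import all_classical all_reals all_analysis.
Set Implicit Arguments. Unset Strict Implicit. Unset Printing Implicit Defensive.
Local Open Scope classical_set_scope.

Record is_group (T : Type) (mul : T -> T -> T) (one : T) (inv : T -> T) : Prop := {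
  grp_assoc : forall x y z, mul x (mul y z) = mul (mul x y) z;
  grp_mul1 : forall x, mul one x = x;
  grp_mulV : forall x, mul (inv x) x = one }.

Section GroupNotions.
Variables (T : Type) (mul : T -> T -> T) (one : T) (inv : T -> T).

Definition is_subgroup (H : set T) : Prop :=
  H one /\ (forall x y, H x -> H y -> H (mul x y)) /\ (forall x, H x -> H (inv x)).

Definition gpow (x : T) (n : nat) : T := iter n (mul x) one.
Definition gzpow (x : T) (k : int) : T :=
  match k with Posz n => gpow x n | Negz n => inv (gpow x n.+1) end.

Definition cyc (x : T) : set T := [set gzpow x k | k in [set: int]].

Definition has_finite_order (x : T) : Prop := exists2 n : nat, (0 < n)%N & gpow x n = one.

Definition is_torsion_subgroup (H : set T) : Prop :=
  is_subgroup H /\ forall x, H x -> has_finite_order x.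

Definition is_abelian_subgroup (H : set T) : Prop :=
  is_subgroup H /\ forall x y, H x -> H y -> mul x y = mul y x.

Definition gprod (I : Type) (s : seq I) (y : I -> T) : T :=
  foldr (fun i acc => mul (y i) acc) one s.

Definition is_direct_sum_of_cyclic (H : set T) : Prop :=
  exists (I : eqType) (x : I -> T),
    (forall i, H (x i)) /\
    (forall h, H h -> exists (s : seq I) (y : I -> T),
        uniq s /\ (forall i, i \in s -> cyc (x i) (y i)) /\ h = gprod s y) /\
    (forall (s : seq I) (y : I -> T), uniq s ->
        (forall i, i \in s -> cyc (x i) (y i)) -> gprod s y = one ->
        forall i, i \in s -> y i = one).

Definition in_class_G : Prop :=
  (forall H, is_torsion_subgroup H -> finite_set H) /\
  (forall H, is_abelian_subgroup H -> is_direct_sum_of_cyclic H).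

Definition normalizes (g : T) (F : set T) : Prop :=
  [set mul (mul g f) (inv g) | f in F] = F.

End GroupNotions.

(* Main.v *)
Require Import Defs.
From HB Require Import structures.
From mathcomp Require Import all_boot all_order all_algebra.
From mathcomp Require Import all_classical all_reals all_analysis.
From mathcomp Require Import ring lra zify.
From mathcomp Require Import Rstruct.
Set Implicit Arguments. Unset Strict Implicit. Unset Printing Implicit Defensive.
Import Order.TTheory GRing.Theory Num.Theory.
Import numFieldNormedType.Exports.
Local Open Scope classical_set_scope.

(* The homomorphism f has finite image on some neighbourhood of the identity. Then the
   intersection F of the images of all neighbourhoods of the identity is attained by one of
   them, hence is a finite subgroup, and it is normalized by f(L); if F is trivial, f is locally
   constant.

   On a compact subgroup K the image is finite: the closure of a cyclic group is compact abelian,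
   its image is a direct sum of cyclic groups, and a nonzero integral character of it is excluded
   by a divisibility argument along powers x^(1 + b + b^2 + ...). A one-parameter semigroup is
   killed by f, its image being divisible. So it suffices that L has a neighbourhood of the
   identity of the form (one-parameter semigroups)...(one-parameter semigroups) K with K a
   compact subgroup. This is a local Gleason-Yamabe theorem. Small subgroups are trapped in
   neighbourhoods by Gleason's argument: smoothed functions built from a Haar functional have
   second differences that are small at the time scale on which a set escapes, so that limits
   at that scale are compact groups, to which a gap lemma of Peter-Weyl type applies (elements
   near the identity hardly move the top eigenfunctions of a convolution operator, while a
   subgroup moving them does so by a definite amount). This yields a compact subgroup K which
   is isolated in, and normalized by, a compact neighbourhood U. Modulo K the powers of an
   element escape U at a rate that behaves like a norm, ultralimits of accelerated powers are
   one-parameter semigroups, and finitely many of them approximate every slow element up to an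
   error much slower than itself; iterating exhausts a neighbourhood. *)

(* Group operations get their own symbols: most statements below also involve the ring
   operations of a field of real numbers. *)
Notation "x ∙ y" := (x * y)%g (at level 40, left associativity).
Notation "x ⁻¹" := (x^-1)%g (at level 3, left associativity, format "x ⁻¹").
Notation "x ^^ n" := (x ^+ n)%g (at level 30, no associativity).

Ltac gsimp := rewrite ?(conjgE, invgM, invgK, invg1, mulgA, mulgK, mulgVK, mulgV, mulVg,
  mul1g, mulg1).

(** * Groups *)

Notation zpow := (gzpow *%g 1%g monoid.inv).
Notation cyclic := (cyc *%g 1%g monoid.inv).
Notation finite_order := (has_finite_order *%g 1%g).

Section IntegerPowers.
Variable G : groupType.
Implicit Types (x y : G) (j k : int).

Lemma gpowE x n : gpow *%g 1%g x n = x ^^ n.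
Proof. exact: iter_mulg_1. Qed.

Lemma zpow_nat x n : zpow x n%:Z = x ^^ n.
Proof. exact: gpowE. Qed.

Lemma zpow0 x : zpow x 0 = 1%g.
Proof. by []. Qed.

Lemma zpow1 x : zpow x 1 = x.
Proof. exact: mulg1. Qed.

Lemma zpowN x k : zpow x (- k)%R = (zpow x k)⁻¹.
Proof.
case: k => [[|n]|n]; first by rewrite oppr0 zpow0 invg1.
  by rewrite -NegzE.
by rewrite NegzE opprK /= invgK.
Qed.

Lemma zpow_subn x m n : zpow x (m%:Z - n%:Z)%R = x ^^ m ∙ (x ^^ n)⁻¹.
Proof.
have [le_nm|/ltnW le_mn] := leqP n m; first by rewrite subzn // zpow_nat expgnFr.
by rewrite -opprB subzn // zpowN zpow_nat expgnFr // invgF.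
Qed.

Lemma int_subn k : exists m n : nat, k = (m%:Z - n%:Z)%R.
Proof.
case: k => n; first by exists n, 0%N; rewrite subr0.
by exists 0%N, n.+1; rewrite NegzE sub0r.
Qed.

Lemma zpowD x j k : zpow x (j + k)%R = zpow x j ∙ zpow x k.
Proof.
have [m [n ->]] := int_subn j; have [p [q ->]] := int_subn k.
have -> : (m%:Z - n%:Z + (p%:Z - q%:Z) = (m + p)%N%:Z - (q + n)%N%:Z)%R.
  by rewrite !PoszD; lia.
have comm : commute (x ^^ n)⁻¹ (x ^^ p).
  exact/commute_sym/commuteV/commuteX2.
by rewrite !zpow_subn !expgnDr invgM -!mulgA (mulgA _⁻¹) comm !mulgA.
Qed.

Lemma zpowM x j k : zpow x (j * k)%R = zpow (zpow x j) k.
Proof.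
have zpowMn n : zpow x (j * n%:Z)%R = zpow (zpow x j) n.
  elim: n => [|n IHn]; first by rewrite mulr0.
  by rewrite -addn1 PoszD mulrDr mulr1 !zpowD IHn zpow1.
by case: k => n; [exact: zpowMn|rewrite NegzE mulrN !zpowN zpowMn].
Qed.

Lemma zpow_one k : zpow 1%g k = 1%g :> G.
Proof. by case: k => n; rewrite ?NegzE ?zpowN zpow_nat expg1n ?invg1. Qed.

Lemma finite_orderP x : finite_order x <-> exists2 n, (0 < n)%N & x ^^ n = 1%g.
Proof. by split=> -[n n_gt0 xn]; exists n; rewrite // ?gpowE // -gpowE. Qed.

Lemma zpow_eq1_finite_order x k : zpow x k = 1%g -> k != 0%R -> finite_order x.
Proof.
case: k => n /=; first by case: n => // n xn _; exists n.+1.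
by move=> /eqP; rewrite invg_eq1 => /eqP xn _; exists n.+1.
Qed.

Lemma finite_order1 : finite_order (1%g : G).
Proof. by exists 1%N; rewrite // gpowE. Qed.

Lemma finite_order_zpow x k : finite_order x -> finite_order (zpow x k).
Proof.
move=> [n n_gt0 xn]; exists n; rewrite // gpowE -zpow_nat -zpowM mulrC zpowM zpow_nat.
by rewrite -gpowE xn zpow_one.
Qed.

Lemma finite_orderM x y :
  commute x y -> finite_order x -> finite_order y -> finite_order (x ∙ y).
Proof.
move=> xy /finite_orderP[m m_gt0 xm] /finite_orderP[n n_gt0 yn].
apply/finite_orderP; exists (m * n)%N; first by rewrite muln_gt0 m_gt0.
by rewrite expgMn // expgnA xm expg1n mul1g mulnC expgnA yn expg1n.
Qed.

End IntegerPowers.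

Section Morphisms.
Variables (G G' : groupType) (f : G -> G').
Hypothesis fM : {morph f : x y / x ∙ y}.

Lemma morph_one : f 1%g = 1%g.
Proof. by apply: (@mulIg _ (f 1%g)); rewrite -fM !mul1g. Qed.

Lemma morph_invg x : f x⁻¹ = (f x)⁻¹.
Proof. by apply: (@mulIg _ (f x)); rewrite -fM !mulVg morph_one. Qed.

End Morphisms.

Definition subgrp (G : groupType) (H : set G) : Prop := is_subgroup *%g 1%g monoid.inv H.

Section Subgroups.
Variable G : groupType.
Implicit Types (x y : G) (H : set G) (f : G -> G).

Lemma subgrp1 H : subgrp H -> H 1%g. Proof. by case. Qed.

Lemma subgrpM H x y : subgrp H -> H x -> H y -> H (x ∙ y).
Proof. by move=> [_ [HM _]]; exact: HM. Qed.

Lemma subgrpV H x : subgrp H -> H x -> H x⁻¹.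
Proof. by move=> [_ [_ HV]]; exact: HV. Qed.

Lemma subgrpX H x n : subgrp H -> H x -> H (x ^^ n).
Proof.
by move=> sH Hx; elim: n => [|n IHn]; rewrite ?expgS; [exact: (subgrp1 sH)|exact: subgrpM].
Qed.

Lemma subgrpJ H x y : subgrp H -> H x -> H y -> H (x ^ y)%g.
Proof. by move=> sH Hx Hy; apply: subgrpM => //; [exact: subgrpV|exact: subgrpM]. Qed.

Lemma subgrp_set1 : subgrp [set 1%g : G].
Proof.
by split=> //; split=> [x y /= -> ->|x /= ->]; rewrite ?mul1g ?invg1.
Qed.

Lemma subgrpI H H' : subgrp H -> subgrp H' -> subgrp (H `&` H').
Proof.
move=> sH sH'; split; first by split; exact: subgrp1.
split=> [x y [Hx H'x] [Hy H'y]|x [Hx H'x]]; first by split; exact: subgrpM.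
by split; exact: subgrpV.
Qed.

Lemma subgrp_cyclic x : subgrp (cyclic x).
Proof.
split; first by exists 0%R.
split=> [_ _ [j _ <-] [k _ <-]|_ [k _ <-]]; first by exists (j + k)%R; rewrite ?zpowD.
by exists (- k)%R; rewrite ?zpowN.
Qed.

Lemma cyclicX x n : cyclic x (x ^^ n).
Proof. by exists (Posz n); rewrite ?zpow_nat. Qed.

Lemma cyclic_id x : cyclic x x.
Proof. exact: (cyclicX x 1). Qed.

Lemma cyclic_sub H x : subgrp H -> H x -> cyclic x `<=` H.
Proof.
move=> sH Hx _ [k _ <-]; have [m [n ->]] := int_subn k; rewrite zpow_subn.
by apply: subgrpM => //; [|apply: subgrpV => //]; exact: subgrpX.
Qed.

Lemma cyclic_comm x : {in cyclic x &, forall y z, commute y z}.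
Proof.
by move=> _ _ /set_mem[j _ <-] /set_mem[k _ <-]; rewrite /commute -!zpowD addrC.
Qed.

End Subgroups.

Lemma subgrp_image (G G' : groupType) (f : G -> G') (H : set G) :
  {morph f : x y / x ∙ y} -> subgrp H -> subgrp (f @` H).
Proof.
move=> fM sH; split; first by exists 1%g; [exact: subgrp1|exact: morph_one].
split=> [_ _ [x Hx <-] [y Hy <-]|_ [x Hx <-]].
  by exists (x ∙ y); [exact: subgrpM|exact: fM].
by exists x⁻¹; [exact: subgrpV|exact: morph_invg].
Qed.

Definition setmulg (G : groupType) (A B : set G) : set G := [set a ∙ b | a in A & b in B].
Notation "A `∙` B" := (setmulg A B) (at level 40, left associativity).
Notation "A `^^ n" := (iter n (setmulg A) [set 1%g]) (at level 30, no associativity).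

Definition symmetric (G : groupType) (A : set G) := forall x, A x -> A x⁻¹.

Definition normalised (G : groupType) (U K : set G) :=
  forall u k, U u -> K k -> K (k ^ u)%g.

Section ProductSets.
Variable G : groupType.
Implicit Types (x y : G) (A B K Q U : set G).

Lemma mem_setmulg A B x y : A x -> B y -> (A `∙` B) (x ∙ y).
Proof. by move=> Ax By; exists x => //; exists y. Qed.

Lemma setmulgS A A' B B' : A `<=` A' -> B `<=` B' -> A `∙` B `<=` A' `∙` B'.
Proof. by move=> AA' BB' _ [a /AA' A'a [b /BB' B'b <-]]; exact: mem_setmulg. Qed.

Lemma setmulg1 A : A `∙` [set 1%g] = A.
Proof.
apply/seteqP; split=> [_ [a Aa [_ -> <-]]|a Aa]; first by rewrite mulg1.
by rewrite -[a]mulg1; exact: mem_setmulg.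
Qed.

Lemma setexpg1 Q : Q `^^ 1 = Q.
Proof. exact: setmulg1. Qed.

Lemma setexpgD Q m n x y :
  (Q `^^ m) x -> (Q `^^ n) y -> (Q `^^ (m + n)) (x ∙ y).
Proof.
elim: m x => [|m IHm] x /=; first by move=> ->; rewrite mul1g.
by move=> [q Qq [z Qz <-]] Qy; rewrite -mulgA; apply: mem_setmulg => //; exact: IHm.
Qed.

Lemma setexpg_mem1 Q n : Q 1%g -> (Q `^^ n) 1%g.
Proof. by move=> Q1; elim: n => // n Qn; have := mem_setmulg Q1 Qn; rewrite mulg1. Qed.

Lemma setexpg_le Q m n : Q 1%g -> (m <= n)%N -> Q `^^ m `<=` Q `^^ n.
Proof.
move=> Q1 /subnK <- x Qx; rewrite -[x]mul1g; apply: setexpgD => //; exact: setexpg_mem1.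
Qed.

Lemma setexpg_ge1 Q n : Q 1%g -> (0 < n)%N -> Q `<=` Q `^^ n.
Proof. by move=> Q1 n_gt0; rewrite -{1}(setexpg1 Q); exact: setexpg_le. Qed.

Lemma setexpgV Q n : symmetric Q -> symmetric (Q `^^ n).
Proof.
move=> symQ; elim: n => [|n IHn] x /=; first by move=> ->; rewrite invg1.
move=> [q Qq [y Qy <-]]; rewrite invgM.
have Qq1 : (Q `^^ 1) q⁻¹ by rewrite setexpg1; exact: symQ.
by have := setexpgD (IHn _ Qy) Qq1; rewrite addn1.
Qed.

Lemma setexpgS Q Q' n : Q `<=` Q' -> Q `^^ n `<=` Q' `^^ n.
Proof. by move=> QQ'; elim: n => //= n IHn; exact: setmulgS. Qed.

Lemma setexpgX Q n x : Q x -> (Q `^^ n) (x ^^ n).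
Proof. by move=> Qx; elim: n => // n IHn; rewrite expgS; exact: mem_setmulg. Qed.

Lemma mem_setexpg4 U x y z t : U x -> U y -> U z -> U t -> (U `^^ 4) (x ∙ y ∙ z ∙ t).
Proof.
by move=> Ux Uy Uz Ut; rewrite -!mulgA; do !apply: mem_setmulg => //; rewrite setmulg1.
Qed.

Lemma subgrp_bigcup_setexpg Q : Q 1%g -> symmetric Q -> subgrp (\bigcup_n Q `^^ n).
Proof.
move=> Q1 symQ; split; first by exists 0%N.
split=> [x y [m _ Qx] [n _ Qy]|x [n _ Qx]]; first by exists (m + n)%N => //; exact: setexpgD.
by exists n => //; exact: setexpgV.
Qed.

Lemma normalised_setexpg U K n : normalised U K -> normalised (U `^^ n) K.
Proof.
move=> UK; elim: n => [|n IHn] x k /=; first by move=> ->; rewrite conjg1.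
by move=> [u Uu [y Uy <-]] Kk; rewrite conjgM; apply: IHn => //; exact: UK.
Qed.

Lemma setexpg_exit Q U n : U 1%g -> ~ Q `^^ n `<=` U ->
  exists m, [/\ (m < n)%N, Q `^^ m `<=` U & ~ Q `^^ m.+1 `<=` U].
Proof.
move=> U1; elim: n => [|n IHn] nU; first by case: nU => x /= ->.
have [QU|/IHn[m [mn QU nQU]]] := pselect (Q `^^ n `<=` U); first by exists n.
by exists m; split=> //; exact: ltnW.
Qed.

End ProductSets.

(** * Compactness, ultrafilters and continuity *)

Lemma filter_forall_seq (T : Type) (I : eqType) (F : set_system T) (s : seq I) (P : I -> set T) :
  Filter F -> (forall i, F (P i)) -> F [set x | forall i, i \in s -> P i x].
Proof.
move=> FF FP; elim: s => [|i s IHs]; first exact: filterE.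
apply: filterS2 (FP i) IHs => x Pi Ps j; rewrite inE => /predU1P[->//|].
exact: Ps.
Qed.

Section Ultrafilters.
Variables (I : Type) (F : set_system I).

Lemma ultra_fmap (T : Type) (x : I -> T) : UltraFilter F -> UltraFilter (x @ F).
Proof.
move=> UF; split; first exact: fmap_proper_filter.
move=> G PG sG; apply/seteqP; split=> [A GA|A]; last exact: sG.
have [//|nA] := in_ultra_setVsetC (x @^-1` A) UF.
have : G (A `&` ~` A) by apply: filterI => //; exact: sG.
by rewrite setICr => /filter_not_empty.
Qed.

Lemma ultra_compact_cvg (T : topologicalType) (C : set T) (x : I -> T) :
  UltraFilter F -> compact C -> F [set i | C (x i)] -> exists2 p, C p & x @ F --> p.
Proof.
rewrite compact_ultra => UF cC Cx.
by have [p [Cp xp]] := cC _ (ultra_fmap x UF) Cx; exists p.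
Qed.

Lemma cvg_not_nbhs (T : topologicalType) (O : set T) (x : I -> T) (p : T) :
  ProperFilter F -> F [set i | ~ O (x i)] -> x @ F --> p -> ~ nbhs p O.
Proof.
move=> PF nO xp /xp xO; have {}xO : F [set i | O (x i)] by [].
by have [i []] := filter_ex (filterI nO xO).
Qed.

Lemma ler_cvgr (R : realFieldType) (u v : I -> R) (a b : R) :
  ProperFilter F -> u @ F --> a -> v @ F --> b -> F [set i | (u i <= v i)%R] -> (a <= b)%R.
Proof.
move=> PF ua vb uv; rewrite -subr_ge0; apply: (cvgr_to_ge (cvgB vb ua)).
by apply: filterS uv => i uv /=; rewrite subr_ge0.
Qed.

Lemma ultra_bounded_cvg (R : realType) (u : I -> R) (B : R) :
  UltraFilter F -> F [set i | (`|u i| <= B)%R] -> exists p : R, u @ F --> p.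
Proof.
move=> UF uB.
have [|p _ up] := ultra_compact_cvg (x := u) UF (@segment_compact R (- B)%R B); last by exists p.
by apply: filterS uB => i /=; rewrite in_itv /= ler_norml.
Qed.

Lemma directed_ultrafilter (le : I -> I -> Prop) (i0 : I) :
  (forall i, le i i) -> (forall i j k, le i j -> le j k -> le i k) ->
  (forall i j, exists2 k, le i k & le j k) ->
  exists G : set_system I, UltraFilter G /\ forall i, G [set j | le i j].
Proof.
move=> le_refl le_trans dir.
have PF : ProperFilter (filter_from [set: I] (fun i => [set j | le i j])).
  apply: filter_from_proper; last by move=> i _; exists i; exact: le_refl.
  apply: filter_from_filter; first by exists i0.
  move=> i j _ _; have [k ik jk] := dir i j; exists k => // l /= kl.
  by split; apply: le_trans kl.
by have [G [UG sG]] := ultraFilterLemma PF; exists G; split=> // i; apply: sG; exists i.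
Qed.

End Ultrafilters.

Lemma nat_ultrafilter : exists F : set_system nat,
  UltraFilter F /\ forall i, F [set j | (i <= j)%N].
Proof.
have [F [UF sF]] := @ultraFilterLemma nat \oo _.
by exists F; split=> // i; apply: sF; exact: nbhs_infty_ge.
Qed.

Lemma nbhs_ultrafilter (T : topologicalType) (x : T) : exists F : set_system (set T),
  UltraFilter F /\ forall V, nbhs x V -> F [set W | nbhs x W /\ W `<=` V].
Proof.
have [F [UF sF]] := @ultraFilterLemma _ (powerset_filter_from (nbhs x)) _.
by exists F; split=> // V nV; apply: sF; exact: powerset_filter_fromP.
Qed.

Lemma harmonic_eventually_small (R : realType) (F : set_system nat) (e : R) :
  Filter F -> (forall i, F [set j | (i <= j)%N]) -> (0 < e)%R ->
  F [set n | (n.+1%:R^-1 <= e)%R].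
Proof.
move=> FF Fge e_gt0; have [N _ Ne] := near_infty_natSinv_lt (PosNum e_gt0).
by apply: filterS (Fge N) => n /= Nn; apply: ltW; exact: (Ne n).
Qed.

Section CompactSets.
Variable T : topologicalType.
Implicit Types (x y : T) (A C O : set T).

Lemma closure_sub_closed A C : closed C -> A `<=` C -> closure A `<=` C.
Proof. by move=> cC AC x /(closureS AC) /cC. Qed.

Lemma compact_finite_cover C (f : T -> set T) :
  compact C -> (forall x, C x -> nbhs x (f x)) ->
  exists s : seq T, (forall x, x \in s -> C x) /\
    forall y, C y -> exists2 x, x \in s & f x y.
Proof.
move=> cC fC; apply: contrapT => no.
have /choice[y yP] (s : seq T) : exists y, C y /\ forall x, x \in s -> C x -> ~ f x y.
  apply: contrapT => ns; apply: no; exists [seq x <- s | `[< C x >]].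
  split=> [x|y Cy]; first by rewrite mem_filter => /andP[/asboolP].
  apply: contrapT => ny; apply: ns; exists y; split=> // x xs Cx fxy; apply: ny.
  by exists x => //; rewrite mem_filter xs andbT; exact/asboolP.
have [s|s t u st tu x /st /tu|s t|F [UF FP]] //=
    := @directed_ultrafilter (seq T) (fun s t => {subset s <= t}) [::].
  by exists (s ++ t) => x xs; rewrite mem_cat xs ?orbT.
have [|p Cp yp] := ultra_compact_cvg (x := y) UF cC.
  by apply: filterE => s; exact: (yP s).1.
apply: (cvg_not_nbhs _ _ yp) (fC p Cp); apply: filterS (FP [:: p]) => s ps.
by apply: (yP s).2 => //; apply: ps; exact: mem_head.
Qed.

Lemma compact_decreasing_sub (Q : nat -> set T) C O :
  compact C -> (forall n, closed (Q n)) -> (forall n, Q n `<=` C) ->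
  (forall m n, (m <= n)%N -> Q n `<=` Q m) ->
  (forall x, (forall n, Q n x) -> nbhs x O) -> exists n, Q n `<=` O.
Proof.
move=> cC clQ QC dQ QO; apply: contrapT => nQ.
have /choice[x xP] : forall n, exists x, Q n x /\ ~ O x.
  move=> n; apply: contrapT => nx; apply: nQ; exists n => y Qy.
  by apply: contrapT => nO; apply: nx; exists y.
have [F [UF Fge]] := nat_ultrafilter.
have [|p Cp xp] := ultra_compact_cvg (x := x) UF cC.
  by apply: filterE => i; apply: QC (xP i).1.
have /QO : forall n, Q n p.
  move=> n; apply: closed_cvg xp; first exact: clQ.
  by apply: filterS (Fge n) => i /= ni; apply: dQ ni _ (xP i).1.
by apply: (cvg_not_nbhs _ _ xp); apply: filterE => i; exact: (xP i).2.
Qed.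

End CompactSets.

Section ContinuityRules.
Variables (X Y Z : topologicalType) (R : realType).
Implicit Types f g : X -> R.

Lemma continuous_idfun : continuous (fun x : X => x).
Proof. by move=> x. Qed.

Lemma continuous_compT (h : Y -> Z) (k : X -> Y) :
  continuous h -> continuous k -> continuous (fun x => h (k x)).
Proof. by move=> ch ck x; apply: (@continuous_comp _ _ _ k h); [exact: ck|exact: ch]. Qed.

Lemma continuous_pairT (h : X -> Y) (k : X -> Z) :
  continuous h -> continuous k -> continuous (fun x => (h x, k x)).
Proof. by move=> ch ck x; apply: cvg_pair; [exact: ch|exact: ck]. Qed.

Lemma continuous_fstT (h : X -> Y * Z) : continuous h -> continuous (fun x => (h x).1).
Proof.
by move=> ch x; apply: (@continuous_comp _ _ _ h fst); [exact: ch|exact: cvg_fst].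
Qed.

Lemma continuous_sndT (h : X -> Y * Z) : continuous h -> continuous (fun x => (h x).2).
Proof.
by move=> ch x; apply: (@continuous_comp _ _ _ h snd); [exact: ch|exact: cvg_snd].
Qed.

Lemma continuous_addT f g : continuous f -> continuous g -> continuous (fun x => f x + g x)%R.
Proof. by move=> cf cg x; apply: cvgD; [exact: cf|exact: cg]. Qed.

Lemma continuous_subT f g : continuous f -> continuous g -> continuous (fun x => f x - g x)%R.
Proof. by move=> cf cg x; apply: cvgB; [exact: cf|exact: cg]. Qed.

Lemma continuous_mulT f g : continuous f -> continuous g -> continuous (fun x => f x * g x)%R.
Proof. by move=> cf cg x; apply: cvgM; [exact: cf|exact: cg]. Qed.

Lemma continuous_invT f :
  (forall x, f x != 0)%R -> continuous f -> continuous (fun x => (f x)^-1)%R.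
Proof. by move=> f0 cf x; apply: cvgV => //; exact: cf. Qed.

Lemma continuous_maxT f g :
  continuous f -> continuous g -> continuous (fun x => Num.max (f x) (g x))%R.
Proof. by move=> cf cg x; apply: (@continuous_max R X f g); [exact: cf|exact: cg]. Qed.

Lemma continuous_sumT (I : Type) (s : seq I) (F : I -> X -> R) :
  (forall i, continuous (F i)) -> continuous (fun x => \sum_(i <- s) F i x)%R.
Proof.
move=> cF; elim: s => [|i s IHs].
  by under eq_fun do rewrite big_nil; exact: cst_continuous.
by under eq_fun do rewrite big_cons; exact: continuous_addT.
Qed.

Lemma preimage_nbhs (h : X -> Y) a (O : set Y) :
  continuous h -> nbhs (h a) O -> nbhs a (h @^-1` O).
Proof. by move=> ch nO; exact: ch. Qed.

End ContinuityRules.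

(** * Locally compact groups *)

HB.structure Definition PreTopologicalGroup := {G of Topological G & Group G}.

HB.mixin Record PreTopologicalGroup_isLocallyCompact G of PreTopologicalGroup G := {
  mulg_continuous : continuous (fun p : G * G => p.1 ∙ p.2);
  invg_continuous : continuous (fun x : G => x⁻¹);
  lcgroup_hausdorff : hausdorff_space G;
  lcgroup_locally_compact : locally_compact [set: G] }.

#[short(type="lcGroupType")]
HB.structure Definition LCGroup :=
  {G of PreTopologicalGroup_isLocallyCompact G & PreTopologicalGroup G}.

Section GroupContinuity.
Variable L : lcGroupType.

Lemma cvg_mulg (I : Type) (F : set_system I) {FF : Filter F} (x y : I -> L) a b :
  x @ F --> a -> y @ F --> b -> (x i ∙ y i) @[i --> F] --> a ∙ b.
Proof.
move=> xa yb.
apply: (@cvg_comp _ _ _ (fun i => (x i, y i)) (fun p : L * L => p.1 ∙ p.2)).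
  exact: (cvg_pair xa yb).
exact: (@mulg_continuous L (a, b)).
Qed.

Lemma cvg_invg (I : Type) (F : set_system I) {FF : Filter F} (x : I -> L) a :
  x @ F --> a -> (x i)⁻¹ @[i --> F] --> a⁻¹.
Proof. by move=> xa; apply: (cvg_comp _ _ xa); exact: (@invg_continuous L a). Qed.

Lemma cvg_expg (I : Type) (F : set_system I) {FF : Filter F} (x : I -> L) a n :
  x @ F --> a -> (x i ^^ n) @[i --> F] --> a ^^ n.
Proof.
move=> xa; elim: n => [|n IHn]; first exact: cvg_cst.
by rewrite expgS; under eq_fun do rewrite expgS; exact: cvg_mulg.
Qed.

Lemma cvgg_unique (I : Type) (F : set_system I) (x : I -> L) (p q : L) :
  ProperFilter F -> x @ F --> p -> x @ F --> q -> p = q.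
Proof. by move=> PF xp xq; exact: (@cvg_unique L (@lcgroup_hausdorff L) _ _ _ _ xp xq). Qed.

Variable X : topologicalType.
Implicit Types f g : X -> L.

Lemma continuous_mulg f g : continuous f -> continuous g -> continuous (fun x => f x ∙ g x).
Proof. by move=> cf cg x; apply: cvg_mulg; [exact: cf|exact: cg]. Qed.

Lemma continuous_invg f : continuous f -> continuous (fun x => (f x)⁻¹).
Proof. by move=> cf x; apply: cvg_invg; exact: cf. Qed.

Lemma continuous_expg f n : continuous f -> continuous (fun x => f x ^^ n).
Proof. by move=> cf x; apply: cvg_expg; exact: cf. Qed.

Lemma continuous_conjg f g :
  continuous f -> continuous g -> continuous (fun x => (f x) ^ (g x))%g.
Proof.
move=> cf cg; apply: continuous_mulg; first exact: continuous_invg.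
exact: continuous_mulg.
Qed.

End GroupContinuity.

Ltac continuity := lazymatch goal with
  | |- continuous (fun _ => ?c) => exact: cst_continuous
  | |- continuous (fun x => x) => exact: continuous_idfun
  | |- continuous (fun x => (@?f x) ∙ (@?g x)) => apply: continuous_mulg; continuity
  | |- continuous (fun x => (@?f x)⁻¹) => apply: continuous_invg; continuity
  | |- continuous (fun x => (@?f x) ^^ _) => apply: continuous_expg; continuity
  | |- continuous (fun x => ((@?f x) ^ (@?g x))%g) => apply: continuous_conjg; continuity
  | |- continuous (fun x => (@?f x - @?g x)%R) => apply: continuous_subT; continuity
  | |- continuous (fun x => (@?f x + @?g x)%R) => apply: continuous_addT; continuity
  | |- continuous (fun x => (@?f x * @?g x)%R) => apply: continuous_mulT; continuity
  | |- continuous (fun x => Num.max (@?f x) (@?g x)) => apply: continuous_maxT; continuity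
  | |- continuous (fun x => (@?f x, @?g x)) => apply: continuous_pairT; continuity
  | |- continuous (fun x => (@?f x).1) => apply: continuous_fstT; continuity
  | |- continuous (fun x => (@?f x).2) => apply: continuous_sndT; continuity
  | |- continuous fst => exact: (continuous_fstT (@continuous_idfun _))
  | |- continuous snd => exact: (continuous_sndT (@continuous_idfun _))
  | |- continuous monoid.inv => exact: invg_continuous
  | |- continuous (monoid.mul ?z) =>
      exact: (continuous_mulg (@cst_continuous _ _ z) (@continuous_idfun _))
  | |- continuous (pair ?z) =>
      exact: (continuous_pairT (@cst_continuous _ _ z) (@continuous_idfun _))
  | ch : continuous ?h |- continuous ?h => exact: ch
  | ch : continuous ?h |- continuous (fun x => ?h (@?k x)) =>
      apply: (continuous_compT ch); continuity
  end.

Section GroupTopology.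
Variable L : lcGroupType.
Implicit Types (x y z : L) (A B C H K U V W O : set L).

Lemma compact_closedg C : compact C -> closed C.
Proof. by move=> cC; apply: compact_closed => //; exact: lcgroup_hausdorff. Qed.

Lemma nbhs_mulgV x V : nbhs 1%g V -> nbhs x [set y | V (y ∙ x⁻¹)].
Proof.
move=> nV; apply: (@preimage_nbhs _ _ (fun y => y ∙ x⁻¹)); first by continuity.
by rewrite mulgV.
Qed.

Lemma nbhs_mulVg x V : nbhs 1%g V -> nbhs x [set y | V (x⁻¹ ∙ y)].
Proof.
move=> nV; apply: (@preimage_nbhs _ _ (fun y => x⁻¹ ∙ y)); first by continuity.
by rewrite mulVg.
Qed.

Lemma nbhs_invg V : nbhs 1%g V -> nbhs (1%g : L) [set x | V x⁻¹].
Proof.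
by move=> nV; apply: (@preimage_nbhs _ _ monoid.inv); [continuity|rewrite invg1].
Qed.

Lemma nbhs_symmetric U : nbhs 1%g U -> exists W, [/\ nbhs 1%g W, symmetric W & W `<=` U].
Proof.
move=> nU; exists (U `&` [set x | U x⁻¹]); split; last by move=> x [].
  by apply: filterI => //; exact: nbhs_invg.
by move=> x [Ux Vx]; split=> //=; rewrite invgK.
Qed.

Lemma nbhs_half U : nbhs 1%g U ->
  exists W, [/\ nbhs 1%g W, symmetric W & W `∙` W `<=` U].
Proof.
move=> nU.
have [[A B] [/= nA nB] AB] : nbhs (1%g, 1%g) [set p : L * L | U (p.1 ∙ p.2)].
  apply: (@preimage_nbhs _ _ (fun p : L * L => p.1 ∙ p.2)); first by continuity.
  by rewrite mulg1.
have [W [nW symW WAB]] := nbhs_symmetric (filterI nA nB).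
by exists W; split=> // _ [x /WAB[Ax _] [y /WAB[_ By] <-]]; exact: (AB (x, y)).
Qed.

Lemma nbhs_compact_symmetric U : nbhs 1%g U ->
  exists C, [/\ compact C, nbhs 1%g C, symmetric C & C `<=` U].
Proof.
move=> nU; have [B nB [cB clB]] := @lcgroup_locally_compact L 1%g I.
have {}nB : nbhs 1%g B by move: nB; rewrite /within /=; apply: filterS => x; exact.
have [W [nW symW WU]] := nbhs_half (filterI nU nB).
have clW : closure W `<=` U `&` B.
  move=> x /(_ _ (nbhs_mulgV x nW)) [w [Ww Wxw]].
  by rewrite -(mulgVK w x) -[x ∙ _]invgK invgF; apply: WU; exact: mem_setmulg (symW _ Wxw) Ww.
exists (closure W `&` [set x | closure W x⁻¹]); split.
- apply: (subclosed_compact _ cB) => [|x [/clW[]]//].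
  apply: closedI; first exact: closed_closure.
  apply: (preimage_closed (f := @monoid.inv L)); last exact: closed_closure.
  by move=> x _; exact: invg_continuous.
- by apply: filterS nW => x Wx; split; apply: subset_closure => //; exact: symW.
- by move=> x [? ?]; split=> //=; rewrite invgK.
- by move=> x [/clW[]].
Qed.

Lemma nbhs_prod_compact (X T : topologicalType) (g : L * X -> T) (C : set X) (O : set T) :
  continuous g -> compact C -> (forall c, C c -> nbhs (g (1%g, c)) O) ->
  exists2 W, nbhs (1%g : L) W & forall w c, W w -> C c -> O (g (w, c)).
Proof.
move=> cg /compact_near_coveringP cC gO.
exists [set w | C `<=` [set c | O (g (w, c))]]; last by move=> w c /= CO /CO.
apply: (cC L (nbhs (1%g : L)) (fun w c => O (g (w, c)))) => c Cc.
have [[A B] [nA nB] AB] := preimage_nbhs (a := (1%g, c)) cg (gO c Cc).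
by exists (B, A) => // -[c' w] [Bc Aw]; exact: (AB (w, c')).
Qed.

Lemma compact_setmulg A B : compact A -> compact B -> compact (A `∙` B).
Proof.
move=> cA cB; rewrite (_ : A `∙` B = (fun p : L * L => p.1 ∙ p.2) @` (A `*` B)).
  apply: continuous_compact; last exact: compact_setX.
  by apply: continuous_subspaceT; exact: mulg_continuous.
apply/seteqP; split=> [_ [a Aa [b Bb <-]]|_ [[a b] [/= Aa Bb] <-]].
  by exists (a, b).
exact: mem_setmulg.
Qed.

Lemma compact_setexpg A n : compact A -> compact (A `^^ n).
Proof.
by move=> cA; elim: n => [|n IHn] /=; [exact: compact_set1|exact: compact_setmulg].
Qed.

Lemma closure_subgrp H : subgrp H -> subgrp (closure H).
Proof.
move=> sH; split; first by apply: subset_closure; exact: subgrp1.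
split=> [x y cx cy V nV|x cx V nV].
  have [[X Y] [/= nX nY] XY] : nbhs (x, y) [set p : L * L | V (p.1 ∙ p.2)].
    by apply: (@preimage_nbhs _ _ (fun p : L * L => p.1 ∙ p.2)); first by continuity.
  have [a [Ha Xa]] := cx _ nX; have [b [Hb Yb]] := cy _ nY.
  by exists (a ∙ b); split; [exact: subgrpM|exact: (XY (a, b))].
have [a [Ha Va]] := cx [set z | V z⁻¹] (preimage_nbhs (@invg_continuous L) nV).
by exists a⁻¹; split=> //; exact: subgrpV.
Qed.

Lemma compact_closure_sub C A : compact C -> A `<=` C -> compact (closure A).
Proof.
move=> cC AC; apply: (subclosed_compact _ cC); first exact: closed_closure.
by apply: closure_sub_closed => //; exact: compact_closedg.
Qed.

Lemma closed_expg_in C n : closed C -> closed [set x | C (x ^^ n)].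
Proof.
move=> clC; apply: (@preimage_closed _ _ (fun x : L => x ^^ n)) => // x _.
by apply: (@continuous_expg L L id) => z.
Qed.

Lemma closed_commute y : closed [set x | commute x y].
Proof.
rewrite (_ : [set x | _] = [set x | [set 1%g] (x ∙ y ∙ (y ∙ x)⁻¹)]).
  apply: (@preimage_closed _ _ (fun x : L => x ∙ y ∙ (y ∙ x)⁻¹)).
    by move=> x _; move: x; continuity.
  by apply: compact_closedg; exact: compact_set1.
apply/seteqP; split=> x /=; first by move=> ->; rewrite mulgV.
by move=> xy; apply: (@mulIg _ (y ∙ x)⁻¹); rewrite xy mulgV.
Qed.

Lemma closure_commute A : (forall x y, A x -> A y -> commute x y) ->
  forall x y, closure A x -> closure A y -> commute x y.
Proof.
move=> comm x y cx cy; have comm_l z : A z -> commute x z.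
  move=> Az; apply: (closure_sub_closed (@closed_commute z)) cx => w Aw.
  exact: comm.
apply: commute_sym; apply: (closure_sub_closed (@closed_commute x)) cy => z Az.
exact: commute_sym (comm_l z Az).
Qed.

Lemma set_nbhs_setmulg W K : nbhs 1%g W -> set_nbhs K (W `∙` K).
Proof.
move=> nW k Kk; apply: filterS (nbhs_mulgV k nW) => y /= Wy.
by rewrite -(mulgVK k y); exact: mem_setmulg.
Qed.

Lemma set_nbhs_compact K O : compact K -> set_nbhs K O ->
  exists2 W, nbhs 1%g W & W `∙` K `<=` O.
Proof.
move=> cK KO.
have [|k Kk|W nW WK] := @nbhs_prod_compact L L (fun p => p.1 ∙ p.2) _ O _ cK.
- by continuity.
- by rewrite mul1g; exact: KO.
- by exists W => // _ [w Ww [k Kk <-]]; exact: WK.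
Qed.

Lemma nbhs_conjg_compact C V : compact C -> nbhs 1%g V ->
  exists2 W, nbhs 1%g W & forall w c, W w -> C c -> V (w ^ c)%g.
Proof.
move=> cC nV; apply: (@nbhs_prod_compact L L (fun p => p.1 ^ p.2)%g) => //.
  by continuity.
by move=> c Cc; rewrite conj1g.
Qed.

End GroupTopology.

Section Thickening.
Variables (L : lcGroupType) (K : set L).
Hypotheses (cK : compact K) (sK : subgrp K).
Implicit Types (V W O : set L).

Lemma setexpg_thickening n V : nbhs 1%g V ->
  exists2 W, nbhs 1%g W & (K `∙` W `∙` K) `^^ n `<=` V `∙` K.
Proof.
elim: n V => [|n IHn] V nV.
  exists V => // _ ->; rewrite -(mulg1 1%g).
  by apply: mem_setmulg; [exact: nbhs_singleton|exact: subgrp1].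
have [V1 [nV1 _ V1V]] := nbhs_half nV.
have [V2 nV2 V2V1] := nbhs_conjg_compact cK nV1.
have [W nW WV2] := IHn _ nV2.
exists (W `&` V2); first exact: filterI.
move=> _ [_ [_ [k1 Kk1 [w [Ww V2w] <-]] [k2 Kk2 <-]] [y Wy <-]].
have {Wy} [v V2v [k3 Kk3 <-]] : (V2 `∙` K) y.
  apply: WV2; apply: setexpgS Wy.
  by apply: setmulgS => //; apply: setmulgS => // ? [].
have Kk12 := subgrpM sK Kk1 Kk2.
have -> : k1 ∙ w ∙ k2 ∙ (v ∙ k3) =
    (w ^ (k1⁻¹))%g ∙ (v ^ ((k1 ∙ k2)⁻¹))%g ∙ (k1 ∙ k2 ∙ k3).
  by gsimp.
apply: mem_setmulg; last exact: subgrpM.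
by apply: V1V; apply: mem_setmulg; apply: V2V1 => //; exact: subgrpV.
Qed.

Lemma compact_thickening n O : set_nbhs K O ->
  exists U, [/\ compact U, symmetric U, set_nbhs K U,
    K `∙` U `∙` K `<=` U & U `^^ n `<=` O].
Proof.
move=> KO; have [V nV VO] := set_nbhs_compact cK KO.
have [W nW WV] := setexpg_thickening n nV.
have [C [cC nC symC CW]] := nbhs_compact_symmetric nW.
exists (K `∙` C `∙` K); split.
- by do !apply: compact_setmulg.
- move=> _ [_ [k Kk [c Cc <-]] [k' Kk' <-]]; rewrite !invgM mulgA.
  by apply: mem_setmulg; [apply: mem_setmulg => //; [|exact: symC]|]; exact: subgrpV.
- move=> k Kk; apply: filterS (set_nbhs_setmulg nC Kk); apply: setmulgS => // c Cc.
  by rewrite -[c]mul1g; apply: mem_setmulg => //; exact: subgrp1.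
- move=> _ [_ [a Ka [_ [_ [k Kk [c Cc <-]] [k' Kk' <-]] <-]] [b Kb <-]].
  rewrite !mulgA -(mulgA _ k' b).
  by apply: mem_setmulg; [apply: mem_setmulg => //|]; exact: subgrpM.
- apply: subset_trans VO; apply: subset_trans WV; apply: setexpgS.
  by apply: setmulgS => //; exact: setmulgS.
Qed.

End Thickening.

(** * Continuous functions on locally compact groups *)

Section RealFunctions.
Variable R : realType.
Local Open Scope ring_scope.

Lemma bump_function (X : topologicalType) (x : X) (V : set X) :
  locally_compact [set: X] -> hausdorff_space X -> nbhs x V ->
  exists b : X -> R,
    [/\ continuous b, (forall y, 0 <= b y <= 1), b x = 1 & forall y, ~ V y -> b y = 0].
Proof.
move=> lcX hX nV.
have clB : closed (~` V°) by apply: open_closedC; exact: open_interior.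
have nBx : ~ (~` V°) x by apply.
have /(@uniform_separatorP X R)[f [cf f01 fx fV]] :=
  @locally_compact_completely_regular X R lcX hX x _ clB nBx.
exists (fun y => 1 - f y); split.
- by apply: continuous_subT => //; exact: cst_continuous.
- move=> y; have /= := f01 (f y) (ex_intro2 _ _ y I erefl).
  by rewrite in_itv /= => /andP[? ?]; apply/andP; split; lra.
- by rewrite (fx (f x)) ?subr0 //; exists x.
- move=> y nVy; rewrite (fV (f y)) ?subrr //; exists y => // /interior_subset.
  exact: nVy.
Qed.

Lemma compact_bounded_fun (X : topologicalType) (g : X -> R) (C : set X) :
  compact C -> continuous g -> exists2 B, 0 <= B & forall x, C x -> `|g x| <= B.
Proof.
move=> cC cg; have cgC : compact (g @` C).
  by apply: continuous_compact => //; exact: continuous_subspaceT.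
have [M [_ MB]] := compact_bounded cgC.
exists (`|M| + 1) => [|x Cx]; first by rewrite addr_ge0.
apply: (MB (`|M| + 1)); last by exists x.
by rewrite (le_lt_trans (ler_norm _)) // ltrDl.
Qed.

Lemma nbhs_ltr (X : topologicalType) (g : X -> R) (c : R) (x : X) :
  continuous g -> c < g x -> nbhs x [set y | c < g y].
Proof.
move=> cg cgx; apply: (@preimage_nbhs X R g x [set r | c < r]) => //.
by apply: open_nbhs_nbhs; split=> //; exact: open_gt.
Qed.

End RealFunctions.

Section UniformContinuity.
Variables (R : realType) (L : lcGroupType).
Local Open Scope ring_scope.
Implicit Types (b : L -> R) (C : set L).

Lemma unif_cont_near1 (X : topologicalType) (F : L * X -> R) (C : set X) (e : R) :
  continuous F -> compact C -> 0 < e ->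
  exists2 W, nbhs 1%g W & forall w c, W w -> C c -> `|F (w, c) - F (1%g, c)| <= e.
Proof.
move=> cF cC e_gt0.
have [|c Cc|W nW WC] := @nbhs_prod_compact L X R (fun p => F p - F (1%g, p.2)) C
    [set r | `|r| <= e] _ cC; last by exists W => // w c; exact: WC.
  by continuity.
rewrite /= subrr; apply: filterS (nbhsx_ballx (0 : R^o) e e_gt0) => r.
by rewrite /ball /= sub0r normrN => /ltW.
Qed.

Definition left_unif_cont b := forall e : R, 0 < e ->
  exists2 W, nbhs 1%g W & forall w y, W w -> `|b (w ∙ y) - b y| <= e.

Lemma compact_support_left_unif_cont b C :
  continuous b -> compact C -> (forall x, ~ C x -> b x = 0) -> left_unif_cont b.
Proof.
move=> cb cC b0 e e_gt0.
have [|W nW WC] := unif_cont_near1 (F := fun p => b (p.1 ∙ p.2)) _ cC e_gt0.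
  by continuity.
have [V [nV symV VW]] := nbhs_symmetric nW; exists V => // w y Vw.
have [Cy|nCy] := pselect (C y); first by rewrite -{2}(mul1g y); exact: WC (VW _ Vw) Cy.
have [Cwy|nCwy] := pselect (C (w ∙ y)); last by rewrite !b0 // subrr normr0 ltW.
by have := WC _ _ (VW _ (symV _ Vw)) Cwy; rewrite /= mulKg mul1g distrC.
Qed.

Lemma left_unif_cont_continuous b : left_unif_cont b -> continuous b.
Proof.
move=> ub x; apply/(@cvgrPdist_le R R^o) => e e_gt0.
have [W nW We] := ub e e_gt0.
apply: filterS (nbhs_mulgV x nW) => y /= Wy.
by have := We _ x Wy; rewrite mulgVK distrC.
Qed.

End UniformContinuity.

(** * The Haar functional of a closed subgroup *)

Section CompactSupport.
Variables (R : realType) (L : lcGroupType) (H : set L).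
Hypotheses (sH : subgrp H) (clH : closed H).
Local Open Scope ring_scope.
Implicit Types (h g psi : L -> R).

(* Functions on [H] are represented by functions on [L]; only their values on [H] matter. *)
Definition compact_support h := exists C, [/\ compact C, C `<=` H &
  forall x, H x -> ~ C x -> h x = 0].

Definition Cc h := continuous h /\ compact_support h.

Definition Cc_ge0 h := Cc h /\ forall x, 0 <= h x.

Definition bump psi := [/\ continuous psi, (forall x, 0 <= psi x <= 1) & psi 1%g = 1].

Lemma Cc_of_zeros h g : continuous g -> Cc h -> (forall x, H x -> h x = 0 -> g x = 0) -> Cc g.
Proof.
move=> cg [_ [C [cC CH h0]]] hg; split=> //; exists C; split=> // x Hx nC.
by apply: hg => //; exact: h0.
Qed.

Lemma CcD h g : Cc h -> Cc g -> Cc (fun x => h x + g x).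
Proof.
move=> [ch [C [cC CH h0]]] [cg [D [cD DH g0]]]; split; first by continuity.
exists (C `|` D); split; first exact: compactU.
  by move=> x [/CH|/DH].
by move=> x Hx nCD; rewrite h0 ?g0 ?addr0 // => ?; apply: nCD; [right|left].
Qed.

Lemma CcM h g : Cc h -> continuous g -> Cc (fun x => h x * g x).
Proof.
move=> Ch cg; have [ch _] := Ch; apply: Cc_of_zeros (Ch) _; first by continuity.
by move=> x _ ->; rewrite mul0r.
Qed.

Lemma CcZ a h : Cc h -> Cc (fun x => a * h x).
Proof.
move=> Ch; under eq_fun do rewrite mulrC.
by apply: CcM => //; exact: cst_continuous.
Qed.

Lemma CcB h g : Cc h -> Cc g -> Cc (fun x => h x - g x).
Proof.
by move=> Ch Cg; under eq_fun do rewrite -mulN1r; apply: CcD => //; exact: CcZ.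
Qed.

Lemma Cc_translate z h : H z -> Cc h -> Cc (fun x => h (z ∙ x)).
Proof.
move=> Hz [ch [C [cC CH h0]]]; split; first by continuity.
exists ([set z⁻¹] `∙` C); split.
- by apply: compact_setmulg => //; exact: compact_set1.
- by move=> _ [_ -> [c Cc <-]]; apply: subgrpM => //; [exact: subgrpV|exact: CH].
- move=> x Hx nC; apply: h0; first exact: subgrpM.
  by move=> Czx; apply: nC; rewrite -(mulKg z x); exact: mem_setmulg.
Qed.

Lemma Cc_ge0D h g : Cc_ge0 h -> Cc_ge0 g -> Cc_ge0 (fun x => h x + g x).
Proof. by move=> [Ch h0] [Cg g0]; split=> [|x]; [exact: CcD|exact: addr_ge0]. Qed.

Lemma Cc_ge0Z a h : 0 <= a -> Cc_ge0 h -> Cc_ge0 (fun x => a * h x).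
Proof. by move=> a0 [Ch h0]; split=> [|x]; [exact: CcZ|exact: mulr_ge0]. Qed.

Lemma Cc_ge0_translate z h : H z -> Cc_ge0 h -> Cc_ge0 (fun x => h (z ∙ x)).
Proof. by move=> Hz [Ch h0]; split=> [|x]; [exact: Cc_translate|exact: h0]. Qed.

Lemma Cc_ge0_funrpos h : Cc h -> Cc_ge0 h^\+.
Proof.
move=> Ch; have [ch _] := Ch; split; last by move=> x; exact: funrpos_ge0.
apply: Cc_of_zeros (Ch) _; last by move=> x _; rewrite /funrpos => ->; rewrite maxxx.
by apply: continuous_maxT => //; exact: cst_continuous.
Qed.

Lemma Cc_ge0_funrneg h : Cc h -> Cc_ge0 h^\-.
Proof.
move=> /(CcZ (- 1)) /Cc_ge0_funrpos; congr Cc_ge0; rewrite -funrposN; congr funrpos.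
by apply/funext => x; rewrite mulN1r.
Qed.

Lemma exists_bump V : nbhs (1%g : L) V -> exists2 psi, bump psi & forall x, ~ V x -> psi x = 0.
Proof.
move=> nV; have [b [cb b01 b1 bV]] :=
  bump_function R (@lcgroup_locally_compact L) (@lcgroup_hausdorff L) nV.
by exists b.
Qed.

Lemma exists_Cc_bump : exists2 h, Cc_ge0 h & bump h.
Proof.
have [C [cC nC _ _]] := nbhs_compact_symmetric (filterT : nbhs (1%g : L) setT).
have [b [cb b01 b1] bC] := exists_bump nC.
exists b => //; split; last by move=> x; case/andP: (b01 x).
split=> //; exists (C `&` H); split; first exact: compact_closedI.
  by move=> x [].
by move=> x Hx nCH; apply: bC => Cx; exact: nCH.
Qed.

Lemma exists_Cc_ge1 C : compact C -> C `<=` H -> exists2 k, Cc_ge0 k & forall x, C x -> 1 <= k x.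
Proof.
move=> cC CH; have [b [Cb b0] [cb b01 b1]] := exists_Cc_bump.
have [|s [sC sP]] := @compact_finite_cover L C (fun x => [set y | 1 / 2 < b (x⁻¹ ∙ y)]) cC.
  move=> x _; apply: (@nbhs_ltr R L (fun y => b (x⁻¹ ∙ y))); first by continuity.
  by rewrite mulVg b1; lra.
exists (fun x => 2 * \sum_(y <- s) b (y⁻¹ ∙ x)).
  apply: Cc_ge0Z => //; have {sP} : forall x, x \in s -> H x by move=> x /sC /CH.
  elim: s {sC} => [|y s IHs] sH'.
    have := Cc_ge0Z (lexx 0) (conj Cb b0); congr Cc_ge0.
    by apply/funext => x; rewrite mul0r big_nil.
  under eq_fun do rewrite big_cons; apply: Cc_ge0D.
    by apply: Cc_ge0_translate; rewrite //; apply: subgrpV => //; apply: sH'; exact: mem_head.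
  by apply: IHs => z zs; apply: sH'; rewrite inE zs orbT.
move=> x Cx; have [y ys /= yx] := sP x Cx; rewrite (big_rem y) //=.
have : 0 <= \sum_(z <- rem y s) b (z⁻¹ ∙ x) by apply: sumr_ge0.
by lra.
Qed.

Lemma Cc_right_unif_cont h e : Cc h -> 0 < e -> exists2 V, nbhs 1%g V &
  forall z x, H z -> H x -> V (z⁻¹ ∙ x) -> `|h x - h z| <= e.
Proof.
move=> [ch [C [cC CH h0]]] e_gt0.
have [|W nW WC] := unif_cont_near1 (F := fun p => h (p.2 ∙ p.1)) _ cC e_gt0.
  by continuity.
have [V [nV symV VW]] := nbhs_symmetric nW; exists V => // z x Hz Hx Vzx.
have [Cz|nCz] := pselect (C z).
  by have := WC _ z (VW _ Vzx) Cz; rewrite /= mulVKg mulg1.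
have [Cx|nCx] := pselect (C x); last by rewrite !h0 // subrr normr0 ltW.
have := WC _ x (VW _ (symV _ Vzx)) Cx.
by rewrite /= invgM invgK mulVKg mulg1 distrC.
Qed.

End CompactSupport.

(* [covering_number h psi] is Haar's ratio (h : psi): the least total weight of a positive
   combination of left translates of [psi] dominating [h] on [H]. *)
Section CoveringNumber.
Variables (R : realType) (L : lcGroupType) (H : set L).
Hypotheses (sH : subgrp H) (clH : closed H).
Local Open Scope ring_scope.
Implicit Types (h g k psi chi : L -> R) (s : seq (R * L)) (c d e : R).
Local Notation Cc := (Cc H).
Local Notation Cc_ge0 := (Cc_ge0 H).

Definition translate_sum s psi x : R := \sum_(p <- s) p.1 * psi (p.2⁻¹ ∙ x).

Definition total_weight s : R := \sum_(p <- s) p.1.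

Definition admissible s := forall p, p \in s -> 0 <= p.1 /\ H p.2.

Definition covered h psi c := exists s, [/\ admissible s,
  forall x, H x -> h x <= translate_sum s psi x & c = total_weight s].

Lemma coveredD h g psi c d :
  covered h psi c -> covered g psi d -> covered (fun x => h x + g x) psi (c + d).
Proof.
move=> [s [As hs ->]] [t [At gt ->]]; exists (s ++ t); split.
- by move=> p; rewrite mem_cat => /orP[/As|/At].
- by move=> x Hx; rewrite /translate_sum big_cat; apply: lerD; [exact: hs|exact: gt].
- by rewrite /total_weight big_cat.
Qed.

Lemma coveredZ a h psi c : 0 <= a -> covered h psi c -> covered (fun x => a * h x) psi (a * c).
Proof.
move=> a0 [s [As hs ->]]; exists [seq (a * p.1, p.2) | p <- s]; split.
- by move=> _ /mapP[p ps ->] /=; have [p0 Hp] := As p ps; split=> //; exact: mulr_ge0.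
- move=> x Hx; rewrite /translate_sum big_map /=.
  under eq_bigr do rewrite -mulrA.
  by rewrite -mulr_sumr; apply: ler_wpM2l => //; exact: hs.
- by rewrite /total_weight big_map /= mulr_sumr.
Qed.

Lemma covered_mono h g psi c :
  (forall x, H x -> h x <= g x) -> covered g psi c -> covered h psi c.
Proof.
move=> hg [s [As gs ->]]; exists s; split=> // x Hx.
by apply: le_trans (gs _ Hx); exact: hg.
Qed.

Lemma covered_translate z h psi c :
  H z -> covered h psi c -> covered (fun x => h (z ∙ x)) psi c.
Proof.
move=> Hz [s [As hs ->]]; exists [seq (p.1, z⁻¹ ∙ p.2) | p <- s]; split.
- move=> _ /mapP[p ps ->] /=; have [p0 Hp] := As p ps; split=> //.
  by apply: subgrpM => //; exact: subgrpV.
- move=> x Hx; rewrite /translate_sum big_map /=.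
  apply: le_trans (hs _ (subgrpM sH Hz Hx)) _.
  by apply: ler_sum => p _; rewrite invgM invgK mulgA.
- by rewrite /total_weight big_map.
Qed.

Lemma covered_trans h chi psi c d :
  covered h chi c -> covered chi psi d -> covered h psi (c * d).
Proof.
move=> [s [As hs ->]] chi_d.
suff : covered (translate_sum s chi) psi (total_weight s * d) by apply: covered_mono.
elim: s As {hs} => [|p s IHs] As.
  exists [::]; split=> //; last by rewrite /total_weight !big_nil mul0r.
  by move=> x Hx; rewrite /translate_sum !big_nil.
rewrite /total_weight big_cons mulrDl -/(total_weight s).
have [p0 Hp] := As p (mem_head _ _).
apply: (@covered_mono _ (fun x => p.1 * chi (p.2⁻¹ ∙ x) + translate_sum s chi x)).
  by move=> x Hx; rewrite /translate_sum big_cons.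
apply: coveredD; last by apply: IHs => q qs; apply: As; rewrite inE qs orbT.
by apply: coveredZ => //; apply: covered_translate => //; exact: subgrpV.
Qed.

Lemma covered_ge h psi c x : (forall y, psi y <= 1) -> covered h psi c -> H x -> h x <= c.
Proof.
move=> psi1 [s [As hs ->]] Hx; apply: le_trans (hs _ Hx) _.
rewrite /translate_sum /total_weight big_seq [leRHS]big_seq.
by apply: ler_sum => p /As[p0 _]; rewrite -[leRHS]mulr1; apply: ler_wpM2l.
Qed.

Lemma covered_ge0 h psi c : covered h psi c -> 0 <= c.
Proof. by move=> [s [As _ ->]]; rewrite /total_weight big_seq; apply: sumr_ge0 => p /As[]. Qed.

Lemma exists_covered h psi z : Cc h -> continuous psi -> (forall x, 0 <= psi x) ->
  H z -> 0 < psi z -> exists c, covered h psi c.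
Proof.
move=> [ch [C [cC CH h0]]] cpsi psi0 Hz pz.
have [B B0 hB] := compact_bounded_fun cC ch.
have [|s [sC sP]] := @compact_finite_cover L C
    (fun x => [set y | psi z / 2 < psi ((x ∙ z⁻¹)⁻¹ ∙ y)]) cC.
  move=> x _; apply: (@nbhs_ltr R L (fun y => psi ((x ∙ z⁻¹)⁻¹ ∙ y))); first by continuity.
  by gsimp; lra.
pose a := 2 * B / psi z; pose t := [seq (a, x ∙ z⁻¹) | x <- s].
have a0 : 0 <= a by rewrite divr_ge0 ?mulr_ge0 // ltW.
exists (total_weight t), t; split=> [_ /mapP[x xs ->]|x Hx|//]; first split=> //=.
  by apply: subgrpM => //; [exact/CH/sC|exact: subgrpV].
have terms_ge0 r : 0 <= \sum_(y <- r) a * psi ((y ∙ z⁻¹)⁻¹ ∙ x).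
  by apply: sumr_ge0 => y _; exact: mulr_ge0.
rewrite /translate_sum big_map /=; have [Cx|nCx] := pselect (C x); last by rewrite h0.
have [y ys /= yx] := sP x Cx.
rewrite (big_rem y) //=; apply: ler_wpDr => //.
apply: le_trans (ler_norm _) _; apply: le_trans (hB x Cx) _.
rewrite [leLHS](_ : B = a * (psi z / 2)); last by rewrite /a; field; rewrite gt_eqF.
by apply: ler_wpM2l => //; exact: ltW.
Qed.

Lemma bump_covered h psi : Cc h -> bump psi -> exists c, covered h psi c.
Proof.
move=> Ch [cp p01 p1]; apply: (@exists_covered _ _ 1%g) => //; last by rewrite p1.
  by move=> x; case/andP: (p01 x).
exact: subgrp1.
Qed.

Definition covering_number h psi : R := inf (covered h psi).

Lemma covering_number_le h psi c : covered h psi c -> covering_number h psi <= c.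
Proof. by move=> hc; apply: ge_inf => //; exists 0 => d /covered_ge0. Qed.

Lemma le_covering_number h psi m :
  (exists c, covered h psi c) -> (forall c, covered h psi c -> m <= c) ->
  m <= covering_number h psi.
Proof. by move=> ex hm; apply: lb_le_inf => //; move=> c; exact: hm. Qed.

Lemma covering_number_ge0 h psi : (exists c, covered h psi c) -> 0 <= covering_number h psi.
Proof. by move=> ex; apply: le_covering_number => // c /covered_ge0. Qed.

Lemma covering_numberD_le h g psi : (exists c, covered h psi c) -> (exists c, covered g psi c) ->
  covering_number (fun x => h x + g x) psi <= covering_number h psi + covering_number g psi.
Proof.
move=> hc gc; rewrite -lerBlDr; apply: le_covering_number => // c hc'.
rewrite lerBlDr -lerBlDl; apply: le_covering_number => // d gd.
by rewrite lerBlDl; apply: covering_number_le; exact: coveredD.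
Qed.

Lemma covering_numberZ a h psi : 0 < a -> (exists c, covered h psi c) ->
  covering_number (fun x => a * h x) psi = a * covering_number h psi.
Proof.
move=> a0 [c hc]; apply/eqP; rewrite eq_le; apply/andP; split.
  rewrite -ler_pdivrMl //; apply: le_covering_number; first by exists c.
  move=> d hd; rewrite ler_pdivrMl //.
  by apply: covering_number_le; apply: coveredZ => //; exact: ltW.
apply: le_covering_number; first by exists (a * c); apply: coveredZ => //; exact: ltW.
move=> d /(coveredZ (a := a^-1)) hd; rewrite mulrC -ler_pdivlMr // mulrC.
apply: covering_number_le; apply: covered_mono (hd _); last by rewrite invr_ge0 ltW.
by move=> x _; rewrite mulrA mulVf ?mul1r // gt_eqF.
Qed.

Lemma covering_number_mono h g psi : (forall x, H x -> h x <= g x) ->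
  (exists c, covered g psi c) -> covering_number h psi <= covering_number g psi.
Proof.
move=> hg gc; apply: le_covering_number => // c gc'.
by apply: covering_number_le; exact: covered_mono gc'.
Qed.

Lemma covering_number_translate z h psi : H z -> (exists c, covered h psi c) ->
  covering_number (fun x => h (z ∙ x)) psi = covering_number h psi.
Proof.
move=> Hz [c hc]; apply/eqP; rewrite eq_le; apply/andP; split.
  apply: le_covering_number; first by exists c.
  by move=> d hd; apply: covering_number_le; exact: covered_translate.
apply: le_covering_number; first by exists c; exact: covered_translate.
move=> d /(covered_translate (subgrpV sH Hz)) hd; apply: covering_number_le.
by apply: covered_mono hd => x _; rewrite mulVKg.
Qed.

Lemma covering_number_trans h chi psi : (exists c, covered h chi c) ->
  (exists c, covered chi psi c) ->
  covering_number h psi <= covering_number h chi * covering_number chi psi.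
Proof.
move=> hc chic.
have le_scaled h' g' (m d : R) : (exists c, covered h' g' c) -> 0 <= d ->
    (forall c, covered h' g' c -> m <= d * c) -> m <= d * covering_number h' g'.
  move=> ex; rewrite le_eqVlt => /predU1P[<- hm|d0 hm].
    by have [c hc'] := ex; have := hm c hc'; rewrite !mul0r.
  rewrite -ler_pdivrMl //; apply: le_covering_number => // c hc'.
  by rewrite ler_pdivrMl //; exact: hm.
rewrite le_scaled ?covering_number_ge0 // => d chi_d.
rewrite mulrC; apply: le_scaled => //; first exact: covered_ge0 chi_d.
by move=> c hc'; rewrite mulrC; apply: covering_number_le; exact: covered_trans hc' chi_d.
Qed.

Lemma covering_number_mul_le h q g psi s V e : bump psi -> (forall x, ~ V x -> psi x = 0) ->
  0 <= e -> (forall x, 0 <= q x) -> (forall x, H x -> h x <= q x * g x) ->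
  (forall z x, H z -> H x -> V (z⁻¹ ∙ x) -> `|q x - q z| <= e) ->
  admissible s -> (forall x, H x -> g x <= translate_sum s psi x) ->
  covering_number h psi <= \sum_(p <- s) p.1 * (q p.2 + e).
Proof.
move=> [_ p01 _] pV e0 q0 hqg qV As gs; apply: covering_number_le.
exists [seq (p.1 * (q p.2 + e), p.2) | p <- s]; split; last by rewrite /total_weight big_map.
  move=> _ /mapP[p ps ->] /=; have [p0 Hp] := As p ps; split=> //.
  by rewrite mulr_ge0 // addr_ge0.
move=> x Hx; apply: le_trans (hqg x Hx) _.
apply: (@le_trans _ _ (q x * translate_sum s psi x)); first exact: ler_wpM2l (gs x Hx).
rewrite /translate_sum big_map mulr_sumr big_seq [leRHS]big_seq; apply: ler_sum => p ps /=.
have [p0 Hp] := As p ps; rewrite mulrCA -mulrA; apply: ler_wpM2l => //.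
have [Vx|nV] := pselect (V (p.2⁻¹ ∙ x)); last by rewrite pV // !mulr0.
have /ler_normlP[_ qx] := qV _ _ Hp Hx Vx.
by apply: ler_wpM2r; [case/andP: (p01 (p.2⁻¹ ∙ x))|lra].
Qed.

Lemma covering_number_quotient_le h f k e : Cc_ge0 h -> Cc_ge0 f ->
  (forall x, h x <= f x) -> (forall x, H x -> f x = 0 \/ 1 <= k x) -> 0 < e ->
  exists2 V, nbhs 1%g V & forall psi s, bump psi -> (forall x, ~ V x -> psi x = 0) ->
    admissible s -> (forall x, H x -> f x + e * k x <= translate_sum s psi x) ->
    covering_number h psi <= \sum_(p <- s) p.1 * (h p.2 / (f p.2 + e) + e).
Proof.
move=> [Ch h0] [Cf f0] hf fk e0.
have d0 x : 0 < f x + e by rewrite ltr_wpDl.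
have cd : continuous (fun x => (f x + e)^-1).
  have [cf _] := Cf; apply: continuous_invT => [x|]; first by rewrite gt_eqF.
  by continuity.
have [V nV qV] := Cc_right_unif_cont (CcM Ch cd) e0.
exists V => // psi s bp pV As fs.
apply: (@covering_number_mul_le h (fun x => h x / (f x + e)) (fun x => f x + e * k x)
  psi s V e) => //; first exact: ltW.
  by move=> x; rewrite divr_ge0 // ltW.
move=> x Hx; rewrite mulrAC ler_pdivlMr //.
have [fx0|k1] := fk x Hx.
  have -> : h x = 0 by apply/eqP; rewrite eq_le h0 andbT -fx0.
  by rewrite !mul0r.
by apply: ler_wpM2l => //; rewrite lerD2l ler_peMr // ltW.
Qed.

Lemma covering_number_almost_additive h1 h2 : Cc_ge0 h1 -> Cc_ge0 h2 ->
  exists2 k, Cc_ge0 k & forall e, 0 < e ->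
  exists2 V, nbhs 1%g V & forall psi, bump psi -> (forall x, ~ V x -> psi x = 0) ->
    covering_number h1 psi + covering_number h2 psi <=
    (1 + 2 * e) * (covering_number (fun x => h1 x + h2 x) psi + e * covering_number k psi).
Proof.
move=> Ch1 Ch2; have C12 := Cc_ge0D Ch1 Ch2; have [_ [C [cC CH hC]]] := C12.1.
have [k Ck k1] := exists_Cc_ge1 R sH clH cC CH; exists k => // e e0.
have hk x : H x -> h1 x + h2 x = 0 \/ 1 <= k x.
  by move=> Hx; have [/k1|/(hC x Hx)] := pselect (C x); [right|left].
have [|V1 nV1 b1] := covering_number_quotient_le Ch1 C12 _ hk e0.
  by move=> x; rewrite lerDl Ch2.2.
have [|V2 nV2 b2] := covering_number_quotient_le Ch2 C12 _ hk e0.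
  by move=> x; rewrite lerDr Ch1.2.
exists (V1 `&` V2) => [|psi bp pV]; first exact: filterI.
have Cek := CcZ e Ck.1.
apply: (@le_trans _ _ ((1 + 2 * e) *
    covering_number (fun x => h1 x + h2 x + e * k x) psi)); last first.
  apply: ler_wpM2l; first by lra.
  rewrite -covering_numberZ //; last by apply: bump_covered => //; exact: Ck.1.
  by apply: covering_numberD_le; apply: bump_covered => //; exact: C12.1.
rewrite -ler_pdivrMl; last by lra.
apply: le_covering_number; first by apply: bump_covered => //; apply: CcD => //; exact: C12.1.
move=> c [s [As gs ->]]; rewrite ler_pdivrMl; last by lra.
have {}b1 : covering_number h1 psi <= \sum_(p <- s) p.1 * (h1 p.2 / (h1 p.2 + h2 p.2 + e) + e).
  by apply: b1 => // x nV1x; apply: pV => -[].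
have {}b2 : covering_number h2 psi <= \sum_(p <- s) p.1 * (h2 p.2 / (h1 p.2 + h2 p.2 + e) + e).
  by apply: b2 => // x nV2x; apply: pV => -[].
apply: le_trans (lerD b1 b2) _; rewrite -big_split /= /total_weight mulr_sumr.
rewrite big_seq [leRHS]big_seq; apply: ler_sum => p ps; have [p0 _] := As p ps.
rewrite -mulrDr mulrC; apply: ler_wpM2r => //.
have : (h1 p.2 + h2 p.2) / (h1 p.2 + h2 p.2 + e) <= 1.
  by rewrite ler_pdivrMr ?mul1r ?lerDl ?ltW // ltr_wpDl //; exact: C12.2.
by rewrite mulrDl; lra.
Qed.

End CoveringNumber.

Lemma le_of_le_perturbation (R : realFieldType) (x y z : R) : (0 <= y)%R -> (0 <= z)%R ->
  (forall e, 0 < e -> x <= (1 + 2 * e) * (y + e * z))%R -> (x <= y)%R.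
Proof.
move=> y0 z0 xe; apply/ler_addgt0Pl => d d0.
pose m := (2 * y + 3 * z + 1)%R; have m0 : (0 < m)%R by rewrite /m; lra.
pose e := Num.min 1%R (d / m)%R.
have e0 : (0 < e)%R by rewrite lt_min ltr01 divr_gt0.
have e_le1 : (e <= 1)%R by rewrite ge_min lexx.
have em : (e * m <= d)%R by rewrite -ler_pdivlMr // ge_min lexx orbT.
have ee_le : (e * e * z <= e * z)%R by rewrite ler_wpM2r // ger_pMr.
by apply: le_trans (xe e e0) _; move: em; rewrite /m; nra.
Qed.

Record positive_invariant_functional (R : realType) (L : lcGroupType) (H : set L)
    (J : (L -> R) -> R) : Prop := PositiveInvariantFunctional {
  posD : forall h g, Cc_ge0 H h -> Cc_ge0 H g -> J (fun x => h x + g x)%R = (J h + J g)%R;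
  posZ : forall a h, (0 < a)%R -> Cc_ge0 H h -> J (fun x => a * h x)%R = (a * J h)%R;
  pos_mono : forall h g, Cc_ge0 H h -> Cc_ge0 H g ->
    (forall x, H x -> h x <= g x)%R -> (J h <= J g)%R;
  pos_translate : forall z h, H z -> Cc_ge0 H h -> J (fun x => h (z ∙ x)) = J h;
  pos_gt0 : forall h x, Cc_ge0 H h -> H x -> (0 < h x)%R -> (0 < J h)%R }.

Record haar_functional (R : realType) (L : lcGroupType) (H : set L)
    (J : (L -> R) -> R) : Prop := HaarFunctional {
  haarD : forall h g, Cc H h -> Cc H g -> J (fun x => h x + g x)%R = (J h + J g)%R;
  haarZ : forall a h, Cc H h -> J (fun x => a * h x)%R = (a * J h)%R;
  haar_mono : forall h g, Cc H h -> Cc H g ->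
    (forall x, H x -> h x <= g x)%R -> (J h <= J g)%R;
  haar_translate : forall z h, H z -> Cc H h -> J (fun x => h (z ∙ x)) = J h;
  haar_gt0 : forall h x, Cc H h -> (forall y, H y -> 0 <= h y)%R -> H x ->
    (0 < h x)%R -> (0 < J h)%R }.

(* The ratios (h : psi) / (h0 : psi) become additive in [h] as the support of [psi] shrinks
   to the identity. *)
Section HaarLimit.
Variables (R : realType) (L : lcGroupType) (H : set L).
Hypotheses (sH : subgrp H) (clH : closed H).
Local Open Scope ring_scope.
Variables (F : set_system (set L)) (psi : set L -> L -> R) (h0 : L -> R).
Hypotheses (UF : UltraFilter F)
  (F_small : forall V, nbhs 1%g V -> F [set W | nbhs 1%g W /\ W `<=` V])
  (psi_bump : forall V, nbhs 1%g V -> bump (psi V))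
  (psi_supp : forall V, nbhs 1%g V -> forall x, ~ V x -> psi V x = 0)
  (h0_Cc : Cc_ge0 H h0) (h0_bump : bump h0).
Implicit Types (h g : L -> R).

Let F_nbhs : F [set V | nbhs 1%g V].
Proof. by apply: filterS (F_small filterT) => V []. Qed.

Let psi_covered h V : Cc_ge0 H h -> nbhs 1%g V -> exists c, covered H h (psi V) c.
Proof. by move=> [Ch _] nV; apply: bump_covered => //; exact: psi_bump. Qed.

Lemma reference_covering_gt0 V : nbhs 1%g V -> 0 < covering_number H h0 (psi V).
Proof.
move=> nV; apply: (@lt_le_trans _ _ 1) => //.
apply: le_covering_number => [|c hc]; first exact: psi_covered.
have [_ _ <-] := h0_bump; apply: covered_ge hc _; last exact: subgrp1.
by move=> y; have [_ p01 _] := psi_bump nV; case/andP: (p01 y).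
Qed.

Definition haar_ratio h V := covering_number H h (psi V) / covering_number H h0 (psi V).

Let inv_reference_ge0 V : nbhs 1%g V -> 0 <= (covering_number H h0 (psi V))^-1.
Proof. by move=> nV; rewrite invr_ge0 ltW // reference_covering_gt0. Qed.

Lemma haar_ratio_ge0 h V : Cc_ge0 H h -> nbhs 1%g V -> 0 <= haar_ratio h V.
Proof.
move=> Ch nV; rewrite mulr_ge0 ?inv_reference_ge0 //.
by apply: covering_number_ge0; exact: psi_covered.
Qed.

Lemma haar_ratio_le h V : Cc_ge0 H h -> nbhs 1%g V ->
  haar_ratio h V <= covering_number H h h0.
Proof.
move=> Ch nV; rewrite ler_pdivrMr ?reference_covering_gt0 //.
apply: covering_number_trans => //; last exact: psi_covered.
by apply: bump_covered => //; exact: Ch.1.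
Qed.

Definition haar_limit h := lim (haar_ratio h @ F).

Lemma haar_ratio_cvg h : Cc_ge0 H h -> haar_ratio h @ F --> haar_limit h.
Proof.
move=> Ch; have [|p ap] :=
    @ultra_bounded_cvg _ F R (haar_ratio h) (covering_number H h h0) UF.
  apply: filterS F_nbhs => V nV /=.
  by rewrite ger0_norm ?haar_ratio_ge0 // haar_ratio_le.
exact: cvgP ap.
Qed.

Lemma haar_limit_unique h p : Cc_ge0 H h -> haar_ratio h @ F --> p -> haar_limit h = p.
Proof. by move=> Ch; apply: cvg_unique (haar_ratio_cvg Ch); exact: Rhausdorff. Qed.

Lemma haar_limit_ge0 h : Cc_ge0 H h -> 0 <= haar_limit h.
Proof.
move=> Ch; apply: (ler_cvgr _ (cvg_cst 0) (haar_ratio_cvg Ch)).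
by apply: filterS F_nbhs => V nV; exact: haar_ratio_ge0.
Qed.

Lemma haar_limit_mono h g : Cc_ge0 H h -> Cc_ge0 H g ->
  (forall x, H x -> h x <= g x) -> haar_limit h <= haar_limit g.
Proof.
move=> Ch Cg hg; apply: (ler_cvgr _ (haar_ratio_cvg Ch) (haar_ratio_cvg Cg)).
apply: filterS F_nbhs => V nV /=; apply: ler_wpM2r; first exact: inv_reference_ge0.
by apply: covering_number_mono => //; exact: psi_covered.
Qed.

Lemma haar_limitZ a h : 0 < a -> Cc_ge0 H h -> haar_limit (fun x => a * h x) = a * haar_limit h.
Proof.
move=> a0 Ch; apply: haar_limit_unique; first by apply: Cc_ge0Z => //; exact: ltW.
apply: cvg_trans (cvgM (cvg_cst a) (haar_ratio_cvg Ch)).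
apply: near_eq_cvg; apply: filterS F_nbhs => V nV.
by rewrite /haar_ratio /= covering_numberZ // ?mulrA //; exact: psi_covered.
Qed.

Lemma haar_limit_translate z h : H z -> Cc_ge0 H h ->
  haar_limit (fun x => h (z ∙ x)) = haar_limit h.
Proof.
move=> Hz Ch; apply: haar_limit_unique; first exact: Cc_ge0_translate.
apply: cvg_trans (haar_ratio_cvg Ch); apply: near_eq_cvg.
apply: filterS F_nbhs => V nV.
by rewrite /haar_ratio /= covering_number_translate //; exact: psi_covered.
Qed.

Lemma haar_limitD_le h g : Cc_ge0 H h -> Cc_ge0 H g ->
  haar_limit (fun x => h x + g x) <= haar_limit h + haar_limit g.
Proof.
move=> Ch Cg; have Chg := Cc_ge0D Ch Cg.
apply: (ler_cvgr _ (haar_ratio_cvg Chg) (cvgD (haar_ratio_cvg Ch) (haar_ratio_cvg Cg))).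
apply: filterS F_nbhs => V nV /=; rewrite -mulrDl; apply: ler_wpM2r.
  exact: inv_reference_ge0.
by apply: covering_numberD_le; exact: psi_covered.
Qed.

Lemma haar_limitD h g : Cc_ge0 H h -> Cc_ge0 H g ->
  haar_limit (fun x => h x + g x) = haar_limit h + haar_limit g.
Proof.
move=> Ch Cg; have Chg := Cc_ge0D Ch Cg.
apply/eqP; rewrite eq_le haar_limitD_le //=.
have [k Ck kV] := covering_number_almost_additive sH clH Ch Cg.
apply: (le_of_le_perturbation (haar_limit_ge0 Chg) (haar_limit_ge0 Ck)) => e e0.
have [V nV Ve] := kV e e0.
apply: (@ler_cvgr _ F R _ _ _ _ _ (cvgD (haar_ratio_cvg Ch) (haar_ratio_cvg Cg))
  (cvgM (cvg_cst (1 + 2 * e))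
    (cvgD (haar_ratio_cvg Chg) (cvgM (cvg_cst e) (haar_ratio_cvg Ck))))).
apply: filterS (F_small nV) => W [nW WV].
change (haar_ratio h W + haar_ratio g W <= (1 + 2 * e) *
  (haar_ratio (fun x => h x + g x) W + e * haar_ratio k W)).
rewrite /haar_ratio -mulrDl [e * (_ / _)]mulrA -mulrDl mulrA.
apply: ler_wpM2r; first exact: inv_reference_ge0.
apply: Ve; first exact: psi_bump.
by move=> x nVx; apply: psi_supp => // /WV.
Qed.

Lemma haar_limit_gt0 h x : Cc_ge0 H h -> H x -> 0 < h x -> 0 < haar_limit h.
Proof.
move=> Ch Hx hx; have h0_covered : exists c, covered H h0 h c.
  by apply: (exists_covered sH h0_Cc.1 _ _ Hx) => //; [exact: Ch.1.1|exact: Ch.2].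
have num_ge0 := covering_number_ge0 h0_covered.
have num_gt0 : 0 < covering_number H h0 h + 1 by rewrite ltr_wpDl.
apply: (@lt_le_trans _ _ (covering_number H h0 h + 1)^-1); first by rewrite invr_gt0.
apply: (ler_cvgr _ (cvg_cst _) (haar_ratio_cvg Ch)).
apply: filterS F_nbhs => V nV /=.
rewrite ler_pdivlMr ?reference_covering_gt0 // ler_pdivrMl //.
apply: le_trans (covering_number_trans sH h0_covered (psi_covered Ch nV)) _.
by apply: ler_wpM2r; [apply: covering_number_ge0; exact: psi_covered|rewrite lerDl].
Qed.

Lemma haar_limit_positive_invariant : positive_invariant_functional H haar_limit.
Proof.
split; [exact: haar_limitD|exact: haar_limitZ|exact: haar_limit_mono
  |exact: haar_limit_translate|exact: haar_limit_gt0].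
Qed.

End HaarLimit.

Lemma exists_positive_invariant_functional (R : realType) (L : lcGroupType) (H : set L) :
  subgrp H -> closed H -> exists J : (L -> R) -> R, positive_invariant_functional H J.
Proof.
move=> sH clH; have [F [UF F_small]] := nbhs_ultrafilter (1%g : L).
have /choice[psi psiP] (V : set L) : exists psi : L -> R,
    nbhs 1%g V -> bump psi /\ forall x, ~ V x -> psi x = 0%R.
  have [nV|nV] := pselect (nbhs 1%g V); last by exists (fun=> 0%R).
  by have [b bb bV] := exists_bump R nV; exists b.
have [h0 Ch0 bh0] := exists_Cc_bump R clH.
exists (haar_limit H F psi h0); apply: haar_limit_positive_invariant => // V nV.
  exact: (psiP V nV).1.
exact: (psiP V nV).2.
Qed.

Section SignedExtension.
Variables (R : realType) (L : lcGroupType) (H : set L) (I : (L -> R) -> R).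
Hypotheses (sH : subgrp H) (posI : positive_invariant_functional H I).
Local Open Scope ring_scope.
Implicit Types (h g p q : L -> R).

Lemma funrposBnegE h x : h x = h^\+ x - h^\- x.
Proof. by rewrite -[in LHS](funrposBneg h). Qed.

Definition signed_extension h := I h^\+ - I h^\-.
Local Notation J := signed_extension.

Lemma signed_extension_sub h p q : Cc H h -> Cc_ge0 H p -> Cc_ge0 H q ->
  (forall x, H x -> h x = p x - q x) -> J h = I p - I q.
Proof.
move=> Ch Cp Cq hpq; have [Cf Cg] := (Cc_ge0_funrpos Ch, Cc_ge0_funrneg Ch).
suff : I h^\+ + I q = I p + I h^\- by rewrite /J; lra.
rewrite -!(posD posI) //; apply/eqP; rewrite eq_le; apply/andP.
by split; apply: (pos_mono posI); rewrite ?Cc_ge0D //;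
  try exact: Cc_ge0D; move=> x Hx; have := hpq x Hx; rewrite funrposBnegE; lra.
Qed.

Lemma signed_extension_ge0 h : Cc H h -> (forall x, H x -> 0 <= h x) -> J h = I h^\+.
Proof.
move=> Ch h_ge0; have Cf := Cc_ge0_funrpos Ch; have Cz := Cc_ge0Z (lexx 0) Cf.
rewrite (@signed_extension_sub _ h^\+ (fun x => 0 * h^\+ x)) //.
  suff : I (fun x => 2 * (0 * h^\+ x)) = I (fun x => 0 * h^\+ x).
    by rewrite (posZ posI) //; lra.
  by congr I; apply/funext => x; rewrite !mul0r mulr0.
by move=> x Hx; rewrite mul0r subr0 /funrpos max_l // h_ge0.
Qed.

Lemma signed_extensionD h g : Cc H h -> Cc H g -> J (fun x => h x + g x) = J h + J g.
Proof.
move=> Ch Cg; have [Cf Cf'] := (Cc_ge0_funrpos Ch, Cc_ge0_funrpos Cg).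
have [Cn Cn'] := (Cc_ge0_funrneg Ch, Cc_ge0_funrneg Cg).
rewrite (@signed_extension_sub _ (fun x => h^\+ x + g^\+ x) (fun x => h^\- x + g^\- x)).
- by rewrite !(posD posI) // /J; lra.
- exact: CcD.
- exact: Cc_ge0D.
- exact: Cc_ge0D.
- by move=> x _ /=; rewrite {1}(funrposBnegE h) {1}(funrposBnegE g); lra.
Qed.

Lemma signed_extension0 h : Cc H h -> (forall x, H x -> h x = 0) -> J h = 0.
Proof.
move=> Ch h0; have Cf := Cc_ge0_funrpos Ch.
by rewrite (@signed_extension_sub _ h^\+ h^\+) ?subrr // => x Hx; rewrite h0 // subrr.
Qed.

Lemma signed_extensionZ a h : Cc H h -> J (fun x => a * h x) = a * J h.
Proof.
move=> Ch; have [Cf Cg] := (Cc_ge0_funrpos Ch, Cc_ge0_funrneg Ch).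
case: (ltrgt0P a) => [a0|a0|->]; last first.
- by rewrite mul0r signed_extension0 //; [exact: CcZ|move=> x _; rewrite mul0r].
- have Na0 : 0 < - a by rewrite oppr_gt0.
  rewrite (@signed_extension_sub _ (fun x => - a * h^\- x) (fun x => - a * h^\+ x)).
  + by rewrite !(posZ posI) // /J; lra.
  + exact: CcZ.
  + by apply: Cc_ge0Z => //; exact: ltW.
  + by apply: Cc_ge0Z => //; exact: ltW.
  + by move=> x _; rewrite funrposBnegE; lra.
- rewrite (@signed_extension_sub _ (fun x => a * h^\+ x) (fun x => a * h^\- x)).
  + by rewrite !(posZ posI) // /J; lra.
  + exact: CcZ.
  + by apply: Cc_ge0Z => //; exact: ltW.
  + by apply: Cc_ge0Z => //; exact: ltW.
  + by move=> x _; rewrite funrposBnegE; lra.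
Qed.

Lemma signed_extension_mono h g : Cc H h -> Cc H g ->
  (forall x, H x -> h x <= g x) -> J h <= J g.
Proof.
move=> Ch Cg hg; rewrite -subr_ge0.
have CNh := CcZ (- 1) Ch; have Cd := CcD Cg CNh.
have -> : J g - J h = J (fun x => g x + - 1 * h x).
  by rewrite signed_extensionD // signed_extensionZ // mulN1r.
have Cf := Cc_ge0_funrpos Cd.
rewrite signed_extension_ge0 // => [|x Hx]; last by have := hg x Hx; lra.
have -> : 0 = J (fun x => 0 * h x) by rewrite signed_extensionZ // mul0r.
rewrite signed_extension_ge0; [|exact: CcZ|by move=> x _; rewrite mul0r].
apply: (pos_mono posI) => //; first by apply: Cc_ge0_funrpos; exact: CcZ.
by move=> x _; rewrite {1}/funrpos mul0r maxxx funrpos_ge0.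
Qed.

Lemma signed_extension_translate z h : H z -> Cc H h -> J (fun x => h (z ∙ x)) = J h.
Proof.
move=> Hz Ch; have [Cf Cg] := (Cc_ge0_funrpos Ch, Cc_ge0_funrneg Ch).
rewrite (@signed_extension_sub _ (fun x => h^\+ (z ∙ x)) (fun x => h^\- (z ∙ x))).
- by rewrite !(pos_translate posI).
- exact: Cc_translate.
- exact: Cc_ge0_translate.
- exact: Cc_ge0_translate.
- by move=> x _; exact: funrposBnegE.
Qed.

Lemma haar_functional_signed_extension : haar_functional H J.
Proof.
split; [exact: signed_extensionD|exact: signed_extensionZ|exact: signed_extension_mono
  |exact: signed_extension_translate|].
move=> h x Ch h_ge0 Hx hx; rewrite signed_extension_ge0 //.
apply: (pos_gt0 posI (Cc_ge0_funrpos Ch) Hx).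
by rewrite /funrpos lt_max hx.
Qed.

End SignedExtension.

Lemma exists_haar_functional (R : realType) (L : lcGroupType) (H : set L) :
  subgrp H -> closed H -> exists J : (L -> R) -> R, haar_functional H J.
Proof.
move=> sH clH; have [I posI] := exists_positive_invariant_functional R sH clH.
by exists (signed_extension I); exact: haar_functional_signed_extension.
Qed.

Lemma haar_norm_le (R : realType) (L : lcGroupType) (H : set L) (J : (L -> R) -> R)
    (h k : L -> R) (c : R) :
  haar_functional H J -> Cc H h -> Cc H k -> (forall x, H x -> `|h x| <= c * k x)%R ->
  (`|J h| <= c * J k)%R.
Proof.
move=> haarJ Ch Ck hck; have Cck := CcZ c Ck; have CNh := CcZ (- 1) Ch.
apply/ler_normlP; rewrite -(haarZ haarJ) // -mulN1r -(haarZ haarJ) //.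
by split; apply: (haar_mono haarJ) => // x Hx; have /ler_normlP[] := hck x Hx; lra.
Qed.

Lemma haarB (R : realType) (L : lcGroupType) (H : set L) (J : (L -> R) -> R) (h g : L -> R) :
  haar_functional H J -> Cc H h -> Cc H g -> J (fun x => h x - g x)%R = (J h - J g)%R.
Proof.
move=> haarJ Ch Cg; under eq_fun do rewrite -mulN1r.
by rewrite (haarD haarJ) ?(haarZ haarJ) ?mulN1r //; exact: CcZ.
Qed.

(** * Gleason's functions *)

Section OrbitSupremum.
Variables (R : realType) (L : lcGroupType) (K : set L) (b : L -> R).
Local Open Scope ring_scope.
Hypotheses (sK : subgrp K) (b01 : forall x, 0 <= b x <= 1).

Definition orbit_sup x := sup [set b (k ∙ x) | k in K].

Lemma orbit_sup_le x c : (forall k, K k -> b (k ∙ x) <= c) -> orbit_sup x <= c.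
Proof.
move=> bc; apply: ge_sup; last by move=> _ [k Kk <-]; exact: bc.
by exists (b (1%g ∙ x)); exists 1%g => //; exact: subgrp1.
Qed.

Lemma le_orbit_sup x k : K k -> b (k ∙ x) <= orbit_sup x.
Proof.
move=> Kk; apply: ub_le_sup; last by exists k.
by exists 1 => _ [l _ <-]; case/andP: (b01 (l ∙ x)).
Qed.

Lemma orbit_sup_itv x : 0 <= orbit_sup x <= 1.
Proof.
apply/andP; split; last by apply: orbit_sup_le => k _; case/andP: (b01 (k ∙ x)).
by apply: le_trans (le_orbit_sup x (subgrp1 sK)); case/andP: (b01 (1%g ∙ x)).
Qed.

Lemma orbit_sup_invariant k x : K k -> orbit_sup (k ∙ x) = orbit_sup x.
Proof.
move=> Kk; apply/eqP; rewrite eq_le; apply/andP; split; apply: orbit_sup_le => l Kl.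
  by rewrite mulgA; apply: le_orbit_sup; exact: subgrpM.
have := le_orbit_sup (k ∙ x) (subgrpM sK Kl (subgrpV sK Kk)).
by rewrite mulgA mulgVK.
Qed.

Lemma orbit_sup_left_unif_cont : compact K -> left_unif_cont b -> left_unif_cont orbit_sup.
Proof.
move=> cK ub e e0; have [W nW We] := ub e e0.
have [V nV VW] := nbhs_conjg_compact cK nW.
have [V' [nV' symV' V'V]] := nbhs_symmetric nV.
have half w y : V' w -> orbit_sup (w ∙ y) <= orbit_sup y + e.
  move=> V'w; apply: orbit_sup_le => k Kk.
  have /ler_normlP[_ le] := We _ (k ∙ y) (VW _ _ (V'V _ V'w) (subgrpV sK Kk)).
  have := le_orbit_sup y Kk; move: le.
  rewrite (_ : (w ^ (k⁻¹))%g ∙ (k ∙ y) = k ∙ (w ∙ y)); last by gsimp.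
  by lra.
exists V' => // w y V'w; apply/ler_normlP.
have := half w y V'w; have := half w⁻¹ (w ∙ y) (symV' _ V'w).
by rewrite mulKg; split; lra.
Qed.

End OrbitSupremum.

Lemma exists_invariant_bump (R : realType) (L : lcGroupType) (U K : set L) :
  compact K -> subgrp K -> set_nbhs K U -> exists tau : L -> R,
  [/\ left_unif_cont tau, (forall x, 0 <= tau x <= 1)%R, tau 1%g = 1%R,
      (forall x, ~ U x -> tau x = 0%R) & forall k x, K k -> tau (k ∙ x) = tau x].
Proof.
move=> cK sK KU.
have [|k Kk|V nV VU] := @nbhs_prod_compact L L L (fun p => p.2 ∙ p.1) K U _ cK.
- by continuity.
- by rewrite mulg1; exact: KU.
have [C [cC nC symC CV]] := nbhs_compact_symmetric nV.
have [b [cb b01 b1] bC] := exists_bump R nC.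
have sup01 := orbit_sup_itv sK b01.
exists (orbit_sup K b); split=> //.
- by apply: orbit_sup_left_unif_cont => //; exact: compact_support_left_unif_cont cC bC.
- apply/eqP; rewrite eq_le; case/andP: (sup01 1%g) => _ -> /=.
  by apply: le_trans (le_orbit_sup b01 1%g (subgrp1 sK)); rewrite mulg1 b1.
- move=> x nUx; apply/eqP; rewrite eq_le; case/andP: (sup01 x) => -> _; rewrite andbT.
  apply: orbit_sup_le => // k Kk; rewrite bC // => /CV Vkx; apply: nUx.
  by rewrite -(mulKg k x); exact: VU Vkx (subgrpV sK Kk).
- by move=> k x Kk; exact: orbit_sup_invariant.
Qed.

Lemma conjg_unif_cont (R : realType) (L : lcGroupType) (C K : set L) (tau : L -> R) (e : R) :
  compact C -> normalised C K -> left_unif_cont tau ->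
  (forall k x, K k -> tau (k ∙ x) = tau x) -> (0 < e)%R ->
  exists2 W, set_nbhs K W & forall b v z, W b -> C v ->
    (`|tau ((b ^ v)%g ∙ z) - tau z| <= e)%R.
Proof.
move=> cC CK ucT tauK e0; have [W0 nW0 W0e] := ucT e e0.
have [W1 nW1 W1W0] := nbhs_conjg_compact cC nW0.
exists (W1 `∙` K); first exact: set_nbhs_setmulg.
move=> _ v z [w W1w [k Kk <-]] Cv; rewrite -(tauK _ z (CK v k Cv Kk)) conjMg -mulgA.
exact: W0e (W1W0 w v W1w Cv).
Qed.

(* [gleason_fun] is the least majorant of [tau] obtained by losing at most [1 / n] of height
   with each translation by an element of [Q]. *)
Section GleasonFunction.
Variables (R : realType) (L : lcGroupType) (U : set L) (tau : L -> R) (Q : set L) (n : nat).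
Local Open Scope ring_scope.
Hypotheses (tau01 : forall x, 0 <= tau x <= 1) (tauU : forall x, ~ U x -> tau x = 0)
  (Q1 : Q 1%g) (symQ : symmetric Q) (n_gt0 : (0 < n)%N) (QU : Q `^^ n `<=` U).

Definition gleason_terms x : set R :=
  [set r | exists k y,
    [/\ (k <= n)%N, (Q `^^ k) y & r = (1 - k%:R / n%:R) * tau (y⁻¹ ∙ x)]].

Definition gleason_fun x := sup (gleason_terms x).

Let n_gt0r : 0 < n%:R :> R. Proof. by rewrite ltr0n. Qed.

Let height_itv k : (k <= n)%N -> 0 <= 1 - k%:R / n%:R :> R /\ 1 - k%:R / n%:R <= 1 :> R.
Proof.
move=> kn; have q_le1 : k%:R / n%:R <= 1 :> R by rewrite ler_pdivrMr // mul1r ler_nat.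
have q_ge0 : 0 <= k%:R / n%:R :> R by rewrite divr_ge0.
by split; lra.
Qed.

Let terms_le1 x r : gleason_terms x r -> r <= 1.
Proof.
move=> [k [y [kn _ ->]]]; have [c0 c1] := height_itv kn.
by have /andP[t0 t1] := tau01 (y⁻¹ ∙ x); rewrite -[leRHS]mulr1; apply: ler_pM.
Qed.

Lemma le_gleason_fun x k y : (k <= n)%N -> (Q `^^ k) y ->
  (1 - k%:R / n%:R) * tau (y⁻¹ ∙ x) <= gleason_fun x.
Proof.
by move=> kn Qy; apply: ub_le_sup; [exists 1 => r; exact: terms_le1|exists k, y].
Qed.

Lemma gleason_fun_le x c : (forall k y, (k <= n)%N -> (Q `^^ k) y ->
  (1 - k%:R / n%:R) * tau (y⁻¹ ∙ x) <= c) -> gleason_fun x <= c.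
Proof.
move=> bc; apply: ge_sup; last by move=> _ [k [y [kn Qy ->]]]; exact: bc.
by exists ((1 - 0%:R / n%:R) * tau (1%g⁻¹ ∙ x)), 0%N, 1%g.
Qed.

Lemma gleason_fun_ge_tau x : tau x <= gleason_fun x.
Proof.
have := @le_gleason_fun x 0%N 1%g (leq0n _) erefl.
by rewrite mul0r subr0 mul1r invg1 mul1g.
Qed.

Lemma gleason_fun_ge0 x : 0 <= gleason_fun x.
Proof. by apply: le_trans (gleason_fun_ge_tau x); case/andP: (tau01 x). Qed.

Lemma gleason_fun_le1 x : gleason_fun x <= 1.
Proof. by apply: gleason_fun_le => k y kn Qy; apply: (@terms_le1 x); exists k, y. Qed.

Lemma gleason_fun_supp x : ~ (U `^^ 2) x -> gleason_fun x = 0.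
Proof.
move=> nU; apply/eqP; rewrite eq_le gleason_fun_ge0 andbT.
apply: gleason_fun_le => k y kn Qy; rewrite tauU ?mulr0 // => Uyx; apply: nU.
have Uy : U y by apply: QU; apply: setexpg_le Qy.
by rewrite -(mulVKg y x); apply: mem_setmulg => //; rewrite setmulg1.
Qed.

Lemma gleason_fun_lipschitz a x :
  Q a -> `|gleason_fun (a ∙ x) - gleason_fun x| <= n%:R^-1.
Proof.
have half b y : Q b -> gleason_fun y <= gleason_fun (b ∙ y) + n%:R^-1.
  move=> Qb; apply: gleason_fun_le => k z kn Qz.
  have /andP[t0 t1] := tau01 (z⁻¹ ∙ y).
  move: kn; rewrite leq_eqVlt => /predU1P[->|kn].
    by rewrite divff ?gt_eqF // subrr mul0r addr_ge0 // gleason_fun_ge0.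
  have := @le_gleason_fun (b ∙ y) k.+1 (b ∙ z) kn (mem_setmulg Qb Qz).
  rewrite invgM mulgA mulgVK -natr1 mulrDl mul1r => le.
  have : n%:R^-1 * tau (z⁻¹ ∙ y) <= n%:R^-1 by rewrite ler_piMr.
  by move: le; rewrite !mulrBl !mulrDl; lra.
move=> Qa; apply/ler_normlP; have := half a x Qa.
by have := half a⁻¹ (a ∙ x) (symQ Qa); rewrite mulKg; split; lra.
Qed.

Lemma gleason_fun_near c e : (forall y z, U y -> `|tau ((c ^ y)%g ∙ z) - tau z| <= e) ->
  forall x, `|gleason_fun (c ∙ x) - gleason_fun x| <= e.
Proof.
move=> ce x; have e0 : 0 <= e.
  by apply: le_trans (normr_ge0 _) (ce 1%g 1%g _); apply: QU; exact: setexpg_mem1.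
have scaled (w t s : R) : 0 <= w -> w <= 1 -> t <= s + e -> w * t <= w * s + e.
  move=> w0 w1 ts; apply: (@le_trans _ _ (w * (s + e))); first exact: ler_wpM2l.
  by rewrite mulrDr lerD2l ler_piMl.
have close k y : (k <= n)%N -> (Q `^^ k) y -> `|tau (y⁻¹ ∙ (c ∙ x)) - tau (y⁻¹ ∙ x)| <= e.
  move=> kn Qy; have Uy : U y by apply: QU; apply: setexpg_le Qy.
  have := ce y (y⁻¹ ∙ x) Uy; congr (`|tau _ - _| <= _).
  by gsimp.
apply/ler_normlP; split.
  suff : gleason_fun x <= gleason_fun (c ∙ x) + e by lra.
  apply: gleason_fun_le => k y kn Qy; have [w0 w1] := height_itv kn.
  have /ler_normlP[le _] := close k y kn Qy.
  apply: le_trans (scaled _ _ (tau (y⁻¹ ∙ (c ∙ x))) w0 w1 _) _; first by lra.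
  by rewrite lerD2r; exact: le_gleason_fun.
suff : gleason_fun (c ∙ x) <= gleason_fun x + e by lra.
apply: gleason_fun_le => k y kn Qy; have [w0 w1] := height_itv kn.
have /ler_normlP[_ le] := close k y kn Qy.
apply: le_trans (scaled _ _ (tau (y⁻¹ ∙ x)) w0 w1 _) _; first by lra.
by rewrite lerD2r; exact: le_gleason_fun.
Qed.

End GleasonFunction.

Section Autocorrelation.
Variables (R : realType) (L : lcGroupType) (J : (L -> R) -> R).
Local Open Scope ring_scope.
Hypothesis haarJ : haar_functional [set: L] J.
Variables (th : L -> R) (A : set L).
Hypotheses (cth : continuous th) (cA : compact A) (thA : forall x, ~ A x -> th x = 0).
Implicit Types (a b x z u : L).

Definition autocorrelation x := J (fun u => th (x ∙ u) * th u).
Local Notation phi := autocorrelation.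

Lemma Cc_translate_prod x z : Cc [set: L] (fun u => th (x ∙ u) * th (z ∙ u)).
Proof.
have Cth : Cc [set: L] th by split=> //; exists A; split=> // u _; exact: thA.
by apply: CcM; [exact: (Cc_translate _ I Cth)|continuity].
Qed.

Let Cc_prod x : Cc [set: L] (fun u => th (x ∙ u) * th u).
Proof. by have := Cc_translate_prod x 1%g; under eq_fun do rewrite mul1g. Qed.

Lemma autocorrelation_shift a x :
  phi (a ∙ x) = J (fun u => th (a ∙ u) * th (x⁻¹ ∙ u)).
Proof.
rewrite -(haar_translate haarJ (z := x)) //; last exact: Cc_translate_prod.
by congr J; apply/funext => u; rewrite mulKg mulgA.
Qed.

Lemma autocorrelation_sub b x :
  phi (b ∙ x) - phi x = J (fun u => (th (b ∙ x ∙ u) - th (x ∙ u)) * th u).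
Proof. by rewrite -(haarB haarJ) //; congr J; apply/funext => u; rewrite mulrBl. Qed.

Lemma autocorrelation_second_difference a b x :
  (phi (a⁻¹ ∙ (b⁻¹ ∙ x)) - phi (b⁻¹ ∙ x)) - (phi (a⁻¹ ∙ x) - phi x) =
  J (fun u => (th (a⁻¹ ∙ u) - th u) * (th (x⁻¹ ∙ b ∙ u) - th (x⁻¹ ∙ u))).
Proof.
have shift1 z : phi z = J (fun u => th u * th (z⁻¹ ∙ u)).
  have := autocorrelation_shift 1%g z; rewrite mul1g => ->.
  by congr J; apply/funext => u; rewrite mul1g.
have Cth z : Cc [set: L] (fun u => th u * th (z ∙ u)).
  by have := Cc_translate_prod 1%g z; under eq_fun do rewrite mul1g.
rewrite (autocorrelation_shift a⁻¹ (b⁻¹ ∙ x)) (autocorrelation_shift a⁻¹ x).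
rewrite (shift1 (b⁻¹ ∙ x)) (shift1 x).
rewrite -!(haarB haarJ); try by do ?apply: CcB; first [exact: Cc_translate_prod|exact: Cth].
by congr J; apply/funext => u; rewrite invgM invgK; lra.
Qed.

Lemma autocorrelation_supp x : phi x != 0 -> exists2 u, A (x ∙ u) & A u.
Proof.
move=> phix; apply: contrapT => nA; move/eqP: phix; apply.
have -> : phi x = J (fun u => 0 * (th (x ∙ u) * th u)).
  congr J; apply/funext => u; rewrite mul0r.
  have [Au|nAu] := pselect (A u); last by rewrite (thA nAu) mulr0.
  by rewrite thA ?mul0r // => Axu; apply: nA; exists u.
by rewrite (haarZ haarJ) ?mul0r.
Qed.

End Autocorrelation.

Record normal_neighbourhood (L : lcGroupType) (U K : set L) : Prop := NormalNeighbourhood {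
  nn_compact : compact U;
  nn_symmetric : symmetric U;
  nn_compact_subgrp : compact K;
  nn_subgrp : subgrp K;
  nn_set_nbhs : set_nbhs K U;
  nn_normalised : normalised U K }.

Lemma nn_mem1 (L : lcGroupType) (U K : set L) : normal_neighbourhood U K -> U 1%g.
Proof. by case=> _ _ _ sK KU _; apply: nbhs_singleton; apply: KU; exact: subgrp1. Qed.

Record gleason_function (R : realType) (L : lcGroupType) (U : set L) (m : nat) (m0 M : R)
    (W : R -> set L) (Q : set L) (n : nat) (phi : L -> R) : Prop := GleasonFunction {
  gleason_ge : (m0 <= phi 1%g)%R;
  gleason_supp : forall x, (phi x != 0)%R -> (U `^^ 4) x;
  gleason_norm_le : forall x, (`|phi x| <= M)%R;
  gleason_near : forall e b x, (0 < e)%R -> W e b -> (`|phi (b ∙ x) - phi x| <= M * e)%R;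
  gleason_second_difference : forall e a b x, (0 < e)%R -> Q a -> W e b -> (U `^^ m) x ->
    (`|(phi (a⁻¹ ∙ (b⁻¹ ∙ x)) - phi (b⁻¹ ∙ x)) - (phi (a⁻¹ ∙ x) - phi x)| <= M * e / n%:R)%R }.

Section GleasonEstimates.
Variables (R : realType) (L : lcGroupType) (U K : set L) (m : nat) (J : (L -> R) -> R).
Local Open Scope ring_scope.
Hypotheses (nUK : normal_neighbourhood U K) (haarJ : haar_functional [set: L] J).
Variables (tau k1 : L -> R) (W : R -> set L) (Q : set L) (n : nat).
Hypotheses (tau01 : forall x, 0 <= tau x <= 1) (tauU : forall x, ~ U x -> tau x = 0)
  (ctau : continuous tau) (Ck1 : Cc_ge0 [set: L] k1)
  (k1_ge1 : forall x, (U `^^ 3) x -> 1 <= k1 x)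
  (W_nbhs : forall e, 0 < e -> set_nbhs K (W e))
  (W_near : forall e b v z, 0 < e -> W e b -> (U `^^ m.+1) v ->
    `|tau ((b ^ v)%g ∙ z) - tau z| <= e)
  (Q1 : Q 1%g) (symQ : symmetric Q) (n_gt0 : (0 < n)%N) (QU : Q `^^ n `<=` U).

Let th := gleason_fun tau Q n.
Let phi := autocorrelation J th.
Let U1 : U 1%g := nn_mem1 nUK.

Let th_ge0 x : 0 <= th x. Proof. exact: gleason_fun_ge0. Qed.
Let th_norm_le1 x : `|th x| <= 1. Proof. by rewrite ger0_norm //; exact: gleason_fun_le1. Qed.
Let th_supp2 x : ~ (U `^^ 2) x -> th x = 0. Proof. exact: gleason_fun_supp. Qed.

Let th_supp3 x : ~ (U `^^ 3) x -> th x = 0.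
Proof. by move=> nU3; apply: th_supp2 => U2; apply: nU3; exact: setexpg_le U2. Qed.

Let th_near e b v z : 0 < e -> W e b -> (U `^^ m) v -> `|th ((b ^ v)%g ∙ z) - th z| <= e.
Proof.
move=> e0 Wb Uv; apply: (@gleason_fun_near R L U) => // y w Uy.
rewrite -conjgM; apply: W_near => //; rewrite -addn1.
by apply: setexpgD => //; rewrite setexpg1.
Qed.

Let cth : continuous th.
Proof.
apply: left_unif_cont_continuous => e e0; exists (W e).
  by apply: W_nbhs => //; exact: subgrp1 (nn_subgrp nUK).
move=> w y Ww; rewrite -[w in th (w ∙ _)]conjg1; apply: th_near => //.
exact: setexpg_mem1.
Qed.

Let cU2 : compact (U `^^ 2). Proof. exact/compact_setexpg/(nn_compact nUK). Qed.

Let le_scaled_k1 (h : L -> R) c : 0 <= c -> (forall u, ~ (U `^^ 3) u -> h u = 0) ->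
  (forall u, `|h u| <= c) -> forall u, `|h u| <= c * k1 u.
Proof.
move=> c0 h0 hc u; have [Uu|nUu] := pselect ((U `^^ 3) u).
  by apply: le_trans (hc u) _; rewrite ler_peMr // k1_ge1.
by rewrite h0 // normr0 mulr_ge0 //; exact: Ck1.2.
Qed.

Let Cc_supp3 (h : L -> R) :
  continuous h -> (forall u, ~ (U `^^ 3) u -> h u = 0) -> Cc [set: L] h.
Proof.
move=> ch h0; split=> //; exists (U `^^ 3); split=> // [|x _]; last exact: h0.
exact/compact_setexpg/(nn_compact nUK).
Qed.

Let haar_supp3_le (h : L -> R) c : 0 <= c -> continuous h ->
  (forall u, ~ (U `^^ 3) u -> h u = 0) -> (forall u, `|h u| <= c) -> `|J h| <= c * J k1.
Proof.
move=> c0 ch h0 hc; apply: (haar_norm_le haarJ (Cc_supp3 ch h0) Ck1.1) => u _.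
exact: le_scaled_k1.
Qed.

Lemma autocorrelation_gleason_ge : J (fun x => tau x * tau x) <= phi 1%g.
Proof.
rewrite /phi /autocorrelation; under [X in _ <= J X]eq_fun do rewrite mul1g.
apply: (haar_mono haarJ).
- apply: Cc_supp3 => [|u nU3]; first by continuity.
  by rewrite tauU ?mulr0 // => Uu; apply: nU3; exact: (setexpg_ge1 U1).
- by apply: Cc_supp3 => [|u nU3]; [continuity|rewrite th_supp3 ?mulr0].
- move=> x _; have /andP[t0 _] := tau01 x.
  by apply: ler_pM => //; exact: gleason_fun_ge_tau.
Qed.

Lemma autocorrelation_gleason_supp x : phi x != 0 -> (U `^^ 4) x.
Proof.
move=> /(autocorrelation_supp haarJ cth cU2 th_supp2)[u Uxu Uu].
rewrite -(mulgK u x); apply: (@setexpgD L U 2 2) => //.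
by apply: setexpgV => //; exact: nn_symmetric nUK.
Qed.

Lemma autocorrelation_gleason_norm_le x : `|phi x| <= J k1.
Proof.
rewrite -[leRHS]mul1r; apply: haar_supp3_le => // [|u nU3|u]; first by continuity.
  by rewrite (th_supp3 nU3) mulr0.
by rewrite normrM -[leRHS]mulr1; apply: ler_pM.
Qed.

Lemma autocorrelation_gleason_near e b x :
  0 < e -> W e b -> `|phi (b ∙ x) - phi x| <= J k1 * e.
Proof.
move=> e0 Wb; rewrite (autocorrelation_sub haarJ cth cU2 th_supp2) mulrC.
apply: haar_supp3_le => [||u nU3|u]; first exact: ltW.
- by continuity.
- by rewrite (th_supp3 nU3) mulr0.
rewrite normrM -[leRHS]mulr1; apply: ler_pM => //.
rewrite -mulgA -[b in th (b ∙ _)]conjg1; apply: th_near => //; exact: setexpg_mem1.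
Qed.

Lemma autocorrelation_gleason_second_difference e a b x :
  0 < e -> Q a -> W e b -> (U `^^ m) x ->
  `|(phi (a⁻¹ ∙ (b⁻¹ ∙ x)) - phi (b⁻¹ ∙ x)) - (phi (a⁻¹ ∙ x) - phi x)| <= J k1 * e / n%:R.
Proof.
move=> e0 Qa Wb Ux.
rewrite (autocorrelation_second_difference haarJ cth cU2 th_supp2).
rewrite (_ : J k1 * e / n%:R = n%:R^-1 * e * J k1); last by rewrite mulrC [J k1 * e]mulrC mulrA.
apply: haar_supp3_le => [||u nU3|u]; first by rewrite mulr_ge0 ?invr_ge0 // ltW.
- by continuity.
- rewrite (th_supp3 nU3) th_supp2 ?subrr ?mul0r // => U2au; apply: nU3.
  rewrite -(mulVKg a u); apply: mem_setmulg => //; apply: QU.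
  exact: (setexpg_ge1 Q1).
rewrite normrM; apply: ler_pM => //; first by apply: gleason_fun_lipschitz => //; exact: symQ.
rewrite (_ : x⁻¹ ∙ b ∙ u = (b ^ x)%g ∙ (x⁻¹ ∙ u)); last by gsimp.
exact: th_near.
Qed.

Lemma gleason_function_autocorrelation :
  gleason_function U m (J (fun x => tau x * tau x)) (J k1) W Q n phi.
Proof.
split; [exact: autocorrelation_gleason_ge|exact: autocorrelation_gleason_supp
  |exact: autocorrelation_gleason_norm_le|exact: autocorrelation_gleason_near
  |exact: autocorrelation_gleason_second_difference].
Qed.

End GleasonEstimates.

Lemma exists_gleason_functions (R : realType) (L : lcGroupType) (U K : set L) (m : nat) :
  normal_neighbourhood U K -> exists (m0 M : R) (W : R -> set L),
  [/\ (0 < m0)%R, (0 < M)%R, (forall e, (0 < e)%R -> set_nbhs K (W e)) &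
    forall Q n, Q 1%g -> symmetric Q -> (0 < n)%N -> Q `^^ n `<=` U ->
      exists phi, gleason_function U m m0 M W Q n phi].
Proof.
move=> nUK; have [cU symU cK sK KU UK] := nUK; have U1 := nn_mem1 nUK.
have sL : subgrp [set: L] by [].
have [J haarJ] := exists_haar_functional R sL (@closedT L).
have [tau [ucT tau01 tau1 tauU tauK]] := exists_invariant_bump R cK sK KU.
have ctau := left_unif_cont_continuous ucT.
have [k1 Ck1 k1_ge1] := exists_Cc_ge1 R sL (@closedT L) (@compact_setexpg L U 3 cU) (@subsetT _ _).
have /choice[W WP] (e : R) : exists W, (0 < e)%R -> set_nbhs K W /\
    forall b v z, W b -> (U `^^ m.+1) v -> (`|tau ((b ^ v)%g ∙ z) - tau z| <= e)%R.
  have [e0|_] := ltrP 0%R e; last by exists setT.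
  have [W KW We] := conjg_unif_cont (@compact_setexpg L U m.+1 cU)
    (normalised_setexpg (n := m.+1) UK) ucT tauK e0.
  by exists W.
exists (J (fun x => tau x * tau x)%R), (J k1), W; split.
- apply: (haar_gt0 haarJ (x := 1%g)) => //; last by rewrite tau1 mulr1.
    split; first by continuity.
    by exists U; split=> // x _ /tauU ->; rewrite mulr0.
  by move=> y _; case/andP: (tau01 y) => t0 _; exact: mulr_ge0.
- have k11 : (1 <= k1 1%g)%R by apply: k1_ge1; exact: setexpg_mem1.
  by apply: (haar_gt0 haarJ Ck1.1 _ _ (lt_le_trans ltr01 k11)) => // y _; exact: Ck1.2.
- by move=> e /WP[].
move=> Q n Q1 symQ n_gt0 QU; exists (autocorrelation J (gleason_fun tau Q n)).
apply: (@gleason_function_autocorrelation R L U K m J nUK haarJ tau k1 W Q n) => //.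
  by move=> e /WP[].
by move=> e b v z /WP[_]; exact.
Qed.

(** * Compact groups: isolating a small closed subgroup *)

Definition isolating (G : groupType) (O K : set G) :=
  forall D, subgrp D -> D `<=` O -> D `<=` K.

Record gap_subgroup (L : lcGroupType) (H K W : set L) : Prop := GapSubgroup {
  gap_closed : closed K;
  gap_subgrp : subgrp K;
  gap_sub : K `<=` H;
  gap_nbhs : nbhs 1%g W;
  gap_isolating : isolating (H `&` W `∙` K) K }.

Section PartitionOfUnity.
Variables (R : realType) (L : lcGroupType) (H : set L).
Hypothesis cH : compact H.
Local Open Scope ring_scope.

Lemma partition_of_unity (V : set L) : nbhs 1%g V ->
  exists (s : seq L) (p : L -> L -> R),
    [/\ (forall y, y \in s -> H y), (forall y, continuous (p y)), (forall y z, 0 <= p y z),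
        (forall y z, ~ V (y⁻¹ ∙ z) -> p y z = 0) &
        forall z, H z -> \sum_(y <- s) p y z = 1].
Proof.
move=> nV; have [b [cb b01 b1] bV] := exists_bump R nV.
have b_ge0 y : 0 <= b y by case/andP: (b01 y).
have [|s [sH sP]] := @compact_finite_cover L H (fun x => [set y | 1 / 2 < b (x⁻¹ ∙ y)]) cH.
  move=> x _; apply: (@nbhs_ltr R L (fun y => b (x⁻¹ ∙ y))); first by continuity.
  by rewrite mulVg b1; lra.
pose S z := \sum_(y <- s) b (y⁻¹ ∙ z).
have S_ge z : H z -> 1 / 2 <= S z.
  move=> Hz; have [y ys /= yz] := sP z Hz; rewrite /S (big_rem y) //=.
  have : 0 <= \sum_(x <- rem y s) b (x⁻¹ ∙ z) by apply: sumr_ge0.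
  by lra.
have max_gt0 z : 0 < Num.max (S z) (1 / 2) by rewrite lt_max; apply/orP; right; lra.
exists s, (fun y z => b (y⁻¹ ∙ z) / Num.max (S z) (1 / 2)); split=> //.
- move=> y; apply: continuous_mulT; first by continuity.
  apply: continuous_invT => [z|]; first by rewrite gt_eqF.
  apply: continuous_maxT; last exact: cst_continuous.
  by apply: continuous_sumT => i; continuity.
- by move=> y z; rewrite divr_ge0 // ltW.
- by move=> y z nVz; rewrite bV // mul0r.
- move=> z Hz; rewrite -mulr_suml -/(S z) max_l ?S_ge // divff // gt_eqF //.
  by have := S_ge z Hz; lra.
Qed.

Lemma separated_approximation (F : L * L -> R) (e : R) : continuous F -> 0 < e ->
  exists (s : seq L) (p : L -> L -> R), (forall y, continuous (p y)) /\
    forall z w, H z -> H w -> `|F (z, w) - \sum_(y <- s) p y z * F (y, w)| <= e.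
Proof.
move=> cF e0.
have [|V nV Ve] := unif_cont_near1 (F := fun q => F (q.2.1 ∙ q.1, q.2.2)) _
    (compact_setX cH cH) e0; first by continuity.
have [s [p [sH cp p0 pV p1]]] := partition_of_unity nV.
exists s, p; split=> // z w Hz Hw.
rewrite -[F (z, w)]mul1r -(p1 z Hz) mulr_suml -sumrB.
apply: le_trans (ler_norm_sum _ _ _) _.
rewrite -[leRHS]mul1r -(p1 z Hz) mulr_suml big_seq [leRHS]big_seq.
apply: ler_sum => y ys; rewrite -mulrBr normrM ger0_norm //.
have [Vz|nVz] := pselect (V (y⁻¹ ∙ z)); last by rewrite pV // !mul0r.
apply: ler_wpM2l => //.
by have := Ve _ (y, w) Vz (conj (sH y ys) Hw); rewrite /= mulVKg mulg1.
Qed.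

Lemma equicontinuous_ultralimit (I : Type) (F : set_system I) (g : I -> L -> R) (B : R) :
  UltraFilter F -> (forall i z, `|g i z| <= B) ->
  (forall e, 0 < e -> exists2 W, nbhs 1%g W &
    forall i z z', W (z⁻¹ ∙ z') -> `|g i z - g i z'| <= e) ->
  exists2 g' : L -> R, continuous g' &
    forall e, 0 < e -> F [set i | forall z, H z -> `|g i z - g' z| <= e].
Proof.
move=> UF gB equi.
have /choice[g' g'P] z : exists p : R, (g^~ z) @ F --> p.
  by apply: (@ultra_bounded_cvg _ F R _ B) => //; apply: filterE => i; exact: gB.
have equi' e : 0 < e -> exists2 W, nbhs 1%g W & forall z z', W (z⁻¹ ∙ z') ->
    (forall i, `|g i z - g i z'| <= e) /\ `|g' z - g' z'| <= e.
  move=> e0; have [W nW We] := equi e e0; exists W => // z z' Wz.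
  split=> [i|]; first exact: We.
  have := @ler_cvgr _ F R _ _ _ _ _ (cvg_norm (cvgB (g'P z) (g'P z'))) (cvg_cst e).
  by apply; apply: filterE => i; exact: We.
exists g'.
  move=> z; apply/(@cvgrPdist_le R R^o) => e e0; have [W nW We] := equi' e e0.
  by apply: filterS (nbhs_mulVg z nW) => y /= Wy; exact: (We z y Wy).2.
move=> e e0; have e3 : 0 < e / 3 by rewrite divr_gt0.
have [W nW We] := equi' _ e3.
have [|s [_ sP]] := @compact_finite_cover L H (fun x => [set y | W (x⁻¹ ∙ y)]) cH.
  by move=> x _; exact: nbhs_mulVg.
have : F [set i | forall y, y \in s -> `|g i y - g' y| <= e / 3].
  elim: s {sP} => [|y s IHs]; first by apply: filterE => i y; rewrite in_nil.
  have Fy : F [set i | `|g i y - g' y| <= e / 3].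
    have /(@cvgrPdist_le R R^o) /(_ _ e3) := g'P y.
    by apply: filterS => i /=; rewrite distrC.
  by apply: filterS2 IHs Fy => i IHs Fy y'; rewrite inE => /predU1P[->//|]; exact: IHs.
apply: filterS => i close z Hz; have [y ys Wz] := sP z Hz.
have [/(_ i) giz g'z] := We _ _ Wz; have giy := close y ys.
have -> : g i z - g' z = - (g i y - g i z) + (g i y - g' y) + (g' y - g' z) by lra.
apply: le_trans (ler_normD _ _) _; apply: le_trans (lerD (ler_normD _ _) (lexx _)) _.
by rewrite normrN; move: giz g'z giy; lra.
Qed.

End PartitionOfUnity.

Section CompactHaar.
Variables (R : realType) (L : lcGroupType) (H : set L) (J : (L -> R) -> R).
Local Open Scope ring_scope.
Hypotheses (cH : compact H) (sH : subgrp H) (haarJ : haar_functional H J).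
Implicit Types (h g u : L -> R) (x y z w v : L).
Local Notation mass := (J (fun=> 1)).

Let Cc_of_continuous h : continuous h -> Cc H h.
Proof. by move=> ch; split=> //; exists H; split. Qed.

Lemma intD h g : continuous h -> continuous g -> J (fun x => h x + g x) = J h + J g.
Proof. by move=> ch cg; apply: (haarD haarJ); exact: Cc_of_continuous. Qed.

Lemma intZ a h : continuous h -> J (fun x => a * h x) = a * J h.
Proof. by move=> ch; apply: (haarZ haarJ); exact: Cc_of_continuous. Qed.

Lemma intB h g : continuous h -> continuous g -> J (fun x => h x - g x) = J h - J g.
Proof. by move=> ch cg; apply: (haarB haarJ); exact: Cc_of_continuous. Qed.

Lemma int_mono h g : continuous h -> continuous g -> (forall x, H x -> h x <= g x) -> J h <= J g.
Proof. by move=> ch cg; apply: (haar_mono haarJ); exact: Cc_of_continuous. Qed.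

Lemma eq_int h g : continuous h -> continuous g -> (forall x, H x -> h x = g x) -> J h = J g.
Proof.
by move=> ch cg hg; apply/eqP; rewrite eq_le !int_mono // => x Hx; rewrite hg.
Qed.

Lemma int_translate z h : H z -> continuous h -> J (fun x => h (z ∙ x)) = J h.
Proof. by move=> Hz ch; apply: (haar_translate haarJ) => //; exact: Cc_of_continuous. Qed.

Lemma int_gt0 h x :
  continuous h -> (forall y, H y -> 0 <= h y) -> H x -> 0 < h x -> 0 < J h.
Proof. by move=> ch; apply: (haar_gt0 haarJ); exact: Cc_of_continuous. Qed.

Lemma mass_gt0 : 0 < mass.
Proof. by apply: (@int_gt0 _ 1%g) => //; [exact: cst_continuous|exact: subgrp1]. Qed.

Lemma int_cst c : J (fun=> c) = c * mass.
Proof. by rewrite -intZ; [congr J; apply/funext => x; rewrite mulr1|exact: cst_continuous]. Qed.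

Lemma int_norm_le h c : continuous h -> (forall x, H x -> `|h x| <= c) -> `|J h| <= c * mass.
Proof.
move=> ch hc; apply: (haar_norm_le haarJ); try by apply: Cc_of_continuous; continuity.
by move=> x Hx; rewrite mulr1; exact: hc.
Qed.

Lemma int_sum (I : Type) (s : seq I) (f : I -> L -> R) : (forall i, continuous (f i)) ->
  J (fun x => \sum_(i <- s) f i x) = \sum_(i <- s) J (f i).
Proof.
move=> cf; elim: s => [|i s IHs].
  by under eq_fun do rewrite big_nil; rewrite int_cst mul0r big_nil.
under eq_fun do rewrite big_cons; rewrite intD // ?IHs ?big_cons //.
exact: continuous_sumT.
Qed.

Lemma int_param_continuous (F : L * L -> R) :
  continuous F -> continuous (fun z => J (fun w => F (z, w))).
Proof.
move=> cF z; apply/(@cvgrPdist_le R R^o) => e e0.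
have m0 := mass_gt0; have d0 : 0 < e / mass by rewrite divr_gt0.
have [|W nW We] := unif_cont_near1 (F := fun p => F (p.1 ∙ z, p.2)) _ cH d0.
  by continuity.
apply: filterS (nbhs_mulgV z nW) => y /= Wy.
rewrite -intB; try by continuity.
rewrite -[leRHS](@divfK _ mass) ?gt_eqF //.
apply: int_norm_le => [|w Hw]; first by continuity.
by have := We _ w Wy Hw; rewrite /= mulgVK mul1g distrC.
Qed.

Lemma int_separated (p : L -> L -> R) (q : L -> L -> R) (s : seq L) :
  (forall y, continuous (p y)) -> (forall y, continuous (q y)) ->
  J (fun z => J (fun w => \sum_(y <- s) p y z * q y w)) =
  J (fun w => J (fun z => \sum_(y <- s) p y z * q y w)).
Proof.
move=> cp cq.
have intw z : J (fun w => \sum_(y <- s) p y z * q y w) = \sum_(y <- s) J (q y) * p y z.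
  rewrite int_sum => [|y]; last by have cqy := cq y; continuity.
  by apply: eq_bigr => y _; rewrite intZ // mulrC.
have intz w : J (fun z => \sum_(y <- s) p y z * q y w) = \sum_(y <- s) J (p y) * q y w.
  rewrite int_sum => [|y]; last by have cpy := cp y; continuity.
  by apply: eq_bigr => y _; under eq_fun do rewrite mulrC; rewrite intZ // mulrC.
under eq_fun do rewrite intw; under [in RHS]eq_fun do rewrite intz.
rewrite !int_sum => [|y|y]; last 2 first.
- by have [cpy cqy] := (cp y, cq y); continuity.
- by have [cpy cqy] := (cp y, cq y); continuity.
by apply: eq_bigr => y _; rewrite !intZ // mulrC.
Qed.

Lemma int_int_dist_le (F G : L * L -> R) e : continuous F -> continuous G ->
  (forall z w, H z -> H w -> `|F (z, w) - G (z, w)| <= e) ->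
  `|J (fun z => J (fun w => F (z, w))) - J (fun z => J (fun w => G (z, w)))| <=
    e * mass * mass.
Proof.
move=> cF cG FG; have cIF := int_param_continuous cF; have cIG := int_param_continuous cG.
rewrite -intB //; apply: int_norm_le => [|z Hz]; first by continuity.
rewrite -intB; try by continuity.
by apply: int_norm_le => [|w Hw]; [continuity|exact: FG].
Qed.

Lemma int_exchange (F : L * L -> R) : continuous F ->
  J (fun z => J (fun w => F (z, w))) = J (fun w => J (fun z => F (z, w))).
Proof.
move=> cF; have m0 := mass_gt0.
apply/eqP; rewrite -subr_eq0 -normr_le0; apply/ler_addgt0Pl => e0 e00; rewrite addr0.
pose e := e0 / (2 * mass * mass); have e_gt0 : 0 < e by rewrite divr_gt0 // !mulr_gt0.
have [s [p [cp pe]]] := separated_approximation cH cF e_gt0.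
pose G (q : L * L) := \sum_(y <- s) p y q.1 * F (y, q.2).
have cG : continuous G.
  by apply: continuous_sumT => y; apply: continuous_mulT; have cpy := cp y; continuity.
have FG := int_int_dist_le cF cG pe.
have cF' : continuous (fun q : L * L => F (q.2, q.1)) by continuity.
have cG' : continuous (fun q : L * L => G (q.2, q.1)) by continuity.
have FG' := int_int_dist_le cF' cG' (fun z w Hz Hw => pe w z Hw Hz).
have GE : J (fun z => J (fun w => G (z, w))) = J (fun w => J (fun z => G (z, w))).
  by apply: (@int_separated p (fun y w => F (y, w)) s) => // y; continuity.
have -> : e0 = e * mass * mass + e * mass * mass by rewrite /e; field; rewrite gt_eqF.
rewrite /= GE in FG FG'; apply: le_trans (lerD FG FG').
rewrite [X in _ <= _ + X]distrC; apply: le_trans (ler_normD _ _).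
by rewrite addrA subrK.
Qed.

Definition inner h g := J (fun x => h x * g x).
Definition sqnorm h := inner h h.

Lemma innerC h g : inner h g = inner g h.
Proof. by congr J; apply/funext => x; rewrite mulrC. Qed.

Lemma innerD h g u : continuous h -> continuous g -> continuous u ->
  inner (fun x => h x + g x) u = inner h u + inner g u.
Proof.
move=> ch cg cu; rewrite /inner -intD; try by continuity.
by congr J; apply/funext => x; rewrite mulrDl.
Qed.

Lemma innerZ a h u : continuous h -> continuous u -> inner (fun x => a * h x) u = a * inner h u.
Proof.
move=> ch cu; rewrite /inner -intZ; last by continuity.
by congr J; apply/funext => x; rewrite mulrA.
Qed.

Lemma innerB h g u : continuous h -> continuous g -> continuous u ->
  inner (fun x => h x - g x) u = inner h u - inner g u.
Proof.
move=> ch cg cu; rewrite /inner -intB; try by continuity.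
by congr J; apply/funext => x; rewrite mulrBl.
Qed.

Lemma eq_sqnorm h g : continuous h -> continuous g -> (forall x, H x -> h x = g x) ->
  sqnorm h = sqnorm g.
Proof.
by move=> ch cg hg; apply: eq_int; [continuity|continuity|move=> x Hx; rewrite hg].
Qed.

Lemma sqnorm_ge0 h : continuous h -> 0 <= sqnorm h.
Proof.
move=> ch; rewrite -[leLHS](mul0r mass) -int_cst; apply: int_mono; try by continuity.
by move=> x _; rewrite -expr2 sqr_ge0.
Qed.

Lemma sqnorm_le0_eq0 h : continuous h -> sqnorm h <= 0 -> forall x, H x -> h x = 0.
Proof.
move=> ch h0 x Hx; apply: contrapT => hx; suff : 0 < sqnorm h by rewrite ltNge h0.
apply: (@int_gt0 _ x) => //; first by continuity.
  by move=> y _; rewrite -expr2 sqr_ge0.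
by rewrite -expr2 exprn_even_gt0 //=; apply/eqP.
Qed.

Lemma sqnorm_le h (c : R) :
  continuous h -> (forall x, H x -> h x ^+ 2 <= c) -> sqnorm h <= c * mass.
Proof.
move=> ch hc; apply: le_trans (ler_norm _) _; apply: int_norm_le; first by continuity.
by move=> x Hx; rewrite -expr2 ger0_norm ?sqr_ge0 // hc.
Qed.

Lemma sqnormZ a h : continuous h -> sqnorm (fun x => a * h x) = a ^+ 2 * sqnorm h.
Proof.
by move=> ch; rewrite /sqnorm innerZ ?(innerC h) ?innerZ //; [rewrite mulrA expr2|continuity].
Qed.

Lemma sqnormB h g : continuous h -> continuous g ->
  sqnorm (fun x => h x - g x) = sqnorm h - 2 * inner h g + sqnorm g.
Proof.
move=> ch cg; have cB : continuous (fun x => h x - g x) by continuity.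
by rewrite /sqnorm innerB // innerC (innerC g) !innerB // (innerC g h); lra.
Qed.

Lemma sqnormD_le h g : continuous h -> continuous g ->
  sqnorm (fun x => h x + g x) <= 2 * sqnorm h + 2 * sqnorm g.
Proof.
move=> ch cg; have cB : continuous (fun x => h x - g x) by continuity.
have cD : continuous (fun x => h x + g x) by continuity.
have -> : sqnorm (fun x => h x + g x) = sqnorm h + 2 * inner h g + sqnorm g.
  by rewrite /sqnorm innerD // innerC (innerC g) !innerD // (innerC g h); lra.
by have := sqnorm_ge0 cB; rewrite sqnormB //; lra.
Qed.

Lemma Cauchy_Schwarz h g : continuous h -> continuous g ->
  inner h g ^+ 2 <= sqnorm h * sqnorm g.
Proof.
move=> ch cg; have [g0|g0] := ltrP 0 (sqnorm g); last first.
  have -> : inner h g = 0.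
    rewrite -(mul0r mass) -int_cst; apply: eq_int; try by continuity.
    by move=> x Hx; rewrite (sqnorm_le0_eq0 cg) // mulr0.
  by rewrite expr2 mul0r mulr_ge0 ?sqnorm_ge0.
pose a := inner h g / sqnorm g.
have cag : continuous (fun x => a * g x) by continuity.
have cB : continuous (fun x => h x - a * g x) by continuity.
have := sqnorm_ge0 cB; rewrite sqnormB // sqnormZ // innerC innerZ // (innerC g h).
have -> : inner h g = a * sqnorm g by rewrite /a divfK // gt_eqF.
move=> le; have -> : (a * sqnorm g) ^+ 2 = a ^+ 2 * sqnorm g * sqnorm g by ring.
by apply: ler_wpM2r; [exact: ltW|lra].
Qed.

(* [convolve] is a compact self-adjoint operator commuting with translations; it is nonzero on
   the functions orthogonal to those invariant under the conjugates of [x0], so its largest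
   eigenvalue there has a finite-dimensional eigenspace, on which [x0] acts nontrivially. *)
Section ConvolutionOperator.
Variables (tau : L -> R) (x0 : L).
Hypotheses (ucT : left_unif_cont tau) (tauV : forall x, tau x⁻¹ = tau x)
  (tau01 : forall x, 0 <= tau x <= 1) (tau1 : tau 1%g = 1)
  (Hx0 : H x0) (tau_x0 : forall w, tau (x0⁻¹ ∙ w) * tau w = 0).

Let ctau : continuous tau := left_unif_cont_continuous ucT.

Definition convolve h z := J (fun w => tau (z⁻¹ ∙ w) * h w).
Local Notation T := convolve.

Lemma convolve_continuous h : continuous h -> continuous (T h).
Proof.
by move=> ch; apply: (@int_param_continuous (fun p => tau (p.1⁻¹ ∙ p.2) * h p.2)); continuity.
Qed.

Lemma convolve_equicontinuous e : 0 < e -> exists2 W, nbhs 1%g W &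
  forall h z z', continuous h -> W (z⁻¹ ∙ z') ->
    (T h z - T h z') ^+ 2 <= e ^+ 2 * mass * sqnorm h.
Proof.
move=> e0; have [W nW We] := ucT e0; exists W => // h z z' ch Wz.
have -> : T h z - T h z' = inner (fun w => tau (z⁻¹ ∙ w) - tau (z'⁻¹ ∙ w)) h.
  rewrite /T -intB; try by continuity.
  by congr J; apply/funext => w; rewrite mulrBl.
apply: le_trans (Cauchy_Schwarz _ ch) _; first by continuity.
apply: ler_wpM2r; first exact: sqnorm_ge0.
apply: sqnorm_le => [|w Hw]; first by continuity.
have := We _ (z'⁻¹ ∙ w) Wz; rewrite -mulgA mulVKg => le.
by rewrite -real_normK ?num_real // ler_sqr ?nnegrE // ltW.
Qed.

Lemma convolve_sqr_le h z : continuous h -> T h z ^+ 2 <= mass * sqnorm h.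
Proof.
move=> ch; rewrite -[T h z]/(inner (fun w => tau (z⁻¹ ∙ w)) h).
apply: le_trans (Cauchy_Schwarz _ ch) _; first by continuity.
apply: ler_wpM2r; first exact: sqnorm_ge0.
rewrite -[leRHS]mul1r; apply: sqnorm_le => [|w Hw]; first by continuity.
by have /andP[t0 t1] := tau01 (z⁻¹ ∙ w); rewrite expr_le1.
Qed.

Lemma convolveB h g : continuous h -> continuous g ->
  T (fun x => h x - g x) = (fun z => T h z - T g z).
Proof.
move=> ch cg; apply/funext => z; rewrite /T -intB; try by continuity.
by congr J; apply/funext => w; rewrite mulrBr.
Qed.

Lemma convolveZ a h : continuous h -> T (fun x => a * h x) = (fun z => a * T h z).
Proof.
move=> ch; apply/funext => z; rewrite /T -intZ; last by continuity.
by congr J; apply/funext => w; rewrite mulrCA.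
Qed.

Lemma convolve_translate h y : H y -> continuous h ->
  T (fun x => h (y ∙ x)) = (fun z => T h (y ∙ z)).
Proof.
move=> Hy ch; apply/funext => z; rewrite /T -[RHS](int_translate Hy); last by continuity.
by congr J; apply/funext => w; congr (tau _ * _); gsimp.
Qed.

Lemma eq_convolve h g z : continuous h -> continuous g -> (forall x, H x -> h x = g x) ->
  T h z = T g z.
Proof.
by move=> ch cg hg; apply: eq_int => [||x Hx]; [continuity|continuity|rewrite hg].
Qed.

Lemma convolve_selfadjoint h g : continuous h -> continuous g ->
  inner (T h) g = inner h (T g).
Proof.
move=> ch cg; pose F (p : L * L) := tau (p.1⁻¹ ∙ p.2) * h p.2 * g p.1.
have cF : continuous F by rewrite /F; continuity.
have -> : inner (T h) g = J (fun z => J (fun w => F (z, w))).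
  congr J; apply/funext => z; rewrite mulrC /T -intZ; last by continuity.
  by congr J; apply/funext => w; rewrite /F /= mulrC.
rewrite (int_exchange cF); congr J; apply/funext => w; rewrite /T -intZ; last by continuity.
congr J; apply/funext => z; rewrite /F /= -[tau (w⁻¹ ∙ z)]tauV invgM invgK.
by rewrite mulrAC mulrC.
Qed.

Definition conj_invariant u := continuous u /\
  forall y v, H y -> H v -> u ((x0 ^ y)%g ∙ v) = u v.

Definition conj_orthogonal h := continuous h /\ forall u, conj_invariant u -> inner h u = 0.
Local Notation S := conj_orthogonal.

Lemma conj_orthogonal_convolve h : S h -> S (T h).
Proof.
move=> [ch hu]; split=> [|u [cu ui]]; first exact: convolve_continuous.
rewrite convolve_selfadjoint //; apply: hu; split; first exact: convolve_continuous.
move=> y v Hy Hv; have Hxy : H (x0 ^ y)%g by exact: subgrpJ.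
have := congr1 (@^~ v) (convolve_translate Hxy cu); rewrite /= => <-.
by apply: eq_convolve => [||x Hx]; [continuity|continuity|exact: ui].
Qed.

Lemma conj_orthogonalB h g : S h -> S g -> S (fun x => h x - g x).
Proof.
move=> [ch hu] [cg gu]; split=> [|u iu]; first by continuity.
by rewrite innerB //; [rewrite hu // gu // subrr|exact: iu.1].
Qed.

Lemma conj_orthogonalZ a h : S h -> S (fun x => a * h x).
Proof.
move=> [ch hu]; split=> [|u iu]; first by continuity.
by rewrite innerZ //; [rewrite hu // mulr0|exact: iu.1].
Qed.

Lemma conj_orthogonal_translate y h : H y -> S h -> S (fun x => h (y ∙ x)).
Proof.
move=> Hy [ch hu]; split=> [|u [cu ui]]; first by continuity.
rewrite -(hu (fun x => u (y⁻¹ ∙ x))).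
  rewrite /inner -[RHS](int_translate Hy); last by continuity.
  by congr J; apply/funext => x; rewrite mulKg.
split=> [|z v Hz Hv]; first by continuity.
have Hy' := subgrpV sH Hy.
rewrite -(ui (z ∙ y) (y⁻¹ ∙ v)); [|exact: subgrpM|exact: subgrpM].
by congr u; gsimp.
Qed.

Lemma conj_orthogonal_closed g : continuous g ->
  (forall e, 0 < e -> exists2 h, S h & sqnorm (fun x => h x - g x) <= e) -> S g.
Proof.
move=> cg approx; split=> // u iu; have cu := iu.1.
apply/eqP; rewrite -sqrf_eq0 eq_le sqr_ge0 andbT; have u0 := sqnorm_ge0 cu.
apply/ler_addgt0Pl => e e0; rewrite addr0.
have d0 : 0 < e / (sqnorm u + 1) by rewrite divr_gt0 //; lra.
have [h Sh hg] := approx _ d0; have ch := Sh.1.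
have -> : inner g u = - inner (fun x => h x - g x) u by rewrite innerB // Sh.2 // sub0r opprK.
rewrite sqrrN; apply: le_trans (Cauchy_Schwarz _ cu) _; first by continuity.
apply: le_trans (ler_wpM2r u0 hg) _.
by rewrite mulrAC ler_pdivrMr ?ler_wpM2l //; lra.
Qed.

Lemma conj_orthogonal_difference : S (fun v => tau (x0⁻¹ ∙ v) - tau v).
Proof.
split=> [|u [cu ui]]; first by continuity.
rewrite innerB; try by continuity.
rewrite /inner -(int_translate Hx0 (h := fun x => tau (x0⁻¹ ∙ x) * u x)); last by continuity.
rewrite (eq_int (g := fun x => tau x * u x)) ?subrr //; try by continuity.
move=> x Hx; rewrite mulKg; congr (_ * _).
by have := ui 1%g x (subgrp1 sH) Hx; rewrite conjg1.
Qed.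

Definition sqr_opnorm := sup [set sqnorm (T h) | h in [set h | S h /\ sqnorm h <= 1]].
Local Notation Lam := sqr_opnorm.

Lemma sqnorm_convolve_le_opnorm h : S h -> sqnorm h <= 1 -> sqnorm (T h) <= Lam.
Proof.
move=> Sh h_le1; apply: ub_le_sup; last by exists h.
exists (mass * mass) => _ [g [[cg _] g1] <-]; have m0 := mass_gt0.
apply: sqnorm_le => [|x _]; first exact: convolve_continuous.
by apply: le_trans (convolve_sqr_le x cg) _; rewrite -[leRHS]mulr1 ler_wpM2l // ltW.
Qed.

Lemma convolve_difference_neq0 : 0 < sqnorm (T (fun v => tau (x0⁻¹ ∙ v) - tau v)).
Proof.
have [cd _] := conj_orthogonal_difference; have Hx0V := subgrpV sH Hx0.
rewrite ltNge; apply/negP => /(sqnorm_le0_eq0 (convolve_continuous cd)) /(_ x0 Hx0).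
rewrite convolveB ?convolve_translate //; try by continuity.
rewrite mulVg {2}/T; under [X in _ - J X]eq_fun do rewrite tau_x0.
rewrite int_cst mul0r subr0 => T0; suff : 0 < T tau 1%g by rewrite T0 ltxx.
apply: (@int_gt0 _ 1%g); first by continuity.
- by move=> y _; apply: mulr_ge0; [case/andP: (tau01 (1%g⁻¹ ∙ y))|case/andP: (tau01 y)].
- exact: subgrp1.
- by rewrite mulVg tau1 mulr1.
Qed.

Lemma sqr_opnorm_gt0 : 0 < Lam.
Proof.
have Sd := conj_orthogonal_difference; have cd := Sd.1; set d := fun v => _ in Sd cd.
have n0 := sqnorm_ge0 cd; pose c := (1 + sqnorm d)^-1.
have c0 : 0 < c by rewrite invr_gt0; lra.
have c_inv : c * (1 + sqnorm d) = 1 by rewrite mulVf // gt_eqF //; lra.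
apply: (@lt_le_trans _ _ (sqnorm (T (fun x => c * d x)))).
  rewrite convolveZ // sqnormZ; last exact: convolve_continuous.
  by rewrite mulr_gt0 ?exprn_gt0 //; exact: convolve_difference_neq0.
apply: sqnorm_convolve_le_opnorm; first exact: conj_orthogonalZ.
by rewrite sqnormZ // expr2 -mulrA; nra.
Qed.

Lemma sqnorm_convolve_le h : S h -> sqnorm (T h) <= Lam * sqnorm h.
Proof.
move=> Sh; have [ch _] := Sh; have [h0|h0] := ltrP 0 (sqnorm h); last first.
  have hz := sqnorm_le0_eq0 ch h0.
  apply: (@le_trans _ _ 0); last by rewrite mulr_ge0 ?sqnorm_ge0 // ltW // sqr_opnorm_gt0.
  rewrite -[leRHS](mul0r mass); apply: sqnorm_le => [|x _]; first exact: convolve_continuous.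
  have -> : T h x = 0; last by rewrite expr0n.
  rewrite -(mul0r mass) -int_cst; apply: eq_int; try by continuity.
  by move=> y Hy; rewrite hz // mulr0.
pose c := (Num.sqrt (sqnorm h))^-1.
have c2 : c ^+ 2 = (sqnorm h)^-1 by rewrite exprVn sqr_sqrtr // ltW.
have := sqnorm_convolve_le_opnorm (conj_orthogonalZ c Sh).
rewrite sqnormZ // c2 mulVf ?gt_eqF // => /(_ (lexx _)).
rewrite convolveZ // sqnormZ; last exact: convolve_continuous.
by rewrite c2 ler_pdivrMl // mulrC.
Qed.

Let T2sub h z := T (T h) z - Lam * h z.

Let T2sub_continuous h : continuous h -> continuous (T2sub h).
Proof.
move=> ch; have cTTh := convolve_continuous (convolve_continuous ch).
by rewrite /T2sub; continuity.
Qed.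

Lemma sqnorm_T2sub_le h : S h -> sqnorm (T2sub h) <= 4 * Lam ^+ 2 * sqnorm h.
Proof.
move=> Sh; have [ch _] := Sh; have L0 := sqr_opnorm_gt0.
have cTT := convolve_continuous (convolve_continuous ch).
have -> : T2sub h = (fun z => T (T h) z + (- Lam) * h z).
  by apply/funext => z; rewrite mulNr.
apply: le_trans (sqnormD_le cTT _) _; first by continuity.
rewrite sqnormZ // sqrrN; have := sqnorm_convolve_le (conj_orthogonal_convolve Sh).
have := ler_wpM2l (ltW L0) (sqnorm_convolve_le Sh); lra.
Qed.

Lemma sqnorm_T2sub_convolve_le h e : S h -> sqnorm h <= 1 -> Lam - e <= sqnorm (T h) ->
  sqnorm (T2sub (T h)) <= Lam ^+ 2 * e.
Proof.
move=> Sh h_le1 he; have [ch _] := Sh; have L0 := sqr_opnorm_gt0.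
have cTh := convolve_continuous ch; have cTTh := convolve_continuous cTh.
have -> : T2sub (T h) = T (fun z => T (T h) z - Lam * h z).
  by rewrite convolveB ?convolveZ //; continuity.
have Sd : S (fun z => T (T h) z - Lam * h z).
  by apply: conj_orthogonalB; [do 2 apply: conj_orthogonal_convolve|exact: conj_orthogonalZ].
apply: le_trans (sqnorm_convolve_le Sd) _; rewrite expr2 -mulrA; apply: ler_wpM2l.
  exact: ltW.
rewrite sqnormB; [|by []|by continuity].
rewrite sqnormZ // innerC innerZ // -convolve_selfadjoint //.
have := sqnorm_convolve_le (conj_orthogonal_convolve Sh).
have : Lam ^+ 2 * sqnorm h <= Lam ^+ 2 by rewrite ger_pMr ?exprn_gt0.
have := ler_wpM2l (ltW L0) he; rewrite expr2 /sqnorm.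
by lra.
Qed.

Lemma near_maximizer e : 0 < e -> exists h, [/\ S h, sqnorm h <= 1 & Lam - e <= sqnorm (T h)].
Proof.
move=> e0; have : Lam - e < Lam by rewrite ltrBlDr ltrDl.
move=> /sup_gt[|_ [h [Sh h_le1] <-] lt]; last by exists h; split=> //; exact: ltW.
have Sd := conj_orthogonal_difference.
exists (sqnorm (T (fun v => 0 * (tau (x0⁻¹ ∙ v) - tau v)))).
exists (fun v => 0 * (tau (x0⁻¹ ∙ v) - tau v)) => //; split; first exact: conj_orthogonalZ Sd.
by rewrite sqnormZ ?expr0n ?mul0r //; exact: Sd.1.
Qed.

Lemma sqnorm_le_of_norm_le d e : 0 < e -> continuous d ->
  (forall z, H z -> `|d z| <= Num.min 1 (e / mass)) -> sqnorm d <= e.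
Proof.
move=> e0 cd dz; have m0 := mass_gt0; set m := Num.min 1 _ in dz.
have m_gt0 : 0 < m by rewrite lt_min ltr01 divr_gt0.
have m_le1 : m <= 1 by rewrite ge_min lexx.
have me : m * mass <= e by rewrite -ler_pdivlMr // ge_min lexx orbT.
apply: le_trans me; apply: sqnorm_le => // z Hz; rewrite -real_normK ?num_real //.
apply: (@le_trans _ _ (m ^+ 2)); first by rewrite ler_sqr ?nnegrE ?dz // ltW.
by rewrite expr2 ger_pMr.
Qed.

Lemma exists_maximizing_limit : exists2 g, continuous g & forall e, 0 < e -> exists h,
  [/\ S h, sqnorm h <= 1, Lam - e <= sqnorm (T h) & sqnorm (fun z => T h z - g z) <= e].
Proof.
have m0 := mass_gt0.
have /choice[h hP] (n : nat) : exists h,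
    [/\ S h, sqnorm h <= 1 & Lam - n.+1%:R^-1 <= sqnorm (T h)].
  by apply: near_maximizer; rewrite invr_gt0.
have Sh n : S (h n) by have [] := hP n.
have ch n : continuous (h n) := (Sh n).1.
have mass_sqnorm n : mass * sqnorm (h n) <= mass.
  by have [_ h_le1 _] := hP n; rewrite -[leRHS]mulr1 ler_wpM2l // ltW.
have [F [UF Fge]] := nat_ultrafilter.
have [n z|e e0|g cg gF] :=
    @equicontinuous_ultralimit R L H cH nat F (fun n => T (h n)) (mass + 1) UF.
- rewrite -ler_sqr ?nnegrE ?addr_ge0 ?(ltW m0) // real_normK ?num_real //.
  by apply: le_trans (le_trans (convolve_sqr_le z (ch n)) (mass_sqnorm n)) _; nra.
- have [d d0 eE] : exists2 d, 0 < d & e = d * (mass + 1).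
    exists (e / (mass + 1)); first by rewrite divr_gt0 // addr_gt0.
    by rewrite divfK // gt_eqF // addr_gt0.
  have [W nW We] := convolve_equicontinuous d0; exists W => // n z z' Wz.
  rewrite -ler_sqr ?nnegrE ?(ltW e0) // real_normK ?num_real //.
  apply: le_trans (We (h n) z z' (ch n) Wz) _; rewrite eE exprMn -[leLHS]mulrA.
  by apply: ler_wpM2l; [exact: sqr_ge0|have := mass_sqnorm n; nra].
exists g => // e e0; have em0 : 0 < Num.min 1 (e / mass) by rewrite lt_min ltr01 divr_gt0.
have [n [close small]] :=
  filter_ex (filterI (gF _ em0) (@harmonic_eventually_small R F e _ Fge e0)).
have [_ h_le1 hLam] := hP n; exists (h n); split=> //; last first.
  apply: sqnorm_le_of_norm_le => //.
  by have cTh := convolve_continuous (ch n); continuity.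
by apply: le_trans hLam; rewrite lerD2l lerN2; exact: small.
Qed.

Definition top_eigenfunction h := S h /\ forall x, H x -> T (T h) x = Lam * h x.

Lemma exists_top_eigenfunction : exists2 g, top_eigenfunction g & 0 < sqnorm g.
Proof.
have [g cg approx] := exists_maximizing_limit; have L0 := sqr_opnorm_gt0.
have Sg : S g.
  apply: conj_orthogonal_closed => // e e0; have [h [Sh _ _ hg]] := approx e e0.
  by exists (T h) => //; exact: conj_orthogonal_convolve.
have cTTg := T2sub_continuous cg.
exists g; first split=> // x Hx.
  apply/eqP; rewrite -subr_eq0; apply/eqP; apply: (sqnorm_le0_eq0 cTTg) => //.
  apply/ler_addgt0Pl => e e0; rewrite addr0.
  have d0 : 0 < e / (10 * Lam ^+ 2) by rewrite divr_gt0 // mulr_gt0 // exprn_gt0.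
  have [h [Sh h_le1 hLam hg]] := approx _ d0; have STh := conj_orthogonal_convolve Sh.
  have Sdiff : S (fun z => T h z - g z) by exact: conj_orthogonalB.
  have cT2d := T2sub_continuous Sdiff.1; have cT2h := T2sub_continuous STh.1.
  have -> : T2sub g = (fun z => T2sub (T h) z + - 1 * T2sub (fun z => T h z - g z) z).
    have [cTh cTg] := (STh.1, convolve_continuous cg).
    have cTTh := convolve_continuous cTh.
    by apply/funext => z; rewrite /T2sub !convolveB //; lra.
  apply: le_trans (sqnormD_le cT2h _) _; first by continuity.
  rewrite sqnormZ //; have := sqnorm_T2sub_convolve_le Sh h_le1 hLam.
  have L4 : 0 <= 4 * Lam ^+ 2 by rewrite mulr_ge0 ?sqr_ge0.
  have := le_trans (sqnorm_T2sub_le Sdiff) (ler_wpM2l L4 hg).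
  have -> : Lam ^+ 2 * (e / (10 * Lam ^+ 2)) = e / 10 by field; rewrite gt_eqF.
  have -> : 4 * Lam ^+ 2 * (e / (10 * Lam ^+ 2)) = 4 * e / 10 by field; rewrite gt_eqF.
  by lra.
rewrite ltNge; apply/negP => g0.
have L6 : 0 < Lam / 6 by rewrite divr_gt0.
have [h [Sh _ hLam hg]] := approx _ L6.
have cTh := convolve_continuous Sh.1.
have cdiff : continuous (fun z => T h z - g z) by continuity.
have := sqnormD_le cdiff cg; under [X in sqnorm X <= _]eq_fun do rewrite subrK.
by lra.
Qed.

Lemma top_eigenfunction_continuous h : top_eigenfunction h -> continuous h.
Proof. by case=> -[]. Qed.

Lemma top_eigenfunctionB h g :
  top_eigenfunction h -> top_eigenfunction g -> top_eigenfunction (fun x => h x - g x).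
Proof.
move=> [Sh hL] [Sg gL]; have [ch cg] := (Sh.1, Sg.1); split; first exact: conj_orthogonalB.
move=> x Hx; rewrite !convolveB ?hL ?gL ?mulrBr //; exact: convolve_continuous.
Qed.

Lemma top_eigenfunction_translate y h :
  H y -> top_eigenfunction h -> top_eigenfunction (fun x => h (y ∙ x)).
Proof.
move=> Hy [Sh hL]; have ch := Sh.1; split; first exact: conj_orthogonal_translate.
move=> x Hx; rewrite !convolve_translate ?hL //; first exact: subgrpM.
exact: convolve_continuous.
Qed.

(* Precompactness of the unit ball of the eigenspace: translation by an element close to the
   identity moves all its elements by a bounded fraction of their norm. *)
Lemma top_eigenfunction_near_translate : exists2 W, nbhs 1%g W & forall y h,
  W y -> H y -> top_eigenfunction h -> sqnorm (fun z => h (y ∙ z) - h z) <= sqnorm h / 4.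
Proof.
have L0 := sqr_opnorm_gt0; have m0 := mass_gt0.
pose e := Num.min 1 (Lam / (4 * mass ^+ 2)).
have e0 : 0 < e by rewrite lt_min ltr01 divr_gt0 // mulr_gt0 // exprn_gt0.
have e_small : e ^+ 2 * (4 * mass ^+ 2) <= Lam.
  apply: (@le_trans _ _ (e * (4 * mass ^+ 2))).
    apply: ler_wpM2r; first by rewrite mulr_ge0 ?sqr_ge0.
    by rewrite expr2 ger_pMr // ge_min lexx.
  by rewrite -ler_pdivlMr ?mulr_gt0 ?exprn_gt0 // ge_min lexx orbT.
have [W0 nW0 W0e] := convolve_equicontinuous e0.
have [W1 nW1 W1W0] := nbhs_conjg_compact cH nW0.
exists [set y | W1 y⁻¹] => [|y h /= Wy Hy [Sh hL]]; first exact: nbhs_invg.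
have ch := Sh.1; have h0 := sqnorm_ge0 ch.
have cTh := convolve_continuous ch.
have diff_le z : H z -> (h (y ∙ z) - h z) ^+ 2 <= Lam^-1 * (e ^+ 2 * mass * sqnorm h).
  move=> Hz; have Hyz := subgrpM sH Hy Hz.
  have -> : h (y ∙ z) - h z = Lam^-1 * (T (T h) (y ∙ z) - T (T h) z).
    by rewrite !hL // -mulrBr mulKf // gt_eqF.
  have W0z : W0 ((y ∙ z)⁻¹ ∙ z) by have := W1W0 _ _ Wy Hz; rewrite conjgE invgM mulgA.
  have := le_trans (W0e (T h) _ _ cTh W0z)
    (ler_wpM2l (mulr_ge0 (sqr_ge0 e) (ltW m0)) (sqnorm_convolve_le Sh)).
  rewrite exprMn; set D := (_ - _) ^+ 2 => DL.
  rewrite expr2 -mulrA ler_wpM2l ?invr_ge0 ?(ltW L0) // mulrC ler_pdivrMr //.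
  by apply: le_trans DL _; rewrite le_eqVlt; apply/orP; left; apply/eqP; ring.
apply: le_trans (sqnorm_le _ diff_le) _; first by continuity.
rewrite (_ : _ * mass = e ^+ 2 * (4 * mass ^+ 2) * (sqnorm h / (4 * Lam))); last first.
  by field; rewrite gt_eqF.
rewrite (_ : sqnorm h / 4 = Lam * (sqnorm h / (4 * Lam))); last by field; rewrite gt_eqF.
by apply: ler_wpM2r => //; rewrite divr_ge0 // mulr_ge0 // ltW.
Qed.

Definition eigen_stabiliser := [set y | H y /\
  forall h, top_eigenfunction h -> forall v, H v -> h (y ∙ v) = h v].

Lemma subgrp_eigen_stabiliser : subgrp eigen_stabiliser.
Proof.
split; first by split=> [|h _ v _]; [exact: subgrp1|rewrite mul1g].
split=> [x y [Hx xP] [Hy yP]|x [Hx xP]].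
  split=> [|h Zh v Hv]; first exact: subgrpM.
  by rewrite -mulgA xP //; [exact: yP|exact: subgrpM].
have HxV := subgrpV sH Hx; split=> // h Zh v Hv.
by rewrite -(xP h Zh (x⁻¹ ∙ v)) ?mulVKg //; exact: subgrpM.
Qed.

Lemma closed_eigen_stabiliser : closed eigen_stabiliser.
Proof.
move=> y cy; split; first by apply: (compact_closedg cH); apply: closureS cy => x [].
move=> h Zh v Hv; have ch := top_eigenfunction_continuous Zh.
have cdiff : continuous (fun y => h (y ∙ v) - h v) by continuity.
have cl : closed [set y | h (y ∙ v) - h v = 0].
  by apply: (@preimage_closed _ _ _ [set 0 : R] (fun x _ => cdiff x)); exact: closed_eq.
apply/eqP; rewrite -subr_eq0; apply/eqP; apply: cl.
by apply: closureS cy => x [_ xP] /=; rewrite xP // subrr.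
Qed.

Lemma eigen_stabiliser_moves : ~ eigen_stabiliser x0.
Proof.
move=> [_ x0P]; have [g Zg g0] := exists_top_eigenfunction.
suff ig : conj_invariant g by have [[_ /(_ g ig) gg] _] := Zg; move: g0; rewrite /sqnorm gg ltxx.
split=> [|y v Hy Hv]; first exact: top_eigenfunction_continuous.
have HyV := subgrpV sH Hy.
have := x0P _ (top_eigenfunction_translate HyV Zg) (y ∙ v) (subgrpM sH Hy Hv).
by rewrite mulKg => <-; congr g; gsimp.
Qed.

Lemma defect_growth y h : H y -> top_eigenfunction h ->
  (forall g, top_eigenfunction g -> sqnorm (fun z => g (y ∙ z) - g z) <= sqnorm g / 4) ->
  (3 / 2) * sqnorm (fun z => h (y ∙ z) - h z) <= sqnorm (fun z => h (y ^^ 2 ∙ z) - h z).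
Proof.
move=> Hy Zh contr; have ch := top_eigenfunction_continuous Zh.
pose d z := h (y ∙ z) - h z.
have Zd : top_eigenfunction d.
  by apply: top_eigenfunctionB => //; exact: top_eigenfunction_translate.
have cd := top_eigenfunction_continuous Zd.
have cX : continuous (fun z => h (y ^^ 2 ∙ z) - h z) by continuity.
have cE : continuous (fun z => - 1 * (d (y ∙ z) - d z)) by continuity.
have := sqnormD_le cX cE; rewrite sqnormZ; last by continuity.
have -> : (fun x => h (y ^^ 2 ∙ x) - h x + - 1 * (d (y ∙ x) - d x)) = (fun x => 2 * d x).
  by apply/funext => z; rewrite /d expg2 !mulgA; lra.
rewrite sqnormZ // -[sqnorm (fun z => h (y ∙ z) - h z)]/(sqnorm d).
by have := contr d Zd; have := sqnorm_ge0 cd; lra.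
Qed.

(* Otherwise the displacement of an eigenfunction under [y ^ (2 ^ k)] grows without bound. *)
Lemma sub_eigen_stabiliser (D : set L) : subgrp D -> D `<=` H ->
  (forall y h, D y -> top_eigenfunction h ->
    sqnorm (fun z => h (y ∙ z) - h z) <= sqnorm h / 4) ->
  D `<=` eigen_stabiliser.
Proof.
move=> sD DH contr y Dy; split=> [|h Zh v Hv]; first exact: DH.
have ch := top_eigenfunction_continuous Zh.
pose a k := sqnorm (fun z => h (y ^^ (2 ^ k) ∙ z) - h z).
have a_ge0 : 0 <= a 0%N by apply: sqnorm_ge0; continuity.
have growth k : (1 + k%:R / 2) * a 0%N <= a k.
  elim: k => [|k IHk]; first by rewrite mul0r addr0 mul1r.
  have Dyk : D (y ^^ (2 ^ k)) by exact: subgrpX.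
  have := defect_growth (DH _ Dyk) Zh (fun g => contr _ g Dyk).
  rewrite -expgnA -expnSr -/(a k.+1) -/(a k) -natr1.
  have : 0 <= k%:R * a 0%N by rewrite mulr_ge0.
  by lra.
have a0 : a 0%N <= 0.
  rewrite leNgt; apply/negP => a_gt0.
  have lt_k := archi_boundP (divr_ge0 (sqnorm_ge0 ch) a_ge0); set k := Num.bound _ in lt_k.
  have := growth k; have := contr _ h (subgrpX (2 ^ k) sD Dy) Zh.
  by move: lt_k; rewrite -/(a k) ltr_pdivrMr //; have := sqnorm_ge0 ch; lra.
have c0 : continuous (fun z => h (y ^^ (2 ^ 0) ∙ z) - h z) by continuity.
have := sqnorm_le0_eq0 c0 a0 Hv; rewrite expn0 expg1 => /eqP.
by rewrite subr_eq0 => /eqP.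
Qed.

Lemma exists_gap_subgroup_avoiding : exists K W, gap_subgroup H K W /\ ~ K x0.
Proof.
have [W nW We] := top_eigenfunction_near_translate.
exists eigen_stabiliser, W; split; last exact: eigen_stabiliser_moves.
split=> //; [exact: closed_eigen_stabiliser|exact: subgrp_eigen_stabiliser|by move=> y []|].
move=> D sD DHW; apply: sub_eigen_stabiliser => // [y /DHW[]//|y h Dy Zh].
have [Hy [w Ww [k [Hk kP] wk]]] := DHW y Dy.
have Hw : H w by rewrite -(mulgK k w) wk; apply: subgrpM => //; exact: subgrpV.
apply: le_trans (We w h Ww Hw Zh); rewrite le_eqVlt; apply/orP; left; apply/eqP.
have ch := top_eigenfunction_continuous Zh.
apply: eq_sqnorm => [||x Hx]; [by continuity|by continuity|].
by rewrite -wk -mulgA (kP _ (top_eigenfunction_translate Hw Zh)).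
Qed.

End ConvolutionOperator.

End CompactHaar.

Section Gap.
Variables (L : lcGroupType) (H : set L).
Hypotheses (cH : compact H) (sH : subgrp H).

Lemma exists_gap_subgroup_notin (R : realType) x : H x -> x <> 1%g ->
  exists K W, gap_subgroup H K W /\ ~ K x.
Proof.
move=> Hx nx; have [J haarJ] := exists_haar_functional R sH (compact_closedg cH).
have nV : nbhs 1%g (~` [set x]).
  apply: open_nbhs_nbhs; split; last by move=> /= e; apply: nx.
  by apply: closed_openC; apply: compact_closedg; exact: compact_set1.
have [W [nW _ WW]] := nbhs_half nV.
have [C [cC nC symC CW]] := nbhs_compact_symmetric nW.
have [b [cb b01 b1] bC] := exists_bump R nC.
pose tau y := (b y * b y⁻¹)%R.
have ctau : continuous tau by rewrite /tau; continuity.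
have tauC y : ~ C y -> tau y = 0%R by move=> nCy; rewrite /tau bC // mul0r.
apply: (@exists_gap_subgroup_avoiding R L H J cH sH haarJ tau) => //.
- exact: compact_support_left_unif_cont cC tauC.
- by move=> y; rewrite /tau invgK mulrC.
- move=> y; have [/andP[p q] /andP[p' q']] := (b01 y, b01 y⁻¹).
  by rewrite mulr_ge0 //= -[leRHS]mulr1; apply: ler_pM.
- by rewrite /tau invg1 b1 mulr1.
- move=> w; have [Cw|nCw] := pselect (C w); last by rewrite (tauC w) ?mulr0.
  have [Cxw|nCxw] := pselect (C (x⁻¹ ∙ w)); last by rewrite tauC ?mul0r.
  case: (WW _ (mem_setmulg (CW _ Cw) (CW _ (symC _ Cxw)))).
  by gsimp.
Qed.

Lemma gap_subgroupT : gap_subgroup H H setT.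
Proof.
split=> //; [exact: compact_closedg|exact: filterT|].
by move=> D _ DH y /DH[].
Qed.

Lemma gap_subgroupI K W K' W' :
  gap_subgroup H K W -> gap_subgroup H K' W' -> gap_subgroup H (K `&` K') (W `&` W').
Proof.
move=> [clK sK KH nW isoK] [clK' sK' K'H nW' isoK']; split.
- exact: closedI.
- exact: subgrpI.
- by move=> y [/KH].
- exact: filterI.
move=> D sD DHW y Dy; split; first apply: (isoK D) => // z /DHW[Hz Wz].
  by split=> //; apply: setmulgS Wz => ? [].
by apply: (isoK' D) => // z /DHW[Hz Wz]; split=> //; apply: setmulgS Wz => ? [].
Qed.

Lemma exists_gap_subgroup (R : realType) (O : set L) : nbhs 1%g O ->
  exists K W, gap_subgroup H K W /\ K `<=` O.
Proof.
move=> nO.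
have cC : compact (H `&` ~` O°).
  by apply: compact_closedI => //; apply: open_closedC; exact: open_interior.
have C_neq1 x : (H `&` ~` O°) x -> x <> 1%g by move=> [_ nOx] e; apply: nOx; rewrite e.
have /choice[KW KWP] x : exists KW : set L * set L, (H `&` ~` O°) x ->
    gap_subgroup H KW.1 KW.2 /\ ~ KW.1 x.
  have [Cx|nCx] := pselect ((H `&` ~` O°) x); last by exists (setT, setT).
  have [K [W KWx]] := exists_gap_subgroup_notin R Cx.1 (C_neq1 x Cx).
  by exists (K, W).
have [x Cx|s [sC sP]] := @compact_finite_cover L (H `&` ~` O°) (fun x => ~` (KW x).1) cC.
  have [[clK _ _ _ _] nKx] := KWP x Cx.
  by apply: open_nbhs_nbhs; split=> //; exact: closed_openC.
suff [K [W [gK Ks]]] : exists K W, gap_subgroup H K W /\ forall x, x \in s -> K `<=` (KW x).1.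
  exists K, W; split=> // y Ky; apply: interior_subset; apply: contrapT => nOy.
  have [x xs] := sP y (conj (gap_sub gK Ky) nOy).
  by apply; exact: Ks Ky.
elim: s sC {sP} => [_|x s IHs sC]; first by exists H, setT; split=> //; exact: gap_subgroupT.
have [y ys|K [W [gK Ks]]] := IHs; first by apply: sC; rewrite inE ys orbT.
have [gKx _] := KWP x (sC x (mem_head _ _)).
exists (K `&` (KW x).1), (W `&` (KW x).2); split; first exact: gap_subgroupI.
by move=> y; rewrite inE => /predU1P[->|/Ks Ky] z [Kz Kxz] //; exact: Ky.
Qed.

End Gap.

(** * Trapping small subgroups *)

Section LimitGroup.
Variables (L : lcGroupType) (I : Type) (F : set_system I).
Hypothesis UF : UltraFilter F.
Variable Q : I -> set L.
Hypotheses (Q1 : F [set i | Q i 1%g]) (symQ : F [set i | symmetric (Q i)]).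
Implicit Types (n : I -> nat) (C U : set L).

Definition limit_group n : set L := [set e | exists (D : nat) (x : I -> L),
  F [set i | (Q i `^^ (D * n i)) (x i)] /\ x @ F --> e].

Lemma subgrp_limit_group n : subgrp (limit_group n).
Proof.
split.
  by exists 0%N, (fun=> 1%g); split; [exact: filterE|exact: cvg_cst].
split=> [a b [D [x [Fx xa]]] [D' [y [Fy yb]]]|a [D [x [Fx xa]]]].
  exists (D + D')%N, (fun i => x i ∙ y i); split; last exact: cvg_mulg.
  by apply: filterS2 Fx Fy => i Qx Qy /=; rewrite mulnDl; exact: setexpgD.
exists D, (fun i => (x i)⁻¹); split; last exact: cvg_invg.
by apply: filterS2 Fx symQ => i Qx sQ /=; exact: setexpgV.
Qed.

Lemma limit_group_sub n C : closed C -> (forall D, F [set i | Q i `^^ (D * n i) `<=` C]) ->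
  limit_group n `<=` C.
Proof.
move=> clC FC e [D [x [Fx xe]]]; apply: closed_cvg xe; first exact: clC.
by apply: filterS2 Fx (FC D) => i Qx QC; exact: QC.
Qed.

Lemma limit_group_mono n n' D : F [set i | (n i <= D * n' i)%N] ->
  limit_group n `<=` limit_group n'.
Proof.
move=> Fle e [D' [x [Fx xe]]]; exists (D' * D)%N, x; split=> //.
apply: filterS3 Fx Fle Q1 => i Qx le Qi1 /=; apply: setexpg_le Qx => //.
by rewrite -mulnA leq_mul2l le orbT.
Qed.

Lemma limit_group_escape n C U : compact C -> (forall D, F [set i | Q i `^^ (D * n i) `<=` C]) ->
  F [set i | (0 < n i)%N] -> F [set i | ~ Q i `^^ (n i).+1 `<=` U] ->
  exists2 p, limit_group n p & ~ nbhs p U.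
Proof.
move=> cC FC n_gt0 nU.
have /choice[x xP] i : exists x : L, ~ Q i `^^ (n i).+1 `<=` U ->
    (Q i `^^ (n i).+1) x /\ ~ U x.
  have [QU|nQU] := pselect (Q i `^^ (n i).+1 `<=` U); first by exists 1%g.
  by move/existsNP: nQU => [x /not_implyP[Qx nUx]]; exists x.
have F2 : F [set i | (Q i `^^ (2 * n i)) (x i)].
  apply: filterS3 Q1 n_gt0 nU => i Qi1 ni0 /xP[Qx _]; apply: setexpg_le Qx => //.
  by move: ni0; rewrite /=; lia.
have [|p Cp xp] := ultra_compact_cvg (x := x) UF cC.
  by apply: filterS2 F2 (FC 2%N) => i Qx QC; exact: QC.
exists p; first by exists 2%N, x.
by apply: (cvg_not_nbhs _ _ xp); apply: filterS nU => i /xP[].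
Qed.

End LimitGroup.

Section ExitTime.
Variable G : groupType.
Implicit Types (Q U : set G).

Definition exit_time Q U : nat := xget 0%N [set n | Q `^^ n `<=` U /\ ~ Q `^^ n.+1 `<=` U].

Lemma exit_timeP Q U m : Q 1%g -> Q `<=` U -> ~ Q `^^ m `<=` U ->
  [/\ (0 < exit_time Q U)%N, (exit_time Q U < m)%N, Q `^^ exit_time Q U `<=` U &
      ~ Q `^^ (exit_time Q U).+1 `<=` U].
Proof.
move=> Q1 QU nQU; have [k [_ kU nkU]] := setexpg_exit (QU _ Q1) nQU.
have [nU nSU] : [set n | Q `^^ n `<=` U /\ ~ Q `^^ n.+1 `<=` U] (exit_time Q U).
  exact: (xgetPex 0%N (ex_intro _ k (conj kU nkU))).
split=> //.
  by case: (exit_time Q U) nSU => // nQ1; case: nQ1; rewrite setexpg1.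
rewrite ltnNge; apply/negP => le; apply: nQU; apply: subset_trans nU.
exact: setexpg_le.
Qed.

End ExitTime.

Section SupportWalk.
Variables (R : realDomainType) (G : groupType) (phi : G -> R).
Local Open Scope ring_scope.

Lemma setexpg_sub_support (Q A : set G) (c d : R) (t : nat) :
  (forall x, phi x != 0 -> A x) -> c <= phi 1%g -> 0 <= d -> t%:R * d < c ->
  (forall q x, Q q -> A x -> `|phi (q ∙ x) - phi x| <= d) -> Q `^^ t `<=` A.
Proof.
move=> suppA c1 d0 tdc walk.
suff bound k y : (k <= t)%N -> (Q `^^ k) y -> A y /\ c - k%:R * d <= phi y.
  by move=> y Qy; have [] := bound t y (leqnn t) Qy.
have pos k' y' : (k' <= t)%N -> c - k'%:R * d <= phi y' -> A y'.
  move=> k't le; apply: suppA; rewrite gt_eqF //; apply: lt_le_trans le.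
  by rewrite subr_gt0; apply: le_lt_trans tdc; rewrite ler_wpM2r ?ler_nat.
elim: k y => [|k IHk] y kt.
  move=> ->; have c1' : c - 0%:R * d <= phi 1%g by rewrite mul0r subr0.
  by split=> //; exact: pos c1'.
move=> [q Qq [x Qx <-]]; have [Ax px] := IHk x (ltnW kt) Qx.
have le : c - k.+1%:R * d <= phi (q ∙ x).
  by have /ler_normlP[] := walk q x Qq Ax; rewrite -natr1 mulrDl mul1r; lra.
by split=> //; exact: pos le.
Qed.

Lemma telescope_second_difference (c : R) (a x : G) k :
  (forall s, (s < k)%N -> `|(phi (a⁻¹ ∙ ((a ^^ s)⁻¹ ∙ x)) - phi ((a ^^ s)⁻¹ ∙ x)) -
     (phi (a⁻¹ ∙ x) - phi x)| <= c) ->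
  `|phi ((a ^^ k)⁻¹ ∙ x) - phi x - k%:R * (phi (a⁻¹ ∙ x) - phi x)| <= k%:R * c.
Proof.
elim: k => [|k IHk] hc; first by rewrite invg1 mul1g subrr !mul0r subr0 normr0.
have -> : (a ^^ k.+1)⁻¹ ∙ x = a⁻¹ ∙ ((a ^^ k)⁻¹ ∙ x) by rewrite expgSr invgM mulgA.
rewrite -natr1 !mulrDl !mul1r.
have := lerD (IHk (fun s sk => hc s (ltnW sk))) (hc k (ltnSn k)).
by apply: le_trans; apply: le_trans (ler_normD _ _); rewrite le_eqVlt; apply/orP; left;
  apply/eqP; congr (`|_|); ring.
Qed.

End SupportWalk.

Section Trapped.
Variables (R : realType) (L : lcGroupType).
Local Open Scope ring_scope.

Lemma gleason_telescope (U Q : set L) (W : R -> set L) (m n k : nat) (m0 M e : R)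
    (phi : L -> R) (a x : L) :
  gleason_function U m m0 M W Q n phi -> 0 < e -> Q a ->
  (forall s, (s < k)%N -> W e (a ^^ s)) -> (U `^^ m) x ->
  `|phi ((a ^^ k)⁻¹ ∙ x) - phi x - k%:R * (phi (a⁻¹ ∙ x) - phi x)| <= k%:R * (M * e / n%:R).
Proof.
move=> gphi e0 Qa Wa Ux; apply: telescope_second_difference => s sk.
by apply: (gleason_second_difference gphi) => //; exact: Wa.
Qed.

(* If [Q] stays in [U] for time [n] and the powers of its elements stay in the small
   neighbourhood [W] for the much longer time [j * n], then a Gleason function varies by much
   less than [1 / n] along [Q]: its support [U ^ 4] is not left before time [D * n]. *)
Lemma setexpg_trapped (U K : set L) (D : nat) : normal_neighbourhood U K ->
  exists (j : nat) (W : set L), set_nbhs K W /\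
    forall Q n, Q 1%g -> symmetric Q -> (0 < n)%N -> Q `^^ n `<=` U ->
      (forall q s, Q q -> (s <= j * n)%N -> W (q ^^ s)) -> Q `^^ (D * n) `<=` U `^^ 4.
Proof.
move=> nUK; have [m0 [M [W [m00 M0 W_nbhs gleason]]]] := exists_gleason_functions R 4 nUK.
pose d := m0 / (2 * D.+1%:R); have d0 : 0 < d by rewrite divr_gt0 // mulr_gt0.
pose e := d / (2 * M); have e0 : 0 < e by rewrite divr_gt0 // mulr_gt0.
have Me : M * e = d / 2 by rewrite /e; field; rewrite gt_eqF.
have B0 : 0 <= 4 * M / d by rewrite divr_ge0 ?mulr_ge0 ?(ltW M0) // ltW.
pose j := (Num.bound (4 * M / d)).+1.
have jd : 4 * M <= j%:R * d.
  by rewrite -ler_pdivrMr // (le_trans (ltW (archi_boundP B0))) // ler_nat.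
exists j, (W e); split=> [|Q n Q1 symQ n_gt0 QU QW]; first exact: W_nbhs.
have [phi gphi] := gleason Q n Q1 symQ n_gt0 QU.
have n0 : 0 < n%:R :> R by rewrite ltr0n.
apply: (@setexpg_sub_support R L phi Q (U `^^ 4) m0 (d / n%:R)).
- exact: gleason_supp gphi.
- exact: gleason_ge gphi.
- by rewrite divr_ge0 // ltW.
- rewrite natrM (_ : D%:R * n%:R * (d / n%:R) = D%:R * d); last by field; rewrite gt_eqF.
  have : D%:R * d <= D.+1%:R * d by rewrite ler_wpM2r ?ler_nat // ltW.
  by rewrite (_ : D.+1%:R * d = m0 / 2); [lra|rewrite /d; field; rewrite gt_eqF].
move=> q x Qq Ux; pose k := (j * n)%N.
have k0 : 0 < k%:R :> R by rewrite ltr0n muln_gt0.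
have := gleason_telescope gphi e0 (symQ _ Qq) (k := k) _ Ux.
rewrite invgK => /(_ (fun s sk => QW _ s (symQ _ Qq) (ltnW sk))).
set delta := phi (q ∙ x) - phi x => tel.
rewrite -(ler_pM2l k0) -[k%:R in leLHS]ger0_norm // -normrM.
have kd : k%:R * (d / n%:R) = j%:R * d by rewrite /k natrM; field; rewrite gt_eqF.
have kMe : k%:R * (M * e / n%:R) = j%:R * d / 2.
  by rewrite Me /k natrM; field; rewrite gt_eqF.
move: tel; rewrite kd kMe; set A := phi (_ ∙ x) => tel.
have [bA bx] := (gleason_norm_le gphi ((q⁻¹ ^^ k)⁻¹ ∙ x), gleason_norm_le gphi x).
rewrite (_ : k%:R * delta = A - phi x - (A - phi x - k%:R * delta)); last by lra.
apply: le_trans (ler_normB _ _) _; apply: le_trans (lerD (ler_normB _ _) tel) _.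
by move: bA bx; rewrite -/A; lra.
Qed.

End Trapped.

Section CyclicIn.
Variable L : lcGroupType.
Implicit Types (A C D H K U V : set L).

Definition cyclic_in V : set L := [set x | cyclic x `<=` V].

Lemma cyclic_in_mem1 V : V 1%g -> cyclic_in V 1%g.
Proof. by move=> V1 _ [k _ <-]; rewrite zpow_one. Qed.

Lemma cyclic_inX V x n : cyclic_in V x -> V (x ^^ n).
Proof. by apply; exact: cyclicX. Qed.

Lemma cyclic_in_sub V : cyclic_in V `<=` V.
Proof. by move=> x; apply; exact: cyclic_id. Qed.

Lemma symmetric_cyclic_in V : symmetric (cyclic_in V).
Proof.
move=> x xV y xy; apply: xV; apply: cyclic_sub xy; first exact: subgrp_cyclic.
by apply: subgrpV; [exact: subgrp_cyclic|exact: cyclic_id].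
Qed.

Lemma subgrp_sub_cyclic_in V D : subgrp D -> D `<=` V -> D `<=` cyclic_in V.
Proof. by move=> sD DV x Dx y /(cyclic_sub sD Dx) /DV. Qed.

Lemma normal_neighbourhood_set1 U :
  compact U -> symmetric U -> nbhs 1%g U -> normal_neighbourhood U [set 1%g].
Proof.
move=> cU sU nU; split=> //; [exact: compact_set1|exact: subgrp_set1|by move=> k ->|].
by move=> u k _ ->; rewrite /= conj1g.
Qed.

Lemma exists_isolating_thickening (R : realType) H n V :
  compact H -> subgrp H -> nbhs 1%g V -> exists K U,
    [/\ compact K, subgrp K, set_nbhs K V, [/\ compact U, symmetric U & set_nbhs K U] &
        U `^^ n `<=` V /\ isolating (H `&` U `^^ n) K].
Proof.
move=> cH sH nV; have [K [W [[clK sK KH nW isoK] KV]]] :=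
  exists_gap_subgroup cH sH R (nbhs_interior nV).
have cK : compact K by exact: subclosed_compact cH KH.
have nO : set_nbhs K (V `&` W `∙` K).
  by move=> k Kk; apply: filterI; [exact: KV|exact: set_nbhs_setmulg].
have [U [cU sU KU _ UO]] := compact_thickening cK sK n nO.
exists K, U; split=> //; split; first by move=> y /UO[].
by move=> D sD DHU; apply: isoK => // y /DHU[Hy /UO[]].
Qed.

End CyclicIn.

Section Trapping.
Variables (R : realType) (L : lcGroupType) (F : set_system (set L)).
Hypotheses (UF : UltraFilter F)
  (F_small : forall V, nbhs 1%g V -> F [set W | nbhs 1%g W /\ W `<=` V]).
Implicit Types (C U V : set L) (n : set L -> nat).

Let F_mem1 : F [set V | cyclic_in V 1%g].
Proof.
by apply: filterS (F_small filterT) => V [nV _]; apply: cyclic_in_mem1; exact: nbhs_singleton.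
Qed.

Let F_symmetric : F [set V | symmetric (cyclic_in V)].
Proof. by apply: filterE => V; exact: symmetric_cyclic_in. Qed.

Lemma cyclic_in_trapped U n : compact U -> symmetric U -> nbhs 1%g U ->
  F [set V | (0 < n V)%N] -> F [set V | cyclic_in V `^^ n V `<=` U] ->
  forall D, F [set V | cyclic_in V `^^ (D * n V) `<=` U `^^ 4].
Proof.
move=> cU sU nU n_gt0 nQU D.
have [j [W [nW trap]]] := setexpg_trapped R D (normal_neighbourhood_set1 cU sU nU).
have V_W : F [set V | cyclic_in V 1%g /\ V `<=` W].
  by apply: filterS2 F_mem1 (F_small (nW 1%g erefl)) => V ? [].
apply: filterS3 n_gt0 nQU V_W => V nV0 QU [Q1 VW]; apply: trap => // [|q s Qq _].
  exact: symmetric_cyclic_in.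
by apply: VW; exact: cyclic_inX.
Qed.

Let exit U V := exit_time (cyclic_in V) U.

Lemma cyclic_in_exit U : compact U -> symmetric U -> nbhs 1%g U ->
  F [set V | exists m, ~ cyclic_in V `^^ m `<=` U] ->
  [/\ F [set V | forall m, ~ cyclic_in V `^^ m `<=` U -> (exit U V < m)%N],
      limit_group F (@cyclic_in L) (exit U) `<=` U `^^ 4 &
      exists2 p, limit_group F (@cyclic_in L) (exit U) p & ~ nbhs p U].
Proof.
move=> cU sU nU escU.
have exitP : F [set V | forall m, ~ cyclic_in V `^^ m `<=` U ->
    [/\ (0 < exit U V)%N, (exit U V < m)%N, cyclic_in V `^^ exit U V `<=` U &
        ~ cyclic_in V `^^ (exit U V).+1 `<=` U]].
  apply: filterS2 F_mem1 (F_small nU) => V Q1 [_ VU] m; apply: exit_timeP => //.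
  exact: subset_trans (@cyclic_in_sub L V) VU.
have exit_at (P : set (set L)) : (forall V, [/\ (0 < exit U V)%N,
      cyclic_in V `^^ exit U V `<=` U & ~ cyclic_in V `^^ (exit U V).+1 `<=` U] -> P V) -> F P.
  by move=> PV; apply: filterS2 exitP escU => V exV [m /exV[? _ ? ?]]; exact: PV.
have [exit_gt0 exit_sub] : F [set V | (0 < exit U V)%N] /\
    F [set V | cyclic_in V `^^ exit U V `<=` U].
  by split; apply: exit_at => V [].
have trapU := cyclic_in_trapped cU sU nU exit_gt0 exit_sub.
have cU4 := compact_setexpg (n := 4) cU.
split.
- by apply: filterS exitP => V exV m /exV[].
- by apply: limit_group_sub => //; exact: compact_closedg.
- by apply: limit_group_escape cU4 trapU _ _ => //; apply: exit_at => V [].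
Qed.

(* Suppose the subgroups generated by [cyclic_in V] leave [C].  Their limit group at the scale
   of the exit time from [C] has compact closure [H], and a neighbourhood [U] of a small
   subgroup [K] contains no larger subgroup of [H].  If [U] is left at a comparable time, then
   the limit group at the scale of the exit time from [U] lies in [H] and in [U ^ 4], hence in
   [K], although it leaves [U]; otherwise [H] itself lies in [U], hence in [K] and in [C]. *)
Lemma cyclic_in_not_escaping C : compact C -> symmetric C -> nbhs 1%g C ->
  ~ F [set V | exists m, ~ cyclic_in V `^^ m `<=` C].
Proof.
move=> cC sC nC escC; have [_ EC [p Ep np]] := cyclic_in_exit cC sC nC escC.
set E := limit_group _ _ _ in EC Ep.
have sE : subgrp E by exact: (subgrp_limit_group UF F_symmetric).
have cH := compact_closure_sub (compact_setexpg (n := 4) cC) EC.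
have sH := closure_subgrp sE.
have EH : E `<=` closure E by exact: subset_closure.
have [K [U [cK sK KC [cU sU KU] [_ isoK]]]] := exists_isolating_thickening R 4 cH sH nC.
have nU : nbhs 1%g U by apply: KU; exact: subgrp1.
have [[D FD]|noD] := pselect (exists D, F [set V | ~ cyclic_in V `^^ (D * exit C V) `<=` U]).
  have [|lt_exit E'U [q E'q nq]] := cyclic_in_exit cU sU nU.
    by apply: filterS FD => V nVU; exists (D * exit C V)%N.
  have E'E : limit_group F (@cyclic_in L) (exit U) `<=` E.
    apply: (@limit_group_mono _ _ _ UF _ F_mem1 _ _ D).
    by apply: filterS2 lt_exit FD => V lt_m nVU; apply: ltnW; exact: lt_m.
  apply: nq; apply: KU; apply: isoK E'q; first exact: subgrp_limit_group.
  by move=> y E'y; split; [apply: EH; exact: E'E|exact: E'U].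
have EU : E `<=` U.
  apply: limit_group_sub => [|D]; first exact: compact_closedg.
  have [//|nVU] := in_ultra_setVsetC [set V | cyclic_in V `^^ (D * exit C V) `<=` U] UF.
  by case: noD; exists D.
apply: np; apply: KC; apply: (isoK E) => // y Ey; split; first exact: EH.
by apply: setexpg_ge1 (EU _ Ey) => //; exact: nbhs_singleton.
Qed.

End Trapping.

Section IsolatedPairs.
Variables (R : realType) (L : lcGroupType).
Implicit Types (U V K : set L).

Lemma trapping U : nbhs 1%g U ->
  exists2 V, nbhs 1%g V & forall n, cyclic_in V `^^ n `<=` U.
Proof.
move=> nU; apply: contrapT => nV; have [C [cC nC sC CU]] := nbhs_compact_symmetric nU.
have [F [UF F_small]] := nbhs_ultrafilter (1%g : L).
case: (cyclic_in_not_escaping R UF F_small cC sC nC); apply: filterS (F_small _ nC) => V [nbV _].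
apply: contrapT => nesc; apply: nV; exists V => // n; apply: subset_trans CU.
by apply: contrapT => nVC; apply: nesc; exists n.
Qed.

Lemma exists_isolated_subgroup : exists U K : set L,
  [/\ compact K, subgrp K, set_nbhs K U & isolating U K].
Proof.
have [C [cC nC sC _]] := nbhs_compact_symmetric (@filterT _ (nbhs (1%g : L)) _).
have [V nV VC] := trapping nC; pose E := \bigcup_n cyclic_in V `^^ n.
have V1 := nbhs_singleton nV.
have sE : subgrp E.
  by apply: subgrp_bigcup_setexpg; [exact: cyclic_in_mem1|exact: symmetric_cyclic_in].
have cH : compact (closure E) by apply: compact_closure_sub cC _ => x [n _]; exact: VC.
have [K [U [cK sK _ [_ _ KU] []]]] :=
  exists_isolating_thickening R 1 cH (closure_subgrp sE) nV.
rewrite setexpg1 => UV isoK; exists U, K; split=> // D sD DU; apply: isoK => // x Dx.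
split; last exact: DU; apply: subset_closure; exists 1%N => //; rewrite setexpg1.
by apply: subgrp_sub_cyclic_in Dx => //; exact: subset_trans UV.
Qed.

Record isolated_pair U K : Prop := IsolatedPair {
  isolated_nn : normal_neighbourhood U K;
  isolated_absorb : K `∙` U `∙` K `<=` U;
  isolated_isolating : isolating (U `^^ 4) K }.

Lemma exists_isolated_pair : exists U K, isolated_pair U K.
Proof.
have [U0 [K [cK sK KU0 isoK]]] := exists_isolated_subgroup.
have [||W nW WK] := @nbhs_prod_compact L L L (fun p => p.2 ^ p.1)%g K U0 _ cK.
- by continuity.
- by move=> k Kk; rewrite /= conjg1; exact: KU0.
have normW : normalised W K.
  move=> w k Ww Kk; apply: (isoK [set k ^ w | k in K]%g); last by exists k.
    by apply: subgrp_image sK => x y; exact: conjMg.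
  by move=> _ [l Kl <-]; exact: WK.
have nO : set_nbhs K (U0 `&` W `∙` K).
  by move=> k Kk; apply: filterI; [exact: KU0|exact: set_nbhs_setmulg].
have [U [cU sU KU KUK UO]] := compact_thickening cK sK 4 nO.
have U1 : U 1%g by apply: nbhs_singleton; apply: KU; exact: subgrp1.
exists U, K; split=> //; last by move=> D sD DU; apply: isoK => // y /DU /UO[].
split=> // u k Uu Kk; have [_ [w Ww [l Kl <-]]] := UO u (setexpg_ge1 (n := 4) U1 isT Uu).
by rewrite conjgM; apply: subgrpJ => //; exact: normW.
Qed.

End IsolatedPairs.

(** * Slow elements and one-parameter flows *)

Lemma ler_inv_divn (R : realFieldType) (n d : nat) : (0 < d)%N -> (d <= n)%N ->
  ((n %/ d)%:R^-1 <= 2 * d%:R / n%:R :> R)%R.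
Proof.
move=> d_gt0 dn; have q_gt0 : (0 < n %/ d)%N by rewrite divn_gt0.
have [q0 n0] : (0 < (n %/ d)%:R :> R)%R /\ (0 < n%:R :> R)%R.
  by rewrite !ltr0n q_gt0 (leq_trans d_gt0 dn).
rewrite ler_pdivlMr // mulrC ler_pdivrMr // -!natrM ler_nat.
by have := ltn_ceil n d_gt0; nia.
Qed.

Lemma truncnD_carry (R : realType) (a b : R) : (0 <= a)%R -> (0 <= b)%R ->
  exists2 e, (e <= 1)%N & Num.truncn (a + b)%R = (Num.truncn a + Num.truncn b + e)%N.
Proof.
move=> a0 b0; exists (Num.truncn (a + b)%R - (Num.truncn a + Num.truncn b))%N.
  have /andP[_ a2] := truncn_itv a0; have /andP[_ b2] := truncn_itv b0.
  have /andP[c1 _] := truncn_itv (addr_ge0 a0 b0).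
  have : (Num.truncn (a + b)%R < Num.truncn a + Num.truncn b + 2)%N.
    by rewrite -(ltr_nat R) !natrD; rewrite -!natr1 in a2 b2; lra.
  by lia.
rewrite subnKC // -(ltnS (_ + _)) -(ltr_nat R) natrD.
have /andP[a1 _] := truncn_itv a0; have /andP[b1 _] := truncn_itv b0.
by have /andP[_ c2] := truncn_itv (addr_ge0 a0 b0); lra.
Qed.

Section OneParameter.
Variables (R : realFieldType) (G : groupType).

Definition one_parameter (u : R -> G) :=
  forall s t : R, (0 <= s)%R -> (0 <= t)%R -> u (s + t)%R = u s ∙ u t.

Variable u : R -> G.
Hypothesis uD : one_parameter u.

Lemma one_parameter0 : u 0%R = 1%g.
Proof.
have := uD (lexx 0%R) (lexx 0%R); rewrite addr0 => u0.
by apply: (@mulgI _ (u 0%R)); rewrite -u0 mulg1.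
Qed.

Lemma one_parameterX n t : (0 <= t)%R -> u (n%:R * t)%R = u t ^^ n.
Proof.
move=> t0; elim: n => [|n IHn]; first by rewrite mul0r one_parameter0.
by rewrite -natr1 mulrDl mul1r uD ?mulr_ge0 // IHn expgSr.
Qed.

End OneParameter.

Section SlowElements.
Variables (G : groupType) (U : set G).
Implicit Types (m n s : nat) (x : G).

Definition slow n : set G := [set x | forall i, (i <= n)%N -> U (x ^^ i)].

Lemma slow_mem1 n : U 1%g -> slow n 1%g.
Proof. by move=> U1 i _; rewrite expg1n. Qed.

Lemma symmetric_slow n : symmetric U -> symmetric (slow n).
Proof. by move=> symU x sx i le; rewrite expVgn; apply: symU; exact: sx. Qed.

Lemma slow_le m n : (m <= n)%N -> slow n `<=` slow m.
Proof. by move=> mn x sx i im; apply: sx; exact: leq_trans mn. Qed.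

Lemma slow_sub n : (0 < n)%N -> slow n `<=` U.
Proof. by move=> n_gt0 x /(_ 1%N n_gt0); rewrite expg1. Qed.

Lemma slowX x m n s : slow m x -> (s * n <= m)%N -> slow n (x ^^ s).
Proof.
move=> sx le i im; rewrite -expgnA; apply: sx; apply: leq_trans le.
by rewrite leq_mul2l im orbT.
Qed.

End SlowElements.

Section IsolatedPair.
Variables (R : realType) (L : lcGroupType) (U K : set L).
Hypothesis iUK : isolated_pair U K.
Implicit Types (k x y : L) (n m : nat) (W : set L).

Let nUK : normal_neighbourhood U K := isolated_nn iUK.
Let cU : compact U := nn_compact nUK.
Let symU : symmetric U := nn_symmetric nUK.
Let cK : compact K := nn_compact_subgrp nUK.
Let sK : subgrp K := nn_subgrp nUK.
Let KU : set_nbhs K U := nn_set_nbhs nUK.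
Let UK : normalised U K := nn_normalised nUK.
Let U1 : U 1%g := nn_mem1 nUK.
Let isoK : isolating (U `^^ 4) K := isolated_isolating iUK.
Let cU4 : compact (U `^^ 4) := compact_setexpg (n := 4) cU.
Let U4 : U `<=` U `^^ 4 := setexpg_ge1 (n := 4) U1 isT.

Lemma absorb_mulr x k : U x -> K k -> U (x ∙ k).
Proof.
move=> Ux Kk; rewrite -(mul1g x); apply: (isolated_absorb iUK).
by apply: mem_setmulg => //; apply: mem_setmulg => //; exact: subgrp1.
Qed.

Lemma closed_slow n : closed (slow U n).
Proof.
move=> x cx i le; apply: (closed_expg_in (compact_closedg cU)).
by apply: closureS cx => y; apply.
Qed.

Lemma nbhs_slow n : nbhs 1%g (slow U n).
Proof.
elim: n => [|n IHn].
  by apply: filterE => x i; rewrite leqn0 => /eqP ->.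
have : nbhs 1%g [set x : L | U (x ^^ n.+1)].
  apply: (@preimage_nbhs _ _ (fun x : L => x ^^ n.+1)); first by continuity.
  by rewrite expg1n; apply: KU; exact: subgrp1.
apply: filterS2 IHn => x sx Ux i; rewrite leq_eqVlt => /predU1P[->//|].
by rewrite ltnS; exact: sx.
Qed.

Lemma slowMr n x k : (0 < n)%N -> slow U n x -> K k -> slow U n (x ∙ k).
Proof.
move=> n_gt0 sx Kk; have Ux := slow_sub n_gt0 sx.
have xkX i : exists2 l, K l & (x ∙ k) ^^ i = x ^^ i ∙ l.
  elim: i => [|i [l Kl IHi]]; first by exists 1%g; [exact: subgrp1|rewrite mulg1].
  exists (l ^ x ∙ k)%g; first by apply: subgrpM => //; exact: UK.
  by rewrite !expgSr IHi; gsimp.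
by move=> i le; have [l Kl ->] := xkX i; apply: absorb_mulr => //; exact: sx.
Qed.

Let setexpg4_forever x : (forall i, (U `^^ 4) (x ^^ i)) -> K x.
Proof.
move=> Ux; apply: (isoK (subgrp_cyclic x)); last exact: cyclic_id.
move=> _ [j _ <-]; case: j => i; first by rewrite zpow_nat; exact: Ux.
by rewrite NegzE zpowN zpow_nat; apply: setexpgV => //; exact: Ux.
Qed.

Lemma slow_forever x : (forall n, slow U n x) -> K x.
Proof. by move=> sx; apply: setexpg4_forever => i; apply: U4; exact: (sx i i). Qed.

Lemma slow_sub_nbhs W : set_nbhs K W -> exists2 n, (0 < n)%N & slow U n `<=` W.
Proof.
move=> KW; have [||m n mn|x sx|n nW] := @compact_decreasing_sub L (fun n => slow U n.+1) U W cU.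
- by move=> n; exact: closed_slow.
- by move=> n; exact: slow_sub.
- exact: slow_le.
- by apply: KW; apply: slow_forever => n; apply: (slow_le (leqnSn n)); exact: sx.
by exists n.+1.
Qed.

Lemma slow_of_setexpg4 : exists2 j, (0 < j)%N & forall n x,
  (forall i, (i <= j * n)%N -> (U `^^ 4) (x ^^ i)) -> slow U n x.
Proof.
pose Q n := slow (U `^^ 4) n.+1.
have [n x cx i le|n x Qx|m n mn|x Qx|n nU] := @compact_decreasing_sub L Q (U `^^ 4) U cU4.
- apply: (closed_expg_in (compact_closedg cU4)).
  by apply: closureS cx => y; apply.
- exact: slow_sub Qx.
- exact: slow_le.
- by apply: KU; apply: setexpg4_forever => i; exact: (Qx i i (leqnSn i)).
exists n.+1 => // m x Ux i im; apply: nU => s sn; rewrite -expgnA; apply: Ux.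
by rewrite mulnC leq_mul.
Qed.

(* Otherwise, with [Q D = slow (D * n D)], products of elements of [Q D] leave [U] at a time
   below [n D], and by [setexpg_trapped] their limits at that time scale form a subgroup of
   [U ^ 4] which is not contained in [K]. *)
Lemma setexpg_slow_sub : exists2 D, (0 < D)%N & forall n, (0 < n)%N ->
  slow U (D * n) `^^ n `<=` U.
Proof.
apply: contrapT => no.
have /choice[n nP] (D : nat) : exists n, (0 < n)%N /\ ~ slow U (D.+1 * n) `^^ n `<=` U.
  apply: contrapT => no_n; apply: no; exists D.+1 => // n n_gt0.
  by apply: contrapT => nQ; apply: no_n; exists n.
have [F [UF Fge]] := nat_ultrafilter.
pose Q D := slow U (D.+1 * n D); pose m D := exit_time (Q D) U.
have mP D : [/\ (0 < m D)%N, (m D < n D)%N, Q D `^^ m D `<=` U & ~ Q D `^^ (m D).+1 `<=` U].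
  apply: exit_timeP; [exact: slow_mem1| |exact: (nP D).2].
  by apply: slow_sub; rewrite muln_gt0 (nP D).1.
have Q1 : F [set D | Q D 1%g] by apply: filterE => D; exact: slow_mem1.
have symQ : F [set D | symmetric (Q D)] by apply: filterE => D; exact: symmetric_slow.
have m_gt0 : F [set D | (0 < m D)%N] by apply: filterE => D; have [] := mP D.
have exitQ : F [set D | ~ Q D `^^ (m D).+1 `<=` U] by apply: filterE => D; have [] := mP D.
have trapQ D' : F [set D | Q D `^^ (D' * m D) `<=` U `^^ 4].
  have [j [W [nW trap]]] := setexpg_trapped R D' nUK.
  have [N N_gt0 NW] := slow_sub_nbhs nW.
  apply: filterS (Fge (j * N)%N) => D /= jN; have [mD0 lt_mn QU _] := mP D.
  apply: trap QU _ => // [||q s Qq sj]; [exact: slow_mem1|exact: symmetric_slow|].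
  apply: NW; apply: slowX Qq _; apply: (@leq_trans (j * m D * N)).
    by rewrite leq_mul2r sj orbT.
  by rewrite mulnAC leq_mul // ?(ltnW lt_mn) // (leq_trans jN).
have [p Ep np] := limit_group_escape UF Q1 cU4 trapQ m_gt0 exitQ.
apply: np; apply: KU; apply: (isoK (subgrp_limit_group UF symQ m)) Ep.
by apply: limit_group_sub => //; exact: compact_closedg.
Qed.

Lemma slowM : exists2 D, (0 < D)%N & forall n x y, (0 < n)%N ->
  slow U (D * n) x -> slow U (D * n) y -> slow U n (x ∙ y).
Proof.
have [D D_gt0 slowD] := setexpg_slow_sub; exists (D * 2)%N; first by rewrite muln_gt0 D_gt0.
move=> n x y n_gt0; rewrite -mulnA => sx sy s le.
have sxy : (slow U (D * (2 * n)) `^^ (2 * s)) ((x ∙ y) ^^ s).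
  elim: s {le} => [|s IHs]; first by rewrite muln0.
  rewrite expgS mulnS; apply: (@setexpgD _ _ 2) => //.
  by apply: mem_setmulg => //; rewrite setmulg1.
apply: (slowD (2 * n)%N); first by rewrite muln_gt0.
by apply: setexpg_le sxy; [exact: slow_mem1|rewrite leq_mul2l le orbT].
Qed.

Lemma exists_slow_gleason_functions m : exists (N : nat) (m0 M : R) (W : R -> set L),
  [/\ (0 < m0)%R, (0 < M)%R, (forall e, (0 < e)%R -> set_nbhs K (W e)) &
    forall n, (N <= n)%N -> exists phi, gleason_function U m m0 M W (slow U n) n phi].
Proof.
have [D D_gt0 slowD] := setexpg_slow_sub.
have [m0 [M [W [m00 M0 nW gleason]]]] := exists_gleason_functions R m nUK.
have D1 : (1 <= D%:R :> R)%R by rewrite ler1n.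
have M_le : (M <= 2 * D%:R * M)%R by rewrite ler_peMl ?ltW //; lra.
exists D, m0, (2 * D%:R * M)%R, W; split=> // [|n Dn]; first exact: lt_le_trans M_le.
pose q := (n %/ D)%N; have q_gt0 : (0 < q)%N by rewrite divn_gt0.
have [phi [ge supp norm_le near second]] :=
  gleason _ q (slow_mem1 U1) (symmetric_slow symU) q_gt0 (slowD q q_gt0).
exists phi; split=> // [x|e b x e0 Wb|e a b x e0 sa Wb Ux].
- exact: le_trans (norm_le x) M_le.
- by apply: le_trans (near e b x e0 Wb) _; rewrite ler_wpM2r // ltW.
have Qa : slow U (D * q) a by apply: slow_le sa; rewrite mulnC leq_divM.
apply: le_trans (second e a b x e0 Qa Wb Ux) _.
rewrite (_ : (2 * D%:R * M * e / n%:R = M * e * (2 * D%:R / n%:R))%R); last by ring.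
by apply: ler_wpM2l; [rewrite mulr_ge0 // ltW|exact: ler_inv_divn].
Qed.

Section Quotients.
Variables (m0 M : R) (W : R -> set L) (Q : set L) (m : nat) (phi : L -> R).
Local Open Scope ring_scope.
Hypothesis gphi : gleason_function U 5 m0 M W Q m phi.

(* Along both [y] and [y'] the function [phi] is nearly linear for [n] steps, and it ends up
   at nearby values. *)
Lemma gleason_quotient (e e' : R) (n : nat) y y' x : (0 < n)%N -> 0 < e -> 0 < e' ->
  Q y -> Q y' -> (forall s, (s < n)%N -> W e (y ^^ s) /\ W e (y' ^^ s)) ->
  W e' ((y ^^ n)⁻¹ ∙ y' ^^ n) -> U y' -> (U `^^ 4) x ->
  `|phi ((y'⁻¹ ∙ y)⁻¹ ∙ x) - phi x| <= M * e' / n%:R + 2 * (M * e / m%:R).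
Proof.
move=> n_gt0 e0 e'0 Qy Qy' We We' Uy' Ux; pose z := y' ∙ x.
have Uz : (U `^^ 5) z by exact: mem_setmulg.
have n0 : 0 < n%:R :> R by rewrite ltr0n.
have tel a : Q a -> (forall s, (s < n)%N -> W e (a ^^ s)) ->
    `|phi ((a ^^ n)⁻¹ ∙ z) - phi z - n%:R * (phi (a⁻¹ ∙ z) - phi z)| <= n%:R * (M * e / m%:R).
  by move=> Qa Wa; exact: gleason_telescope gphi e0 Qa Wa Uz.
have tel_y := tel y Qy (fun s sn => (We s sn).1).
have tel_y' := tel y' Qy' (fun s sn => (We s sn).2).
have := gleason_near gphi ((y' ^^ n)⁻¹ ∙ z) e'0 We'; rewrite mulgA mulgK => near.
have -> : phi ((y'⁻¹ ∙ y)⁻¹ ∙ x) - phi x = (phi (y⁻¹ ∙ z) - phi z) - (phi (y'⁻¹ ∙ z) - phi z).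
  by rewrite /z invgM invgK mulKg !mulgA; lra.
rewrite -(ler_pM2l n0) -[n%:R in leLHS]ger0_norm // -normrM mulrBr.
rewrite (_ : n%:R * (M * e' / n%:R + _) = M * e' + 2 * (n%:R * (M * e / m%:R))); last first.
  by rewrite mulrDr [_ * (_ / n%:R)]mulrC divfK ?gt_eqF // mulrCA.
move: tel_y tel_y' near; set A := phi ((y ^^ n)⁻¹ ∙ z); set B := phi ((y' ^^ n)⁻¹ ∙ z).
set d := n%:R * _; set d' := n%:R * (phi (y'⁻¹ ∙ z) - _) => tel_y tel_y' near.
rewrite (_ : d - d' = (A - B) - (A - phi z - d) + (B - phi z - d')); last by lra.
apply: le_trans (ler_normD _ _) _; rewrite mulrDl mul1r addrA.
by apply: lerD => //; apply: le_trans (ler_normB _ _) _; exact: lerD.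
Qed.

End Quotients.

(* The powers of [w = y'^-1 y] move [phi] by at most [delta / n] each, so they stay in its
   support for [j * J * n] steps. *)
Lemma slow_quotient J : (0 < J)%N -> exists (N c : nat) (W : set L),
  [/\ (0 < c)%N, set_nbhs K W & forall n y y', (N <= n)%N -> slow U n y -> slow U n y' ->
      W ((y ^^ (n %/ c))⁻¹ ∙ y' ^^ (n %/ c)) -> slow U (J * n) (y'⁻¹ ∙ y)].
Proof.
move=> J_gt0; have [j j_gt0 jP] := slow_of_setexpg4.
have [N [m0 [M [W [m00 M0 nW gleason]]]]] := exists_slow_gleason_functions 5.
pose delta := (m0 / (2 * (j * J)%:R))%R.
have delta0 : (0 < delta)%R by rewrite divr_gt0 // mulr_gt0 // ltr0n muln_gt0 j_gt0.
pose e := (delta / (4 * M))%R; have e0 : (0 < e)%R by rewrite divr_gt0 // mulr_gt0.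
have [c c_gt0 cW] := slow_sub_nbhs (nW e e0).
have c0 : (0 < c%:R :> R)%R by rewrite ltr0n.
pose e' := (delta / (4 * c%:R * M))%R; have e'0 : (0 < e')%R by rewrite divr_gt0 // !mulr_gt0.
exists (N + c)%N, c, (W e'); split=> // [|n y y' Nn sy sy' Wyy']; first exact: nW.
have cn : (c <= n)%N by apply: leq_trans Nn; exact: leq_addl.
have n_gt0 := leq_trans c_gt0 cn; have n0 : (0 < n%:R :> R)%R by rewrite ltr0n.
pose k := (n %/ c)%N; have k_gt0 : (0 < k)%N by rewrite divn_gt0.
have We z s : slow U n z -> (s < k)%N -> W e (z ^^ s).
  move=> sz sk; apply: cW; apply: slowX sz _; apply: leq_trans (leq_divM n c).
  by rewrite leq_mul2r (ltnW sk) orbT.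
have [|phi gphi] := gleason n; first by apply: leq_trans Nn; exact: leq_addr.
have walk x : (U `^^ 4) x -> (`|phi ((y'⁻¹ ∙ y)⁻¹ ∙ x) - phi x| <= delta / n%:R)%R.
  move=> Ux; have Wk s : (s < k)%N -> W e (y ^^ s) /\ W e (y' ^^ s) by split; exact: We.
  have := gleason_quotient gphi k_gt0 e0 e'0 sy sy' Wk Wyy' (slow_sub n_gt0 sy') Ux.
  move/le_trans; apply.
  have -> : (delta / n%:R = M * e' * (2 * c%:R / n%:R) + 2 * (M * e / n%:R))%R.
    by rewrite /e /e'; field; rewrite !gt_eqF.
  by rewrite lerD2r; apply: ler_wpM2l; [rewrite mulr_ge0 // ltW|exact: ler_inv_divn].
apply: jP => i le_i; rewrite -[_ ^^ i]invgK; apply: setexpgV => //; rewrite -expVgn.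
suff sub : [set (y'⁻¹ ∙ y)⁻¹] `^^ i `<=` U `^^ 4 by apply: sub; exact: setexpgX.
apply: (setexpg_sub_support (gleason_supp gphi) (gleason_ge gphi) (d := (delta / n%:R)%R)).
- by rewrite divr_ge0 // ltW.
- apply: (@le_lt_trans _ _ (((j * J) * n)%:R * (delta / n%:R))%R).
    by rewrite ler_wpM2r ?ler_nat -?mulnA // divr_ge0 // ltW.
  rewrite (_ : ((j * J * n)%:R * (delta / n%:R) = m0 / 2)%R); first by lra.
  by rewrite natrM /delta; field; rewrite !pnatr_eq0 -!lt0n n_gt0 j_gt0 J_gt0.
- by move=> _ x ->; exact: walk.
Qed.

Lemma slow_commutator J : (0 < J)%N -> exists (N : nat) (V : set L), set_nbhs K V /\
  forall n b y, (N <= n)%N -> V b -> slow U n y -> slow U (J * n) [~ b, y]%g.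
Proof.
move=> J_gt0; have [j j_gt0 jP] := slow_of_setexpg4.
have [|N [c [W [c_gt0 nW quot]]]] := @slow_quotient (2 * j * J); first by rewrite !muln_gt0 j_gt0.
have [|[u k] [/= Uu Kk]|W' nW' W'W] := @nbhs_prod_compact L (L * L)%type L
    (fun p => [~ p.2.1, p.1 ∙ p.2.2]%g) (U `*` K) W _ (compact_setX cU cK).
- by rewrite /commg; continuity.
- apply: nW; rewrite mul1g commgEr.
  by apply: subgrpM => //; apply: UK => //; exact: subgrpV.
exists (j * N.+1)%N, (U `&` W' `∙` K); split.
  by move=> k Kk; apply: filterI; [exact: KU|exact: set_nbhs_setmulg].
move=> n b y jNn [Ub [w Ww [k Kk wk]]] sy.
pose n' := (n %/ j)%N.
have Nn' : (N.+1 <= n')%N by rewrite leq_divRL // mulnC.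
have jn'n : (j * n' <= n)%N by rewrite mulnC leq_divM.
have n'n : (n' <= n)%N by exact: leq_div.
rewrite commgEr conjVg; apply: (@slow_le _ _ (J * n)%N (2 * j * J * n')%N).
  rewrite (_ : (2 * j * J * n' = J * (2 * j * n'))%N) ?leq_mul2l; last by lia.
  by have := ltn_ceil n j_gt0; rewrite -/n'; nia.
apply: quot; first exact: ltnW.
- exact: slow_le sy.
- apply: jP => i le_i; rewrite -conjXg conjgE mulgA -[_ ∙ b]mulg1.
  by apply: mem_setexpg4 => //; [exact: symU|apply: sy; exact: leq_trans jn'n].
rewrite -conjXg -commgEl -wk; apply: (W'W w (y ^^ (n' %/ c), k)) => //.
by split=> //; apply: sy; apply: leq_trans (leq_div _ _) n'n.
Qed.

Record flow (X : R -> L) : Prop := Flow {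
  flowD : one_parameter X;
  flow_in : forall t : R, (0 <= t <= 1)%R -> U (X t) }.

Lemma slow_flow X n (t : R) : flow X -> (0 <= t)%R -> (n%:R * t <= 1)%R -> slow U n (X t).
Proof.
move=> fX t0 nt i le_i; rewrite -(one_parameterX (flowD fX)) //.
apply: flow_in => //; rewrite mulr_ge0 //=.
by apply: le_trans nt; rewrite ler_wpM2r // ler_nat.
Qed.

Lemma setexpg_rescaled n v (t : R) : (0 < n)%N -> slow U n v -> (0 <= t)%R ->
  (U `^^ (Num.truncn t).+2) (v ^^ Num.truncn (t * n%:R)%R).
Proof.
move=> n_gt0 sv t0; set k := Num.truncn (t * _)%R.
have k_le : (k <= (Num.truncn t).+1 * n)%N.
  rewrite -(ler_nat R) natrM; apply: (@le_trans _ _ (t * n%:R)%R).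
    by rewrite truncn_le mulr_ge0.
  by rewrite ler_wpM2r // ltW // truncnS_gt.
have q_le : (k %/ n <= (Num.truncn t).+1)%N by rewrite -(mulnK (Num.truncn t).+1 n_gt0) leq_div2r.
rewrite (divn_eq k n) expgnDr mulnC expgnA.
apply: (@setexpg_le _ _ (k %/ n + 1)) => //; first by rewrite addn1 ltnS.
apply: setexpgD; first by apply: setexpgX; exact: sv.
by rewrite setexpg1; apply: sv; rewrite ltnW // ltn_mod.
Qed.

Lemma limit_flow (I : Type) (F : set_system I) (n : I -> nat) (v : I -> L) :
  UltraFilter F -> F [set i | (0 < n i)%N] -> v @ F --> (1%g : L) ->
  F [set i | slow U (n i) (v i)] ->
  exists2 X, flow X & forall t : R, (0 <= t)%R ->
    v i ^^ Num.truncn (t * (n i)%:R)%R @[i --> F] --> X t.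
Proof.
move=> UF n_gt0 v1 sv.
have /choice[X XP] (t : R) : exists x : L, (0 <= t)%R ->
    v i ^^ Num.truncn (t * (n i)%:R)%R @[i --> F] --> x.
  have [t0|_] := lerP 0%R t; last by exists 1%g.
  have [|x _ xP] := ultra_compact_cvg (x := fun i => v i ^^ Num.truncn (t * (n i)%:R)%R) UF
     (@compact_setexpg _ _ (Num.truncn t).+2 cU); last by exists x.
  by apply: filterS2 n_gt0 sv => i n0 si; exact: setexpg_rescaled.
exists X => //; split=> [s t s0 t0|t /andP[t0 t1]].
  have /choice[e eP] i : exists e, (e <= 1)%N /\ Num.truncn ((s + t) * (n i)%:R)%R =
      (Num.truncn (s * (n i)%:R)%R + Num.truncn (t * (n i)%:R)%R + e)%N.
    rewrite mulrDl; have [e e1 ->] := truncnD_carry (mulr_ge0 s0 (ler0n R (n i)))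
      (mulr_ge0 t0 (ler0n R (n i))).
    by exists e.
  have carry1 : v i ^^ e i @[i --> F] --> (1%g : L).
    move=> O nO; have O1 := nbhs_singleton nO; have Ov : F [set i | O (v i)] by exact: v1.
    change (F [set i | O (v i ^^ e i)]); apply: filterS Ov => i Oi /=.
    by case: (eP i); case: (e i) => [|[|//]]; rewrite ?expg1.
  apply: (cvgg_unique _ (XP _ (addr_ge0 s0 t0))).
  rewrite -[X s ∙ X t]mulg1 (_ : (fun i => _) = (fun i => v i ^^ Num.truncn (s * (n i)%:R)%R ∙
    v i ^^ Num.truncn (t * (n i)%:R)%R ∙ v i ^^ e i)).
    exact: cvg_mulg (cvg_mulg (XP s s0) (XP t t0)) carry1.
  by apply/funext => i; rewrite (eP i).2 !expgnDr.
apply: closed_cvg (XP t t0); first exact: compact_closedg cU.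
apply: filterS sv => i si; apply: si; rewrite -(ler_nat R).
apply: (@le_trans _ _ (t * (n i)%:R)%R); first by rewrite truncn_le mulr_ge0.
by rewrite ler_piMl.
Qed.

Lemma slow_seq_limit_flow (I : Type) (F : set_system I) (n : I -> nat) (c : I -> L) :
  UltraFilter F -> (forall N, F [set i | (N < n i)%N]) -> (forall i, (0 < n i)%N) ->
  (forall i, slow U (n i) (c i)) ->
  exists X k, [/\ flow X, K k, forall i, slow U (n i) (c i ∙ k⁻¹) &
    forall (t : R) W, (0 <= t)%R -> nbhs 1%g W ->
      F [set i | W (((c i ∙ k⁻¹) ^^ Num.truncn (t * (n i)%:R)%R)⁻¹ ∙ X t)]].
Proof.
move=> UF n_lim n_gt0 sc.
have [|k _ ck] := ultra_compact_cvg (x := c) UF cU.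
  by apply: filterE => i; exact: slow_sub (sc i).
have Kk : K k.
  apply: slow_forever => N; apply: closed_cvg ck; first exact: closed_slow.
  by apply: filterS (n_lim N) => i /= /ltnW lt_Ni; exact: slow_le (sc i).
have sv i : slow U (n i) (c i ∙ k⁻¹) by apply: slowMr => //; exact: subgrpV.
have [|||X fX XP] := @limit_flow I F n (fun i => c i ∙ k⁻¹) UF.
- exact: filterE.
- by rewrite -(mulgV k); apply: cvg_mulg => //; exact: cvg_cst.
- exact: filterE.
exists X, k; split=> // t W t0 nW.
have lim1 : ((c i ∙ k⁻¹) ^^ Num.truncn (t * (n i)%:R)%R)⁻¹ ∙ X t @[i --> F] --> (X t)⁻¹ ∙ X t.
  by apply: cvg_mulg; [apply: cvg_invg; exact: XP|exact: cvg_cst].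
by rewrite mulVg in lim1; exact: lim1.
Qed.

Lemma slow_flow_quotient J : (0 < J)%N -> exists (N d : nat) (W : set L),
  [/\ (0 < d)%N, nbhs 1%g W & forall n X v, (N < n)%N -> flow X -> slow U n v ->
      W ((v ^^ Num.truncn (d%:R^-1 * n%:R : R)%R)⁻¹ ∙ X d%:R^-1%R) ->
      slow U (J * n) ((X n%:R^-1%R)⁻¹ ∙ v)].
Proof.
move=> J_gt0; have [N0 [d [W [d_gt0 nW quot]]]] := slow_quotient J_gt0.
have [W0 nW0 W0W] := set_nbhs_compact cK nW.
have [W1 [nW1 _ W1W0]] := nbhs_half nW0.
have [N2 _ N2P] := slow_sub_nbhs (@set_nbhs_setmulg L W1 K nW1).
have d0 : (0 < d%:R :> R)%R by rewrite ltr0n.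
exists (N0 + N2)%N, d, W1; split=> // n X v Nn fX sv.
have n0 : (0 < n%:R :> R)%R by rewrite ltr0n (leq_ltn_trans _ Nn).
set p := X n%:R^-1%R; pose k := (n %/ d)%N.
have nV0 : (0 <= n%:R^-1 :> R)%R by rewrite invr_ge0 ltW.
have -> : Num.truncn (d%:R^-1 * n%:R : R)%R = k.
  apply: truncn_def; rewrite mulrC ler_pdivlMr // ltr_pdivrMr // -!natrM ler_nat ltr_nat.
  by rewrite leq_divM /= ltn_ceil.
move=> W1v; pose r : R := (d%:R^-1 - k%:R * n%:R^-1)%R.
have nr : (n%:R * r = n%:R / d%:R - k%:R)%R by rewrite /r; field; rewrite !gt_eqF.
have r0 : (0 <= r)%R.
  rewrite -(pmulr_rge0 _ n0) nr subr_ge0 ler_pdivlMr //.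
  by rewrite -natrM ler_nat leq_divM.
have r1 : (n%:R * r <= 1)%R.
  rewrite nr lerBlDr addrC natr1 ler_pdivrMr // ltW //.
  by rewrite -natrM ltr_nat ltn_ceil.
have Xd : X d%:R^-1%R = p ^^ k ∙ X r.
  rewrite -(one_parameterX (flowD fX) k nV0) -(flowD fX) ?mulr_ge0 //; congr X.
  by rewrite /r addrC subrK.
have [w W1w [l Kl wl]] : (W1 `∙` K) (X r)⁻¹.
  apply: N2P; apply: symmetric_slow => //; apply: slow_flow => //.
  by apply: le_trans r1; rewrite ler_wpM2r // ler_nat ltnW // (leq_ltn_trans _ Nn) ?leq_addl.
apply: quot => //; first by rewrite ltnW // (leq_ltn_trans _ Nn) ?leq_addr.
  by apply: slow_flow => //; rewrite mulfV // gt_eqF.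
have -> : (v ^^ k)⁻¹ ∙ p ^^ k = ((v ^^ k)⁻¹ ∙ X d%:R^-1%R ∙ w) ∙ l.
  by rewrite -mulgA wl Xd; gsimp.
by apply: W0W; apply: mem_setmulg => //; apply: W1W0; exact: mem_setmulg.
Qed.

(* Otherwise the elements not approximated by any finite set of flows have, along an
   ultrafilter, a limit flow, which approximates them. *)
Lemma slow_approx_flow J : (0 < J)%N -> exists (N : nat) (l : seq (R -> L)),
  (forall X : R -> L, X \in l -> flow X) /\ forall n c, (N <= n)%N -> slow U n c ->
    exists2 X : R -> L, X \in l & slow U (J * n) ((X n%:R^-1%R)⁻¹ ∙ c).
Proof.
move=> J_gt0; apply: contrapT => no.
have /choice[nc ncP] (i : seq (R -> L) * nat) : exists nc : nat * L,
    [/\ (i.2 < nc.1)%N, slow U nc.1 nc.2 & forall X : R -> L, X \in i.1 -> flow X ->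
        ~ slow U (J * nc.1) ((X nc.1%:R^-1%R)⁻¹ ∙ nc.2)].
  apply: contrapT => no_nc; apply: no; exists i.2.+1, [seq X <- i.1 | `[< flow X >]].
  split=> [X|n c lt_n sc]; first by rewrite mem_filter => /andP[/asboolP].
  apply: contrapT => no_X; apply: no_nc; exists (n, c); split=> // X Xi fX sX.
  by apply: no_X; exists X => //; rewrite mem_filter Xi andbT; exact/asboolP.
have [|i j k [ij1 ij2] [jk1 jk2]|[l N] [l' N']|F [UF F_large]] :=
    @directed_ultrafilter (seq (R -> L) * nat)%type
    (fun i j => {subset i.1 <= j.1} /\ (i.2 <= j.2)%N) ([::], 0%N).
- by move=> i; split.
- by split; [move=> X /ij1 /jk1|exact: leq_trans jk2].
- exists (l ++ l', maxn N N'); rewrite /= ?leq_maxl ?leq_maxr.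
    by split=> // X Xl; rewrite mem_cat Xl.
  by split=> // X Xl; rewrite mem_cat Xl orbT.
pose n i := (nc i).1; pose c i := (nc i).2.
have n_lim N : F [set i | (N < n i)%N].
  apply: filterS (F_large ([::], N)) => i [_ /= le_N].
  by have [lt _ _] := ncP i; exact: leq_ltn_trans le_N lt.
have n_gt0 i : (0 < n i)%N by have [lt _ _] := ncP i; exact: leq_ltn_trans lt.
have sc i : slow U (n i) (c i) by have [] := ncP i.
have [X [k [fX Kk sv XP]]] := slow_seq_limit_flow UF n_lim n_gt0 sc.
have [N [d [W [d_gt0 nW quot]]]] := slow_flow_quotient J_gt0.
have dV0 : (0 <= d%:R^-1 :> R)%R by rewrite invr_ge0 ler0n.
have nearX := XP _ W dV0 nW.
have [i [[Wi [Xi _]] Ni]] :=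
  filter_ex (filterI (filterI nearX (F_large ([:: X], 0%N))) (n_lim N)).
have [_ _ nsX] := ncP i; apply: (nsX X) => //; first by apply: Xi; exact: mem_head.
rewrite -/(c i) -/(n i) -(mulgVK k (c i)) mulgA.
apply: slowMr => //; first by rewrite muln_gt0 J_gt0 n_gt0.
exact: quot.
Qed.

End IsolatedPair.

(** * A neighbourhood covered by products of flows *)

Section CvgToCompactSubgroup.
Variables (L : lcGroupType) (K : set L) (I : Type) (F : set_system I).
Hypotheses (cK : compact K) (sK : subgrp K) (FF : Filter F).
Implicit Types x y : I -> L.

Lemma cvg_set_nbhs_mulg x y :
  x @ F `=>` set_nbhs K -> y @ F `=>` set_nbhs K -> x i ∙ y i @[i --> F] `=>` set_nbhs K.
Proof.
move=> xK yK W nW; have [V [_ _ nV _ VW]] := compact_thickening cK sK 2 nW.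
have xV : F [set i | V (x i)] by exact: xK.
have yV : F [set i | V (y i)] by exact: yK.
change (F [set i | W (x i ∙ y i)]); apply: filterS2 xV yV => i Vx Vy; apply: VW.
by apply: mem_setmulg => //; rewrite setmulg1.
Qed.

Lemma cvg_set_nbhs_conjg x g : (forall k, K k -> K (k ^ g)%g) ->
  x @ F `=>` set_nbhs K -> (x i ^ g)%g @[i --> F] `=>` set_nbhs K.
Proof.
move=> Kg xK W nW; apply: (xK [set z | W (z ^ g)%g]) => k Kk.
apply: (@preimage_nbhs _ _ (fun z => z ^ g)%g); first by continuity.
by apply: nW; exact: Kg.
Qed.

End CvgToCompactSubgroup.

Section FlowProducts.
Variables (R : realType) (L : lcGroupType) (U K : set L).
Hypothesis iUK : isolated_pair U K.
Implicit Types (X : R -> L) (l : seq (R -> L)) (t : nat -> R) (tau : R).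

Let sK : subgrp K := nn_subgrp (isolated_nn iUK).
Let cK : compact K := nn_compact_subgrp (isolated_nn iUK).
Let U1 : U 1%g := nn_mem1 (isolated_nn iUK).

Fixpoint flow_product l t : L :=
  if l is X :: l' then X (t 0%N) ∙ flow_product l' (fun i => t i.+1) else 1%g.

Lemma flows_cons X l : {in X :: l, forall Y, flow U Y} ->
  flow U X /\ {in l, forall Y, flow U Y}.
Proof.
by move=> lP; split=> [|Y Yl]; apply: lP; [exact: mem_head|rewrite inE Yl orbT].
Qed.

Lemma flow_product0 l : {in l, forall X, flow U X} -> flow_product l (fun=> 0%R) = 1%g.
Proof.
by elim: l => //= X l IHl /flows_cons[fX /IHl ->]; rewrite (one_parameter0 (flowD fX)) mulg1.
Qed.

Lemma setexpg_flow_product l t m tau : {in l, forall X, flow U X} ->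
  (forall i, 0 <= t i <= tau)%R -> (m%:R * tau <= 1)%R ->
  (slow U m `^^ size l) (flow_product l t).
Proof.
elim: l t => //= X l IHl t /flows_cons[fX lP] t_tau m_tau; apply: mem_setmulg.
  have /andP[t0 t1] := t_tau 0%N; apply: slow_flow => //.
  by apply: le_trans m_tau; rewrite ler_wpM2l.
exact: IHl.
Qed.

Lemma flow_product_insert l t m tau (s : R) X : {in l, forall Y, flow U Y} -> X \in l ->
  (forall i, 0 <= t i <= tau)%R -> (0 <= s)%R -> (m%:R * tau <= 1)%R ->
  exists (t' : nat -> R) (a b : L), [/\ (forall i, 0 <= t' i <= tau + s)%R,
    flow_product l t = a ∙ b, flow_product l t' = a ∙ X s ∙ b & (slow U m `^^ size l) b].
Proof.
elim: l t => //= Y l IHl t /flows_cons[fY lP] Xl t_tau s0 m_tau.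
have slow1 : slow U m 1%g by exact: slow_mem1.
have t_le i : (0 <= t i <= tau + s)%R by have /andP[? ?] := t_tau i; apply/andP; split; lra.
move: Xl; rewrite inE => /predU1P[->|Xl].
  exists (fun i => if i is 0 then t 0%N + s else t i)%R, (Y (t 0%N)),
    (flow_product l (fun i => t i.+1)).
  have /andP[t0 t1] := t_tau 0%N; split=> //=.
  - by move=> [|i]; [apply/andP; split; lra|exact: t_le].
  - by rewrite (flowD fY).
  - by rewrite -[X in _ X]mul1g; apply: mem_setmulg => //; exact: setexpg_flow_product m_tau.
have [t' [a [b [t'_tau e e' sb]]]] := IHl (fun i => t i.+1) lP Xl (fun i => t_tau i.+1) s0 m_tau.
exists (fun i => if i is j.+1 then t' j else t 0%N), (Y (t 0%N) ∙ a), b; split=> /=.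
- by move=> [|i]; [exact: t_le|exact: t'_tau].
- by rewrite e mulgA.
- by rewrite e' !mulgA.
- by rewrite -[b]mul1g; exact: mem_setmulg.
Qed.

Lemma slow_flowVM X m (s s' : R) : flow U X -> (0 <= s)%R -> (0 <= s')%R ->
  (m%:R * `|s - s'| <= 1)%R -> slow U m ((X s)⁻¹ ∙ X s').
Proof.
wlog le_ss' : s s' / (s <= s')%R => [hwlog fX s0 s0' ms|fX s0 s0' ms].
  have [/hwlog|/ltW/hwlog hw] := leP s s'; first exact.
  rewrite -[_ ∙ _]invgK invgM invgK; apply: symmetric_slow.
    exact: nn_symmetric (isolated_nn iUK).
  by apply: hw => //; rewrite distrC.
have d0 : (0 <= s' - s)%R by rewrite subr_ge0.
have -> : X s' = X s ∙ X (s' - s)%R by rewrite -(flowD fX) // addrC subrK.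
by rewrite mulKg; apply: slow_flow => //; move: ms; rewrite distrC ger0_norm.
Qed.

Section Limits.
Variables (F : set_system nat) (UF : UltraFilter F).

Lemma slow_cvg_set_nbhs (x : nat -> L) :
  (forall m, F [set r | slow U m (x r)]) -> x @ F `=>` set_nbhs K.
Proof.
move=> sx W nW; have [m _ mW] := slow_sub_nbhs iUK nW.
by apply: filterS (sx m) => r /mW.
Qed.

Lemma flow_cvg_set_nbhs X (s : nat -> R) (s' : R) : flow U X -> (forall r, 0 <= s r)%R ->
  (0 <= s')%R -> s @ F --> s' -> (X s')⁻¹ ∙ X (s r) @[r --> F] `=>` set_nbhs K.
Proof.
move=> fX s_ge0 s'_ge0 ss'; apply: slow_cvg_set_nbhs => m.
have e0 : (0 < m.+1%:R^-1 :> R)%R by rewrite invr_gt0 ltr0n.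
have /(@cvgrPdist_le R R^o) /(_ _ e0) := ss'; apply: filterS => r /= le_e.
apply: slow_flowVM => //; apply: (@le_trans _ _ (m%:R / m.+1%:R)%R).
  by rewrite ler_wpM2l.
by rewrite ler_pdivrMr ?ltr0n // mul1r ler_nat.
Qed.

Lemma flow_product_cvg_set_nbhs l (t : nat -> nat -> R) (t' : nat -> R) :
  {in l, forall X, flow U X} -> (forall r i, 0 <= t r i)%R ->
  (forall i, 0 <= t' i <= 1)%R -> (forall i, (t^~ i) @ F --> t' i) ->
  (flow_product l t')⁻¹ ∙ flow_product l (t r) @[r --> F] `=>` set_nbhs K.
Proof.
elim: l t t' => [|X l IHl] t t' /=.
  move=> _ _ _ _ W nW; change (F [set r : nat | W (1⁻¹ ∙ 1)%g]).
  by apply: filterE => r; rewrite /= invg1 mul1g; apply: nbhs_singleton; apply: nW; exact: subgrp1.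
move=> /flows_cons[fX lP] t_ge0 t'_le1 tt'.
have := IHl (fun r i => t r i.+1) (fun i => t' i.+1) lP (fun r i => t_ge0 r i.+1)
  (fun i => t'_le1 i.+1) (fun i => tt' i.+1).
set p := flow_product l (fun i => t' i.+1) => cvg_l.
have cvg_X : (X (t' 0%N))⁻¹ ∙ X (t r 0%N) @[r --> F] `=>` set_nbhs K.
  by apply: flow_cvg_set_nbhs (tt' 0%N) => //; case/andP: (t'_le1 0%N).
have Kp k : K k -> K (k ^ p)%g.
  apply: (normalised_setexpg (n := size l) (nn_normalised (isolated_nn iUK))).
  apply: (setexpgS (slow_sub (isT : (0 < 1)%N))).
  by apply: (setexpg_flow_product (tau := 1%R)) => //; rewrite mul1r.
rewrite (_ : (fun r => _) = (fun r => ((X (t' 0%N))⁻¹ ∙ X (t r 0%N)) ^ p ∙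
  (p⁻¹ ∙ flow_product l (fun i => t r i.+1)))%g); last by apply/funext => r; gsimp.
by apply: cvg_set_nbhs_mulg => //; exact: cvg_set_nbhs_conjg cvg_X.
Qed.

End Limits.

Lemma flow_product_limit l (t : nat -> nat -> R) a : {in l, forall X, flow U X} ->
  (forall r i, 0 <= t r i <= 1)%R -> (forall r, slow U r ((flow_product l (t r))⁻¹ ∙ a)) ->
  exists t' k, [/\ (forall i, 0 <= t' i)%R, K k & a = flow_product l t' ∙ k].
Proof.
move=> lP t01 st; have [F [UF Fge]] := nat_ultrafilter.
have /choice[t' t'P] i : exists p : R, (t^~ i) @ F --> p /\ (0 <= p <= 1)%R.
  have [|p p01 tp] := ultra_compact_cvg (x := t^~ i) UF (@segment_compact R 0%R 1%R).
    by apply: filterE => r; rewrite /= in_itv /=; exact: t01.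
  by exists p; split=> //; move: p01; rewrite /= in_itv.
exists t', ((flow_product l t')⁻¹ ∙ a); split; last by gsimp.
  by move=> i; have [_ /andP[]] := t'P i.
have cvg_a : ((flow_product l t')⁻¹ ∙ flow_product l (t r)) ∙ ((flow_product l (t r))⁻¹ ∙ a)
    @[r --> F] `=>` set_nbhs K.
  apply: cvg_set_nbhs_mulg => //.
    apply: flow_product_cvg_set_nbhs => // [r i|i|i]; [|exact: (t'P i).2|exact: (t'P i).1].
    by case/andP: (t01 r i).
  apply: slow_cvg_set_nbhs => m.
  by apply: filterS (Fge m) => r /= mr; apply: slow_le (st r).
apply: (slow_forever iUK) => m.
have nm : set_nbhs K (slow U m.+1).
  move=> k Kk; apply: filterS (set_nbhs_setmulg (nbhs_slow iUK m.+1) Kk).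
  by move=> _ [y sy [k' Kk' <-]]; exact: (slowMr iUK).
have slow_a : F [set r | slow U m.+1 ((flow_product l t')⁻¹ ∙ flow_product l (t r) ∙
    ((flow_product l (t r))⁻¹ ∙ a))] by exact: cvg_a nm.
have [r] := filter_ex slow_a; rewrite /= mulgA mulgK.
exact: slow_le.
Qed.

Lemma exists_flow_refinement : exists (M : nat) (l : seq (R -> L)),
  [/\ (0 < M)%N, {in l, forall X, flow U X} & forall n t tau a, (M <= n)%N ->
    (forall i, 0 <= t i <= tau)%R -> (M%:R * tau <= 1)%R ->
    slow U n ((flow_product l t)⁻¹ ∙ a) ->
    exists t', (forall i, 0 <= t' i <= tau + n%:R^-1)%R /\
      slow U (2 * n) ((flow_product l t')⁻¹ ∙ a)].
Proof.
have [D D_gt0 slowD] := slowM R iUK.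
have D2_gt0 : (0 < D * 2)%N by rewrite muln_gt0 D_gt0.
have [N1 [V [nV comm]]] := slow_commutator R iUK D2_gt0.
have [N2 [l [lP approx]]] := slow_approx_flow R iUK D2_gt0.
have [U' [_ _ nU' _ U'V]] := compact_thickening cK sK (size l) nV.
have [M0 _ M0U'] := slow_sub_nbhs iUK nU'.
pose M := (M0 + N1 + N2).+1.
have slowV b : (slow U M `^^ size l) b -> V b.
  move=> sb; apply: U'V; apply: setexpgS sb => x sx; apply: M0U'.
  by apply: slow_le sx; rewrite /M; lia.
exists M, l; split=> // n t tau a Mn t_tau M_tau sc; set c := _ ∙ a in sc.
have n_gt0 : (0 < n)%N by exact: leq_trans Mn.
have nV0 : (0 <= n%:R^-1 :> R)%R by rewrite invr_ge0.
have [|X Xl sXc] := approx n c _ sc; first by apply: leq_trans Mn; rewrite /M; lia.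
have [t' [b [b' [t'_tau e e' sb']]]] := flow_product_insert lP Xl t_tau nV0 M_tau.
exists t'; split=> //.
have sX : slow U n (X n%:R^-1%R).
  by apply: slow_flow => //; [exact: lP|rewrite mulfV // pnatr_eq0 -lt0n].
rewrite (_ : _ ∙ a = [~ b', X n%:R^-1%R]%g ∙ ((X n%:R^-1%R)⁻¹ ∙ c)); last first.
  by rewrite /c e e' commgEr; gsimp.
apply: slowD; rewrite ?muln_gt0 // mulnA //; apply: comm => //; last exact: slowV.
by apply: leq_trans Mn; rewrite /M; lia.
Qed.

(* The total time spent in each flow is at most [2 / N], where [N = 2 * M]. *)
Lemma flow_product_approximations : exists (N : nat) (l : seq (R -> L)),
  {in l, forall X, flow U X} /\ forall a, slow U N a -> exists t : nat -> nat -> R,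
    (forall r i, 0 <= t r i <= 1)%R /\ forall r, slow U r ((flow_product l (t r))⁻¹ ∙ a).
Proof.
have [M [l [M_gt0 lP refine]]] := exists_flow_refinement.
pose N := (2 * M)%N; have N_gt0 : (0 < N)%N by rewrite muln_gt0.
exists N, l; split=> // a sa; have N0 : (0 < N%:R :> R)%R by rewrite ltr0n.
pose tau r : R := (2 / N%:R - 2 / (2 ^ r * N)%:R)%R.
have tau_le r : (tau r <= 2 / N%:R)%R by rewrite /tau lerBlDr lerDl divr_ge0.
have M_tau r : (M%:R * tau r <= 1)%R.
  apply: (@le_trans _ _ (M%:R * (2 / N%:R))%R); first by rewrite ler_wpM2l.
  by rewrite [leLHS](_ : _ = 1%R) // /N natrM; field; rewrite pnatr_eq0 -lt0n.
have /choice[t tP] r : exists t : nat -> R, (forall i, 0 <= t i <= tau r)%R /\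
    slow U (2 ^ r * N) ((flow_product l t)⁻¹ ∙ a).
  elim: r => [|r [t [t_tau st]]].
    exists (fun=> 0%R); rewrite flow_product0 // invg1 mul1g expn0 mul1n; split=> // i.
    by rewrite lexx /tau expn0 mul1n subrr lexx.
  have [|t' [t'_tau st']] := refine _ _ _ _ _ t_tau (M_tau r) st.
    by rewrite /N mulnA leq_pmull // muln_gt0 expn_gt0.
  exists t'; rewrite expnS -mulnA; split=> // i.
  suff -> : tau r.+1 = (tau r + (2 ^ r * N)%:R^-1)%R by [].
  by rewrite /tau expnS -mulnA (natrM _ 2) -/N; field; rewrite !gt_eqF.
exists t; split=> [r i|r]; last first.
  apply: slow_le (tP r).2; apply: leq_trans (leq_pmulr _ N_gt0).
  by rewrite ltnW // ltn_expl.
have /andP[-> t_le] := (tP r).1 i; apply: le_trans t_le (le_trans (tau_le r) _).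
by rewrite ler_pdivrMr // mul1r ler_nat /N leq_pmulr.
Qed.

Lemma flow_product_cover : exists (N : nat) (l : seq (R -> L)), {in l, forall X, flow U X} /\
  forall a, slow U N a -> exists t k,
    [/\ (forall i, 0 <= t i)%R, K k & a = flow_product l t ∙ k].
Proof.
have [N [l [lP approx]]] := flow_product_approximations; exists N, l; split=> // a.
by move=> /approx[t [t01 st]]; exact: flow_product_limit t01 st.
Qed.

End FlowProducts.

(** * Integer characters of direct sums of cyclic groups *)

Notation abelian_subgrp := (is_abelian_subgroup *%g 1%g monoid.inv).
Notation grp_prod := (gprod *%g 1%g).

Definition additive_on (G : groupType) (B : set G) (chi : G -> int) :=
  forall x y, B x -> B y -> chi (x ∙ y) = (chi x + chi y)%R.

Section AdditiveOn.
Variables (G : groupType) (B : set G) (chi : G -> int).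
Hypotheses (sB : subgrp B) (chiD : additive_on B chi).

Lemma additive_on1 : chi 1%g = 0%R.
Proof. by have := chiD (subgrp1 sB) (subgrp1 sB); rewrite mulg1; lia. Qed.

Lemma additive_onX g n : B g -> chi (g ^^ n) = (chi g * n%:Z)%R.
Proof.
move=> Bg; elim: n => [|n IHn]; first by rewrite additive_on1 mulr0.
by rewrite expgSr chiD ?IHn; [rewrite -addn1 PoszD mulrDr mulr1|exact: subgrpX|].
Qed.

End AdditiveOn.

Section GroupProducts.
Variables (G : groupType) (I : eqType).
Implicit Types (s : seq I) (y z : I -> G).

Lemma eq_grp_prod s y z : {in s, y =1 z} -> grp_prod s y = grp_prod s z.
Proof.
elim: s => //= i s IHs yz; rewrite yz ?mem_head // IHs // => j js.
by apply: yz; rewrite inE js orbT.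
Qed.

Lemma grp_prod1 s : grp_prod s (fun=> 1%g) = 1%g :> G.
Proof. by elim: s => //= i s ->; rewrite mulg1. Qed.

Lemma grp_prod_mul_at s y (g : G) i : uniq s -> i \in s -> (forall j, commute g (y j)) ->
  grp_prod s (fun j => if j == i then g ∙ y j else y j) = g ∙ grp_prod s y.
Proof.
move=> + + gy; elim: s => //= j s IHs /andP[js us]; rewrite inE => /predU1P[->|i_s].
  rewrite eqxx -mulgA; congr (_ ∙ (_ ∙ _)); apply: eq_grp_prod => k ks.
  by case: eqVneq => // kj; rewrite -kj ks in js.
rewrite IHs // ifN; last by apply: contraNneq js => ->.
by rewrite !mulgA (gy j).
Qed.

Lemma grp_prod_finite_order s y : (forall i j, commute (y i) (y j)) ->
  (forall i, finite_order (y i)) -> finite_order (grp_prod s y).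
Proof.
move=> comm_y fin_y; elim: s => [|i s IHs] /=; first exact: finite_order1.
apply: finite_orderM => //; elim: s {IHs} => [|j s IHs] /=; first exact: commute1.
exact: commuteM.
Qed.

End GroupProducts.

Section Words.
Variables (G : groupType) (B : set G) (I : eqType) (b : I -> G).
Hypotheses (aB : abelian_subgrp B) (Bb : forall i, B (b i)).
Implicit Types (w : seq (I * int)) (s : seq I) (i j : I) (g h : G).

Definition word_value w : G := foldr (fun p h => zpow (b p.1) p.2 ∙ h) 1%g w.

Definition word_coef i w : int := (\sum_(p <- w | p.1 == i) p.2)%R.

Definition word_inv w := [seq (p.1, - p.2)%R | p <- rev w].

Lemma word_value_cat w w' : word_value (w ++ w') = word_value w ∙ word_value w'.
Proof. by elim: w => [|p w IHw] /=; rewrite ?mul1g // IHw mulgA. Qed.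

Lemma word_value_inv w : word_value (word_inv w) = (word_value w)⁻¹.
Proof.
rewrite /word_inv; elim: w => [|p w IHw]; first by rewrite invg1.
by rewrite rev_cons map_rcons -cats1 word_value_cat IHw /= zpowN mulg1 invgM.
Qed.

Lemma word_coef_cat i w w' : word_coef i (w ++ w') = (word_coef i w + word_coef i w')%R.
Proof. exact: big_cat. Qed.

Lemma word_coef_inv i w : word_coef i (word_inv w) = (- word_coef i w)%R.
Proof. by rewrite /word_coef big_map -sumrN; apply: perm_big; rewrite perm_rev. Qed.

Let zpow_comm i j m n : commute (zpow (b i) m) (zpow (b j) n).
Proof. by apply: aB.2; apply: (cyclic_sub aB.1 (Bb _)); [exists m|exists n]. Qed.

Lemma word_value_grp_prod s w : uniq s -> {subset [seq p.1 | p <- w] <= s} ->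
  word_value w = grp_prod s (fun j => zpow (b j) (word_coef j w)).
Proof.
move=> us; elim: w => [|[i m] w IHw] ws.
  rewrite -[LHS](grp_prod1 _ s); apply: eq_grp_prod => j _.
  by rewrite /word_coef big_nil.
rewrite [LHS]/= IHw => [|j jw]; last by apply: ws; rewrite inE jw orbT.
rewrite -(grp_prod_mul_at us (ws _ (mem_head _ _))) => [|j]; last exact: zpow_comm.
apply: eq_grp_prod => j _; rewrite /word_coef big_cons /= [i == j]eq_sym.
by case: eqP => [->|//]; rewrite zpowD.
Qed.

Lemma grp_prod_word s (y : I -> G) : {in s, forall i, cyclic (b i) (y i)} ->
  exists w, grp_prod s y = word_value w.
Proof.
elim: s => [|i s IHs] ys; first by exists [::].
have [j js|w wE] := IHs; first by apply: ys; rewrite inE js orbT.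
have [m _ mE] := ys i (mem_head _ _).
by exists ((i, m) :: w); rewrite /= wE mE.
Qed.

Hypothesis indep : forall s (y : I -> G), uniq s -> {in s, forall i, cyclic (b i) (y i)} ->
  grp_prod s y = 1%g -> {in s, forall i, y i = 1%g}.

Lemma word_value1_coef w i : word_value w = 1%g -> zpow (b i) (word_coef i w) = 1%g.
Proof.
pose s := undup (i :: [seq p.1 | p <- w]); have us : uniq s by exact: undup_uniq.
rewrite (word_value_grp_prod us) => [w1|j jw]; last by rewrite mem_undup inE jw orbT.
apply: (indep us _ w1); last by rewrite mem_undup mem_head.
by move=> j _; exists (word_coef j w).
Qed.

Lemma infinite_order_coef w g : word_value w = g -> ~ finite_order g ->
  exists2 i, ~ finite_order (b i) & word_coef i w != 0%R.
Proof.
move=> <- inf_g; apply: contrapT => no; apply: inf_g.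
rewrite (word_value_grp_prod (undup_uniq [seq p.1 | p <- w])); last first.
  by move=> j; rewrite mem_undup.
apply: grp_prod_finite_order => [i j|i]; first exact: zpow_comm.
have [fin_i|inf_i] := pselect (finite_order (b i)); first exact: finite_order_zpow.
have [->|ci] := eqVneq (word_coef i w) 0%R; first exact: finite_order1.
by case: no; exists i.
Qed.

(* The character is the coefficient at a generator of infinite order, which does not depend on
   the word. *)
Lemma direct_sum_character g : (forall h, B h -> exists w, h = word_value w) ->
  B g -> ~ finite_order g -> exists2 chi, additive_on B chi & chi g != 0%R.
Proof.
move=> dec Bg inf_g.
have /choice[w wP] h : exists w, B h -> h = word_value w.
  by have [/dec[w ->]|nBh] := pselect (B h); [exists w|exists [::]].
have [i inf_i ci] := infinite_order_coef (esym (wP g Bg)) inf_g.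
exists (fun h => word_coef i (w h)) => // x y Bx By.
have Bxy : B (x ∙ y) by apply: subgrpM => //; exact: aB.1.
have := @word_value1_coef (w x ++ w y ++ word_inv (w (x ∙ y))) i.
rewrite !word_value_cat word_value_inv -!wP // mulgA mulgV => /(_ erefl) coef1.
apply/eqP; rewrite eq_sym -subr_eq0 -addrA -word_coef_inv -!word_coef_cat.
by apply: contra_notT inf_i; exact: zpow_eq1_finite_order coef1.
Qed.

End Words.

Notation class_G G := (@in_class_G G *%g 1%g monoid.inv).

Lemma finite_exponent (G : groupType) (B : set G) : finite_set B ->
  (forall g, B g -> finite_order g) ->
  exists2 e, (0 < e)%N & forall g, B g -> g ^^ e = 1%g.
Proof.
move=> /finite_seqP[s ->]; elim: s => [|g s IHs] fin; first by exists 1%N.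
have [|e e_gt0 eP] := IHs; first by move=> h hs; apply: fin; rewrite /= inE hs orbT.
have /finite_orderP[n n_gt0 gn] : finite_order g by apply: fin; rewrite /= mem_head.
exists (e * n)%N; first by rewrite muln_gt0 e_gt0.
move=> h; rewrite /= inE => /predU1P[->|hs].
  by rewrite mulnC expgnA gn expg1n.
by rewrite expgnA eP // expg1n.
Qed.

Section ClassG.
Variable G : groupType.
Hypothesis Gclass : class_G G.

Lemma class_G_character (B : set G) g : abelian_subgrp B -> B g -> ~ finite_order g ->
  exists2 chi, additive_on B chi & chi g != 0%R.
Proof.
move=> aB Bg inf_g; have [I [b [Bb [dec indep]]]] := Gclass.2 B aB.
apply: (direct_sum_character aB Bb indep _ Bg inf_g) => h /dec[s [y [_ [ys ->]]]].
exact: grp_prod_word ys.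
Qed.

Lemma divisible_abelian_trivial (B : set G) : abelian_subgrp B ->
  (forall g n, B g -> (0 < n)%N -> exists2 h, B h & h ^^ n = g) ->
  forall g, B g -> g = 1%g.
Proof.
move=> aB div.
have fin g : B g -> finite_order g.
  move=> Bg; apply: contrapT => inf_g.
  have [chi chiD /negP chi0] := class_G_character aB Bg inf_g; apply: chi0.
  have [h Bh hE] := div g `|chi g|%N.+1 Bg isT.
  have : chi g = (chi h * `|chi g|%N.+1%:Z)%R by rewrite -(additive_onX aB.1 chiD) // hE.
  move/(congr1 absz); rewrite abszM -absz_eq0; case: (`|chi h|)%N => [|k] /=; first by move=> ->.
  by nia.
have [e e_gt0 eP] := finite_exponent (Gclass.1 B (conj aB.1 fin)) fin.
by move=> g Bg; have [h Bh <-] := div g e Bg e_gt0; exact: eP.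
Qed.

End ClassG.

(** * Homomorphisms into groups of the class *)

Lemma sum_expn_split b m M : (m <= M)%N ->
  (\sum_(j < M) b ^ j = \sum_(j < m) b ^ j + (\sum_(j < M - m) b ^ j) * b ^ m)%N.
Proof.
move=> mM; rewrite -[in LHS](subnKC mM) big_split_ord /= big_distrl /=; congr addn.
by apply: eq_bigr => j _; rewrite -expnD addnC.
Qed.

(* Such an [h] is [- d / (b - 1)] in the [b]-adic integers, which is not an integer. *)
Lemma adic_geometric_series (d h : int) (b := `|d|%N.+2) :
  (forall m, exists z : int,
     h = (d * (\sum_(j < m) b ^ j)%N%:Z + z * (b ^ m)%N%:Z)%R) -> d = 0%R.
Proof.
move=> hP; pose w := (`|d|%N.+1%:Z * h + d)%R.
have dvd_w m : (b ^ m %| `|w|)%N.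
  have [z hz] := hP m; have := predn_exp b m.
  have : (0 < b ^ m)%N by rewrite expn_gt0.
  rewrite /w hz; move: (b ^ m)%N (\sum_(j < m) _)%N => p s p_gt0 /= ps.
  have {}ps : (`|d|%N.+1%:Z * s%:Z = p%:Z - 1)%R by lia.
  rewrite (_ : (_ + d = p%:Z * (d + `|d|%N.+1%:Z * z))%R) ?abszM ?dvdn_mulr //.
  by rewrite mulrDr mulrCA ps; ring.
have w0 : w = 0%R.
  apply/eqP; rewrite -absz_eq0; apply/eqP; case: (posnP `|w|%N) => // w_gt0.
  by have := dvdn_leq w_gt0 (dvd_w `|w|%N); rewrite leqNgt ltn_expl.
have : (`|d|.+1 * `|h| = `|d|)%N by rewrite -[RHS]abszN -[(- d)%R](addKr h) -?abszM; lia.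
by case: (`|h|)%N => [|k]; lia.
Qed.

Section CompactGroups.
Variable L : lcGroupType.
Implicit Types (A : set L) (x y : L).

Lemma compact_additive_trivial A (h : L -> int) : compact A -> subgrp A -> additive_on A h ->
  forall x, A x -> h x = 0%R.
Proof.
move=> cA sA hD x Ax; pose b := `|h x|%N.+2; pose S m := (\sum_(j < m) b ^ j)%N.
have [F [UF Fge]] := nat_ultrafilter.
have lim (u : nat -> nat) : exists2 y, A y & x ^^ u M @[M --> F] --> y.
  by apply: ultra_compact_cvg => //; apply: filterE => M; exact: subgrpX.
have [y Ay yP] := lim S.
apply: (@adic_geometric_series (h x) (h y)) => m; have [z Az zP] := lim (fun M => S (M - m)%N).
exists (h z).
have -> : y = x ^^ S m ∙ z ^^ (b ^ m).
  apply: (cvgg_unique _ yP).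
  have FO O : nbhs (x ^^ S m ∙ z ^^ (b ^ m)) O ->
      F [set M | O (x ^^ S m ∙ (x ^^ S (M - m)%N) ^^ (b ^ m))].
    exact: (cvg_mulg (cvg_cst (x ^^ S m)) (cvg_expg (n := b ^ m) zP)).
  move=> O /FO nO; change (F [set M | O (x ^^ S M)]).
  by apply: filterS2 (Fge m) nO => M /= mM; rewrite -expgnA -expgnDr -sum_expn_split.
by rewrite hD ?(additive_onX sA hD) //; exact: subgrpX.
Qed.

End CompactGroups.

Section OneParameterTrivial.
Variables (R : realFieldType) (G : groupType) (u : R -> G).
Hypothesis uD : one_parameter u.
Local Open Scope ring_scope.

Let quotients : set G := [set u s ∙ (u t)⁻¹ | s in [set s | 0 <= s] & t in [set t | 0 <= t]].

Let commute_u s t : 0 <= s -> 0 <= t -> commute (u s) (u t).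
Proof. by move=> s0 t0; rewrite /commute -!uD // addrC. Qed.

Let quotientM s t s' t' : 0 <= s -> 0 <= t -> 0 <= s' -> 0 <= t' ->
  (u s ∙ (u t)⁻¹) ∙ (u s' ∙ (u t')⁻¹) = u (s + s') ∙ (u (t + t'))⁻¹.
Proof.
move=> s0 t0 s'0 t'0; rewrite (addrC t) !uD // invgM !mulgA; congr (_ ∙ _).
by rewrite -!mulgA; congr (_ ∙ _); apply: commute_sym; exact/commuteV/commute_u.
Qed.

Lemma one_parameter_quotients_abelian : abelian_subgrp quotients.
Proof.
split; last first.
  move=> _ _ [s s0 [t t0 <-]] [s' s'0 [t' t'0 <-]].
  by rewrite !quotientM // (addrC s) (addrC t).
split; first by exists 0 => //=; exists 0 => //=; rewrite mulgV.
split=> [_ _ [s s0 [t t0 <-]] [s' s'0 [t' t'0 <-]]|_ [s s0 [t t0 <-]]].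
  rewrite quotientM //; exists (s + s'); first exact: addr_ge0.
  by exists (t + t') => //; exact: addr_ge0.
by exists t => //; exists s => //; rewrite invgM invgK.
Qed.

Lemma one_parameter_trivial : class_G G -> forall t, 0 <= t -> u t = 1%g.
Proof.
move=> Gclass t t0; apply: (divisible_abelian_trivial Gclass one_parameter_quotients_abelian).
  move=> _ n [s s0 [s' s'0 <-]] n_gt0; have n0 : n%:R != 0 :> R by rewrite pnatr_eq0 -lt0n.
  have [q0 q'0] : 0 <= s / n%:R /\ 0 <= s' / n%:R by rewrite !divr_ge0.
  exists (u (s / n%:R) ∙ (u (s' / n%:R))⁻¹).
    by exists (s / n%:R) => //; exists (s' / n%:R).
  rewrite expgMn ?expVgn; last exact/commuteV/commute_u.
  by rewrite -!(one_parameterX uD) // ![n%:R * _]mulrC !divfK.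
by exists t => //; exists 0 => //=; rewrite (one_parameter0 uD) invg1 mulg1.
Qed.

End OneParameterTrivial.

Section Homomorphism.
Variables (L : lcGroupType) (G : groupType) (f : L -> G).
Hypotheses (fM : {morph f : x y / x ∙ y}) (Gclass : class_G G).
Implicit Types (K V : set L) (x : L).

Lemma compact_finite_order K x : compact K -> subgrp K -> K x -> finite_order (f x).
Proof.
move=> cK sK Kx; apply: contrapT => inf_fx; pose A := closure (cyclic x).
have sA : subgrp A := closure_subgrp (subgrp_cyclic x).
have Ax : A x by apply: subset_closure; exact: cyclic_id.
have cA : compact A := compact_closure_sub cK (cyclic_sub sK Kx).
have aB : abelian_subgrp (f @` A).
  split; first exact: subgrp_image.
  move=> _ _ [y Ay <-] [z Az <-]; rewrite -!fM; congr f.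
  by apply: (closure_commute _ Ay Az) => v w xv xw; apply: (@cyclic_comm _ x); exact: mem_set.
have [|chi chiD /negP] := class_G_character Gclass aB _ inf_fx; first by exists x.
apply; apply/eqP; apply: (compact_additive_trivial (h := chi \o f) cA sA _ Ax) => y z Ay Az.
by rewrite /= fM; apply: chiD; [exists y|exists z].
Qed.

Lemma compact_image_finite K : compact K -> subgrp K -> finite_set (f @` K).
Proof.
move=> cK sK; apply: Gclass.1; split; first exact: subgrp_image.
by move=> _ [x Kx <-]; exact: compact_finite_order Kx.
Qed.

Lemma flow_product_trivial (R : realType) (U : set L) (l : seq (R -> L)) t :
  {in l, forall X, flow U X} -> (forall i, 0 <= t i)%R -> f (flow_product l t) = 1%g.
Proof.
elim: l t => [|X l IHl] t /=; first by move=> _ _; exact: morph_one.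
move=> /flows_cons[fX lP] t_ge0; rewrite fM IHl // mulg1.
apply: (@one_parameter_trivial R G (f \o X)) => // s s' s0 s'0.
by rewrite /= (flowD fX) // fM.
Qed.

Lemma image_nbhs_finite (R : realType) : exists2 V, nbhs 1%g V & finite_set (f @` V).
Proof.
have [U [K iUK]] := exists_isolated_pair R L.
have [N [l [lP cover]]] := flow_product_cover R iUK.
have [_ _ cK sK _ _] := isolated_nn iUK.
exists (slow U N); first exact: nbhs_slow iUK N.
apply: sub_finite_set (compact_image_finite cK sK) => _ [a sa <-].
have [t [k [t_ge0 Kk ->]]] := cover a sa; exists k => //.
by rewrite fM (flow_product_trivial lP) // mul1g.
Qed.

Definition local_image : set G := \bigcap_(V in nbhs (1%g : L)) f @` V.

Lemma local_image_attained (R : realType) : exists2 V, nbhs 1%g V & f @` V `<=` local_image.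
Proof.
have [V0 nV0 finV0] := image_nbhs_finite R.
have /choice[W WP] g : exists W, nbhs 1%g W /\ (local_image g \/ ~ (f @` W) g).
  have [Fg|] := pselect (local_image g); first by exists setT; split; [exact: filterT|left].
  by move/existsNP => [W /not_implyP[nW nWg]]; exists W; split; [|right].
have /finite_seqP[s sE] := finV0; exists (V0 `&` [set x | forall g, g \in s -> W g x]).
  by apply: filterI => //; apply: filter_forall_seq => g; exact: (WP g).1.
move=> _ [x [V0x Wx] <-]; have [_ [//|]] := WP (f x); case; exists x => //; apply: Wx.
by have : (f @` V0) (f x); [exists x|rewrite sE].
Qed.

Lemma subgrp_local_image (R : realType) : subgrp local_image.
Proof.
have [V nV VF] := local_image_attained R; have [W [nW symW WV]] := nbhs_half nV.
split; first by move=> U nU; exists 1%g; [exact: nbhs_singleton|exact: morph_one].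
split=> [g h Fg Fh|g Fg]; have [x Wx <-] := Fg W nW.
  have [y Wy <-] := Fh W nW.
  by apply: VF; exists (x ∙ y); [apply: WV; exact: mem_setmulg|rewrite fM].
apply: VF; exists x⁻¹; last exact: morph_invg.
apply: WV; rewrite -[x⁻¹]mulg1; apply: mem_setmulg; first exact: symW.
exact: nbhs_singleton.
Qed.

Lemma local_image_normalised x : normalizes *%g monoid.inv (f x) local_image.
Proof.
have conj y g : local_image g -> local_image (f y ∙ g ∙ (f y)⁻¹).
  move=> Fg V nV; have nW : nbhs (1%g : L) [set z | V (y ∙ z ∙ y⁻¹)].
    by apply: (@preimage_nbhs _ _ (fun z => y ∙ z ∙ y⁻¹)); [continuity|rewrite mulg1 mulgV].
  by have [z Vz <-] := Fg _ nW; exists (y ∙ z ∙ y⁻¹); rewrite ?fM ?(morph_invg fM).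
apply/seteqP; split=> [_ [h Fh <-]|g Fg]; first exact: conj.
exists ((f x)⁻¹ ∙ g ∙ f x); last by gsimp.
by have := conj x⁻¹ g Fg; rewrite (morph_invg fM) invgK.
Qed.

Lemma locally_constant_or_normalizes (R : realType) :
  (forall x, nbhs x [set y | f y = f x]) \/
  exists F : set G, [/\ subgrp F, finite_set F, F <> [set 1%g] &
    forall x, normalizes *%g monoid.inv (f x) F].
Proof.
have [F1|] := pselect (local_image = [set 1%g]); [left=> x|right].
  have [V nV] := local_image_attained R; rewrite F1 => V1.
  apply: filterS (nbhs_mulgV x nV) => y /= Vyx.
  have := V1 _ (ex_intro2 _ _ _ Vyx erefl); rewrite fM (morph_invg fM) /= => fyx.
  by apply: (@mulIg _ (f x)⁻¹); rewrite fyx mulgV.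
have [V nV finV] := image_nbhs_finite R.
exists local_image; split=> //; [exact: subgrp_local_image R| |exact: local_image_normalised].
by apply: sub_finite_set finV => g /(_ V nV).
Qed.

End Homomorphism.

Section GroupOfLaws.
Variables (T : Type) (mul : T -> T -> T) (one : T) (inv : T -> T).
Hypothesis gT : is_group mul one inv.

Lemma is_group_mulV : right_inverse one inv mul.
Proof.
move=> x; rewrite -(grp_mul1 gT (mul x (inv x))) -[in X in mul X _](grp_mulV gT (inv x)).
rewrite -(grp_assoc gT) [mul (inv x) (mul _ _)](grp_assoc gT) (grp_mulV gT).
by rewrite (grp_mul1 gT) (grp_mulV gT).
Qed.

Lemma is_group_mul1 : right_id one mul.
Proof.
by move=> x; rewrite -(grp_mulV gT x) (grp_assoc gT) is_group_mulV (grp_mul1 gT).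
Qed.

End GroupOfLaws.

Theorem theoremD
  (L : topologicalType) (mulL : L -> L -> L) (oneL : L) (invL : L -> L)
  (HL : is_group mulL oneL invL)
  (Hmul_cont : continuous (fun p : L * L => mulL p.1 p.2))
  (Hinv_cont : continuous invL)
  (Hhaus : hausdorff_space L)
  (Hlc : locally_compact [set: L])
  (G : discreteTopologicalType) (mulG : G -> G -> G) (oneG : G) (invG : G -> G)
  (HG : is_group mulG oneG invG)
  (HGclass : in_class_G mulG oneG invG)
  (phi : L -> G)
  (Hphi : forall x y, phi (mulL x y) = mulG (phi x) (phi y)) :
  continuous phi \/
  exists F : set G,
    [/\ is_subgroup mulG oneG invG F, finite_set F, F <> [set oneG] &
        forall x : L, normalizes mulG invG (phi x) F].
Proof.
pose L' : PreTopologicalGroup.type := HB.pack L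
  (isGroup.Build L (grp_assoc HL) (grp_mul1 HL) (is_group_mul1 HL) (grp_mulV HL)
    (is_group_mulV HL)).
pose Llc : lcGroupType := HB.pack L L'
  (PreTopologicalGroup_isLocallyCompact.Build L' Hmul_cont Hinv_cont Hhaus Hlc).
pose G' : groupType := HB.pack G
  (isGroup.Build G (grp_assoc HG) (grp_mul1 HG) (is_group_mul1 HG) (grp_mulV HG)
    (is_group_mulV HG)).
have [const|norm] := @locally_constant_or_normalizes Llc G' phi Hphi HGclass Rdefinitions.R.
  by left=> x; apply: cvg_near_cst; exact: const.
by right.
Qed.
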